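(* The theory $\mathrm{CT}_0 + \mathrm{GRP} + \mathrm{ASP}$ (that is, $\mathrm{CT}_0$ extended with the Global Reflection Principle and the Axiom Soundness Property for $\mathrm{PA}$) is $\mathrm{PA}$-relatively definable in $\mathrm{CT}_0$: there is a formula $T'(x)$ of the language $\mathcal{L}_{\mathrm{PA}}\cup\{T\}$ such that $\mathrm{CT}_0$ proves every axiom of $\mathrm{CT}_0+\mathrm{GRP}+\mathrm{ASP}$ with the predicate $T$ replaced throughout by the formula $T'$ (the arithmetical vocabulary being left unchanged). In particular, $\mathrm{CT}_0$ is not conservative over $\mathrm{PA}$, i.e. there is an arithmetical sentence provable in $\mathrm{CT}_0$ but not in $\mathrm{PA}$.
   Context: Arithmetization. $\mathcal{L}_{\mathrm{PA}}$ is the language of Peano Arithmetic with function symbols $0,S,+,\times$ and equality as the only predicate symbol; formulae are built from atomic formulae $s=t$ by $\neg,\wedge,\vee,\exists,\forall$. Fix a Gödel coding; syntactic objects are identified with their codes, and all syntactic notions are expressed by natural arithmetical formulae (so in nonstandard models codes may be nonstandard). $\underline{x}$ is the (code of the) numeral $SS\ldots S0$ with $x$ occurrences of $S$; $t^{\circ}$ is the value of a closed term $t$. Inside the theories, variables $\phi,\psi$ range over codes of $\mathcal{L}_{\mathrm{PA}}$-sentences, $\phi(v)$ over codes of $\mathcal{L}_{\mathrm{PA}}$-formulae with at most the free variable $v$, $s,t$ over codes of closed terms, $v$ (in syntactic positions) over codes of variables; $\phi(t)$ denotes the result of substituting $t$ for the free occurrences of $v$ in $\phi(v)$ (it is $\phi$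 itself if $\phi$ is a sentence). $\mathrm{CT}^-$ is the theory in $\mathcal{L}_{\mathrm{PA}}\cup\{T\}$ ($T$ a unary predicate) with the axioms of $\mathrm{PA}$ (induction only for arithmetical formulae) and, for $\otimes\in\{\wedge,\vee\}$, $Q\in\{\forall,\exists\}$: (1) $\forall s,t\,(T(s=t)\leftrightarrow s^{\circ}=t^{\circ})$; (2) $\forall\phi,\psi\,(T(\phi\otimes\psi)\leftrightarrow T\phi\otimes T\psi)$; (3) $\forall\phi\,(T(\neg\phi)\leftrightarrow\neg T\phi)$; (4) $\forall v,\phi(v)\,(T(Qv\,\phi(v))\leftrightarrow Qx\,T(\phi(\underline{x})))$. $\mathrm{CT}_0$ is $\mathrm{CT}^-$ plus the induction scheme for all $\Delta_0$ formulae (all quantifiers bounded) of $\mathcal{L}_{\mathrm{PA}}\cup\{T\}$. For a formula $\tau(y)$, $\mathrm{Pr}_{\tau}(x)$ is the formula formalizing ''there is a proof of the sentence $x$ in the sequent calculus for first-order logic in which additional initial sequents $\longrightarrow\phi$ are allowed for all sentences $\phi$ with $\tau(\phi)$''. The Global Reflection Principle $\mathrm{GRP}$ is $\forall\phi\,(\mathrm{Pr}_T(\phi)\rightarrow T(\phi))$. $\mathrm{Ax}_{\mathrm{PA}}(x)$ represents the set of axioms of $\mathrm{PA}$ (axioms being sentences). The Axiom Soundness Property for $\mathrm{PA}$, $\mathrm{ASP}$, is $\forall\phi\,(\mathrm{Ax}_{\mathrm{PA}}(\phi)\rightarrow T(\phi))$. *)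

(* Defs.v *)
From Stdlib Require Import List Arith.
Import ListNotations.

Set Implicit Arguments.
Unset Strict Implicit.
Set Contextual Implicit.
Unset Printing Implicit Defensive.

(** * First-order syntax over 0, S, +, *, = *)

Inductive term : Type :=
| Var (v : nat)
| Zero
| Succ (t : term)
| Plus (s t : term)
| Times (s t : term).

(* [P] is the type of the unary predicate symbols other than equality. *)
Inductive form (P : Type) : Type :=
| FEq (s t : term)
| FPred (p : P) (t : term)
| FNeg (A : form P)
| FAnd (A B : form P)
| FOr (A B : form P)
| FEx (v : nat) (A : form P)
| FAll (v : nat) (A : form P).

Definition FImp P (A B : form P) : form P := FOr (FNeg A) B.

Notation LPA := (form Empty_set).
Notation LPAT := (form unit).

Fixpoint fvt (t : term) : list nat :=
  match t with
  | Var v => [v]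
  | Zero => []
  | Succ t => fvt t
  | Plus s t | Times s t => fvt s ++ fvt t
  end.

Fixpoint fv P (A : form P) : list nat :=
  match A with
  | FEq s t => fvt s ++ fvt t
  | FPred _ t => fvt t
  | FNeg A => fv A
  | FAnd A B | FOr A B => fv A ++ fv B
  | FEx v A | FAll v A => remove Nat.eq_dec v (fv A)
  end.

Definition sentence P (A : form P) : Prop := fv A = [].

Fixpoint substt (v : nat) (r t : term) : term :=
  match t with
  | Var u => if u =? v then r else Var u
  | Zero => Zero
  | Succ t => Succ (substt v r t)
  | Plus s t => Plus (substt v r s) (substt v r t)
  | Times s t => Times (substt v r s) (substt v r t)
  end.

(* Replaces the free occurrences of [v] without renaming bound variables: it
   is meant to be used only when [free_for r v A] holds. *)
Fixpoint subst P (v : nat) (r : term) (A : form P) : form P :=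
  match A with
  | FEq s t => FEq (substt v r s) (substt v r t)
  | FPred p t => FPred p (substt v r t)
  | FNeg A => FNeg (subst v r A)
  | FAnd A B => FAnd (subst v r A) (subst v r B)
  | FOr A B => FOr (subst v r A) (subst v r B)
  | FEx u A => FEx u (if u =? v then A else subst v r A)
  | FAll u A => FAll u (if u =? v then A else subst v r A)
  end.

Fixpoint free_for P (r : term) (v : nat) (A : form P) : Prop :=
  match A with
  | FEq _ _ | FPred _ _ => True
  | FNeg A => free_for r v A
  | FAnd A B | FOr A B => free_for r v A /\ free_for r v B
  | FEx u B | FAll u B =>
      ~ In v (fv A) \/ (~ In u (fvt r) /\ free_for r v B)
  end.

(** * Sequent calculus *)

Definition atomic P (A : form P) : Prop :=
  match A with FEq _ _ | FPred _ _ => True | _ => False end.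

Section SequentCalculus.
Variables (P : Type) (Ax : form P -> Prop).
Local Notation seqt := (list (form P)).

(* [LK_struct] is weakening, contraction and exchange at once. *)
Inductive LK : seqt -> seqt -> Prop :=
| LK_id A : LK [A] [A]
| LK_ax A : sentence A -> Ax A -> LK [] [A]
| LK_refl t : LK [] [FEq t t]
| LK_eq s t v A : atomic A ->
    LK [FEq s t; subst v s A] [subst v t A]
| LK_struct G D G' D' : LK G D -> incl G G' -> incl D D' -> LK G' D'
| LK_cut A G D : LK G (A :: D) -> LK (A :: G) D -> LK G D
| LK_negL A G D : LK G (A :: D) -> LK (FNeg A :: G) D
| LK_negR A G D : LK (A :: G) D -> LK G (FNeg A :: D)
| LK_andL A B G D : LK (A :: B :: G) D -> LK (FAnd A B :: G) D
| LK_andR A B G D : LK G (A :: D) -> LK G (B :: D) -> LK G (FAnd A B :: D)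
| LK_orL A B G D : LK (A :: G) D -> LK (B :: G) D -> LK (FOr A B :: G) D
| LK_orR A B G D : LK G (A :: B :: D) -> LK G (FOr A B :: D)
| LK_allL v A r G D : free_for r v A ->
    LK (subst v r A :: G) D -> LK (FAll v A :: G) D
| LK_allR v A u G D : free_for (Var u) v A ->
    (forall B, In B (G ++ FAll v A :: D) -> ~ In u (fv B)) ->
    LK G (subst v (Var u) A :: D) -> LK G (FAll v A :: D)
| LK_exL v A u G D : free_for (Var u) v A ->
    (forall B, In B (FEx v A :: G ++ D) -> ~ In u (fv B)) ->
    LK (subst v (Var u) A :: G) D -> LK (FEx v A :: G) D
| LK_exR v A r G D : free_for r v A ->
    LK G (subst v r A :: D) -> LK G (FEx v A :: D).

Definition provable (A : form P) : Prop := LK [] [A].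

End SequentCalculus.

(** * Replacing predicate symbols by formulae *)

Definition fresh (s : nat -> term) (vs : list nat) : nat :=
  S (list_max (flat_map (fun u => fvt (s u)) vs)).

Definition upd X (s : nat -> X) (v : nat) (x : X) : nat -> X :=
  fun u => if u =? v then x else s u.

Fixpoint csubstt (s : nat -> term) (t : term) : term :=
  match t with
  | Var v => s v
  | Zero => Zero
  | Succ t => Succ (csubstt s t)
  | Plus t1 t2 => Plus (csubstt s t1) (csubstt s t2)
  | Times t1 t2 => Times (csubstt s t1) (csubstt s t2)
  end.

(* Simultaneous substitution; every bound variable is renamed so that nothing
   is captured. *)
Fixpoint csubst P (s : nat -> term) (A : form P) : form P :=
  match A with
  | FEq t1 t2 => FEq (csubstt s t1) (csubstt s t2)
  | FPred p t => FPred p (csubstt s t)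
  | FNeg A => FNeg (csubst s A)
  | FAnd A B => FAnd (csubst s A) (csubst s B)
  | FOr A B => FOr (csubst s A) (csubst s B)
  | FEx v B =>
      let w := fresh s (fv A) in FEx w (csubst (upd s v (Var w)) B)
  | FAll v B =>
      let w := fresh s (fv A) in FAll w (csubst (upd s v (Var w)) B)
  end.

Fixpoint replace_preds P Q (F : P -> term -> form Q) (A : form P) : form Q :=
  match A with
  | FEq s t => FEq s t
  | FPred p t => F p t
  | FNeg A => FNeg (replace_preds F A)
  | FAnd A B => FAnd (replace_preds F A) (replace_preds F B)
  | FOr A B => FOr (replace_preds F A) (replace_preds F B)
  | FEx v A => FEx v (replace_preds F A)
  | FAll v A => FAll v (replace_preds F A)
  end.

Definition embed P (A : LPA) : form P :=
  replace_preds (fun p : Empty_set => match p with end) A.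

(* [T'] is a formula [T'(x)] with [x] the variable number 0. *)
Definition replace_T (T' : LPAT) (A : LPAT) : LPAT :=
  replace_preds (fun _ t => csubst (upd Var 0 t) T') A.

Definition PA_relatively_definable (U V : LPAT -> Prop) : Prop :=
  exists T' : LPAT,
    (forall v, In v (fv T') -> v = 0) /\
    (forall A, U A -> provable V (replace_T T' A)).

(** * Writing formulae with Rocq binders *)

(* [F : bform P] denotes the formula [F n], where [n] is any number such that
   all the variables with index at least [n] may be used as bound variables,
   i.e. [n] exceeds all the variables occurring in the terms from which [F] is
   built. A closed [F] denotes the sentence [F 0]. *)
Definition bform (P : Type) : Type := nat -> form P.

Section Builders.
Variable P : Type.
Implicit Types F G : bform P.

Definition beq (s t : term) : bform P := fun _ => FEq s t.
Definition bneg F : bform P := fun n => FNeg (F n).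
Definition band F G : bform P := fun n => FAnd (F n) (G n).
Definition bor F G : bform P := fun n => FOr (F n) (G n).
Definition bimp F G : bform P := fun n => FImp (F n) (G n).
Definition biff F G : bform P := band (bimp F G) (bimp G F).
Definition bex (F : term -> bform P) : bform P :=
  fun n => FEx n (F (Var n) (S n)).
Definition ball (F : term -> bform P) : bform P :=
  fun n => FAll n (F (Var n) (S n)).

End Builders.

Declare Scope arith_scope.
Delimit Scope arith_scope with arith.
Bind Scope arith_scope with bform.
Local Open Scope arith_scope.

Notation "s ≐ t" := (beq s t) (at level 70) : arith_scope.
Notation "¬ F" := (bneg F) (at level 75, right associativity) : arith_scope.
Notation "F ∧ G" := (band F G) (at level 80, right associativity) : arith_scope.
Notation "F ∨ G" := (bor F G) (at level 85, right associativity) : arith_scope.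
Notation "F → G" :=
  (bimp F G) (at level 99, G at level 200, right associativity) : arith_scope.
Notation "F ↔ G" := (biff F G) (at level 95, no associativity) : arith_scope.
Notation "∃ x .. y , F" := (bex (fun x => .. (bex (fun y => F)) ..))
  (at level 10, x binder, y binder, F at level 200) : arith_scope.
Notation "∀ x .. y , F" := (ball (fun x => .. (ball (fun y => F)) ..))
  (at level 10, x binder, y binder, F at level 200) : arith_scope.

(** * Peano Arithmetic *)

Definition PA_basic : list LPA :=
  [ (∀ x, ¬ Succ x ≐ Zero) 0;
    (∀ x y, Succ x ≐ Succ y → x ≐ y) 0;
    (∀ x, Plus x Zero ≐ x) 0;
    (∀ x y, Plus x (Succ y) ≐ Succ (Plus x y)) 0;
    (∀ x, Times x Zero ≐ Zero) 0;
    (∀ x y, Times x (Succ y) ≐ Plus (Times x y) x) 0 ].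

(* Both [Zero] and [Succ (Var v)] are free for [v] in every formula. *)
Definition induction P (v : nat) (A : form P) : form P :=
  FImp (FAnd (subst v Zero A) (FAll v (FImp A (subst v (Succ (Var v)) A))))
       (FAll v A).

(* The universal closures of [A]: the sentences obtained from [A] by prefixing
   universal quantifiers. *)
Definition closure_of P (A B : form P) : Prop :=
  sentence B /\ exists vs : list nat, B = fold_right (@FAll P) A vs.

Inductive PA : LPA -> Prop :=
| PA_ax A : In A PA_basic -> PA A
| PA_induction v A B : closure_of (induction v A) B -> PA B.

(** * Arithmetization *)

Fixpoint num (n : nat) : term :=
  match n with 0 => Zero | S n => Succ (num n) end.

(* The pairing function (x + y)^2 + x, which is injective, not onto, and at
   least as large as both components. *)
Definition tpair (x y : term) : term :=
  Plus (Times (Plus x y) (Plus x y)) x.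
Notation "⟨ x , y ⟩" := (tpair x y) (format "⟨ x ,  y ⟩") : arith_scope.

Definition lnil : term := Zero.
Definition lcons (x l : term) : term := Succ ⟨x, l⟩.

(* Codes of terms and formulae. Variables are given by their indices. All
   these functions have values strictly larger than the codes of the immediate
   subexpressions. *)
Definition cVar (i : term) : term := ⟨num 1, i⟩.
Definition cZero : term := ⟨num 0, num 0⟩.
Definition cSucc (t : term) : term := ⟨num 2, t⟩.
Definition cPlus (s t : term) : term := ⟨num 3, ⟨s, t⟩⟩.
Definition cTimes (s t : term) : term := ⟨num 4, ⟨s, t⟩⟩.
Definition cEq (s t : term) : term := ⟨num 5, ⟨s, t⟩⟩.
Definition cNeg (a : term) : term := ⟨num 6, a⟩.
Definition cAnd (a b : term) : term := ⟨num 7, ⟨a, b⟩⟩.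
Definition cOr (a b : term) : term := ⟨num 8, ⟨a, b⟩⟩.
Definition cEx (v a : term) : term := ⟨num 9, ⟨v, a⟩⟩.
Definition cAll (v a : term) : term := ⟨num 10, ⟨v, a⟩⟩.
Definition cImp (a b : term) : term := cOr (cNeg a) b.

Section Arithmetization.
Variable P : Type.
Local Notation bform := (bform P).

Definition Le (x y : term) : bform := ∃ z, Plus z x ≐ y.

(* [s] codes a triple (m, a, b); its elements are the [x <= m] such that
   1 + (x + 1) b divides [a]. Every finite set has such a code: let [b] be a
   common multiple of 1, ..., m, which makes the moduli for [x <= m] pairwise
   coprime, and [a] the product of the moduli of the elements. *)
Definition InSet (x s : term) : bform :=
  ∃ m a b q, s ≐ ⟨m, ⟨a, b⟩⟩ ∧ Le x m
             ∧ a ≐ Times q (Succ (Times (Succ x) b)).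

(* Definition by recursion on codes: [x] belongs to a finite set each of whose
   elements [z] satisfies [J] relative to that set. In all the uses below,
   [J R z] reduces [z] to elements [R y] where [y] has a smaller code than [z]
   (for pairs: where the first component of [y] is smaller than that of [z]),
   so that [J] has exactly one fixed point. *)
Definition Rec (J : (term -> bform) -> term -> bform) (x : term) : bform :=
  ∃ s, InSet x s ∧ ∀ z, InSet z s → J (fun y => InSet y s) z.

Definition isTerm : term -> bform := Rec (fun R z =>
    z ≐ cZero
  ∨ (∃ i, z ≐ cVar i)
  ∨ (∃ t, z ≐ cSucc t ∧ R t)
  ∨ (∃ s t, (z ≐ cPlus s t ∨ z ≐ cTimes s t) ∧ R s ∧ R t)).

Definition isForm : term -> bform := Rec (fun R z =>
    (∃ s t, z ≐ cEq s t ∧ isTerm s ∧ isTerm t)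
  ∨ (∃ a, z ≐ cNeg a ∧ R a)
  ∨ (∃ a b, (z ≐ cAnd a b ∨ z ≐ cOr a b) ∧ R a ∧ R b)
  ∨ (∃ v a, (z ≐ cEx v a ∨ z ≐ cAll v a) ∧ R a)).

(* The variable [v] occurs free in the term or formula [x]. *)
Definition FreeIn (v : term) : term -> bform := Rec (fun R z =>
    z ≐ cVar v
  ∨ (∃ a, (z ≐ cSucc a ∨ z ≐ cNeg a) ∧ R a)
  ∨ (∃ a b, (z ≐ cPlus a b ∨ z ≐ cTimes a b ∨ z ≐ cEq a b
             ∨ z ≐ cAnd a b ∨ z ≐ cOr a b) ∧ (R a ∨ R b))
  ∨ (∃ u a, (z ≐ cEx u a ∨ z ≐ cAll u a) ∧ ¬ u ≐ v ∧ R a)).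

Definition isClosedTerm (x : term) : bform := isTerm x ∧ ∀ v, ¬ FreeIn v x.

Definition isSent (x : term) : bform := isForm x ∧ ∀ v, ¬ FreeIn v x.

(* [x] is a formula with at most the free variable [v]. *)
Definition isForm1 (v x : term) : bform :=
  isForm x ∧ ∀ u, FreeIn u x → u ≐ v.

(* [y] is the result of substituting [r] for the free occurrences of [v] in the
   term or formula [x]. *)
Definition Sub (x v r y : term) : bform := Rec (fun R z =>
    z ≐ ⟨cZero, cZero⟩
  ∨ z ≐ ⟨cVar v, r⟩
  ∨ (∃ u, ¬ u ≐ v ∧ z ≐ ⟨cVar u, cVar u⟩)
  ∨ (∃ a a', R ⟨a, a'⟩
       ∧ (z ≐ ⟨cSucc a, cSucc a'⟩ ∨ z ≐ ⟨cNeg a, cNeg a'⟩))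
  ∨ (∃ a a' b b', R ⟨a, a'⟩ ∧ R ⟨b, b'⟩
       ∧ (z ≐ ⟨cPlus a b, cPlus a' b'⟩ ∨ z ≐ ⟨cTimes a b, cTimes a' b'⟩
          ∨ z ≐ ⟨cEq a b, cEq a' b'⟩
          ∨ z ≐ ⟨cAnd a b, cAnd a' b'⟩ ∨ z ≐ ⟨cOr a b, cOr a' b'⟩))
  ∨ (∃ u a a', ¬ u ≐ v ∧ R ⟨a, a'⟩
       ∧ (z ≐ ⟨cEx u a, cEx u a'⟩ ∨ z ≐ ⟨cAll u a, cAll u a'⟩))
  ∨ (∃ a, z ≐ ⟨cEx v a, cEx v a⟩ ∨ z ≐ ⟨cAll v a, cAll v a⟩)) ⟨x, y⟩.

Definition FreeFor (r v : term) : term -> bform := Rec (fun R z =>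
    (∃ s t, z ≐ cEq s t)
  ∨ (∃ a, z ≐ cNeg a ∧ R a)
  ∨ (∃ a b, (z ≐ cAnd a b ∨ z ≐ cOr a b) ∧ R a ∧ R b)
  ∨ (∃ u a, (z ≐ cEx u a ∨ z ≐ cAll u a)
       ∧ (¬ FreeIn v z ∨ (¬ FreeIn u r ∧ R a)))).

(* [n] is the numeral of [x]. *)
Definition Numeral (x n : term) : bform := Rec (fun R z =>
    z ≐ ⟨Zero, cZero⟩
  ∨ (∃ y m, z ≐ ⟨Succ y, cSucc m⟩ ∧ R ⟨y, m⟩)) ⟨x, n⟩.

(* [x] is the value of the closed term [t]. *)
Definition Val (t x : term) : bform := Rec (fun R z =>
    z ≐ ⟨cZero, Zero⟩
  ∨ (∃ s y, R ⟨s, y⟩ ∧ z ≐ ⟨cSucc s, Succ y⟩)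
  ∨ (∃ s y s' y', R ⟨s, y⟩ ∧ R ⟨s', y'⟩
       ∧ (z ≐ ⟨cPlus s s', Plus y y'⟩
          ∨ z ≐ ⟨cTimes s s', Times y y'⟩))) ⟨t, x⟩.

(** ** Proofs *)

Definition Mem (x : term) : term -> bform := Rec (fun R z =>
  ∃ y l, z ≐ lcons y l ∧ (y ≐ x ∨ R l)).

Definition isFormList : term -> bform := Rec (fun R z =>
  z ≐ lnil ∨ (∃ y l, z ≐ lcons y l ∧ isForm y ∧ R l)).

Local Notation "[[ ]]" := lnil.
Local Notation "[[ x ; .. ; y ]]" := (lcons x .. (lcons y lnil) ..).
Local Notation "x ::: l" := (lcons x l) (at level 60, right associativity).

Definition NotFreeInSeq (u G D : term) : bform :=
  ∀ x, Mem x G ∨ Mem x D → ¬ FreeIn u x.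

(* The rules of [LK], by number of premises. *)
Definition Rule0 (tau : term -> bform) (G D : term) : bform :=
    (∃ a, G ≐ [[a]] ∧ D ≐ [[a]])
  ∨ (∃ a, G ≐ [[]] ∧ D ≐ [[a]] ∧ isSent a ∧ tau a)
  ∨ (∃ t, G ≐ [[]] ∧ D ≐ [[cEq t t]])
  ∨ (∃ s t v p q a b, isTerm p ∧ isTerm q
       ∧ G ≐ [[cEq s t; a]] ∧ D ≐ [[b]]
       ∧ Sub (cEq p q) v s a ∧ Sub (cEq p q) v t b).

Definition Rule1 (G1 D1 G D : term) : bform :=
    (∀ x, (Mem x G1 → Mem x G) ∧ (Mem x D1 → Mem x D))
  ∨ (∃ a, D1 ≐ a ::: D ∧ G ≐ cNeg a ::: G1)
  ∨ (∃ a, G1 ≐ a ::: G ∧ D ≐ cNeg a ::: D1)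
  ∨ (∃ a b L, G1 ≐ a ::: b ::: L ∧ G ≐ cAnd a b ::: L ∧ D ≐ D1)
  ∨ (∃ a b L, D1 ≐ a ::: b ::: L ∧ D ≐ cOr a b ::: L ∧ G ≐ G1)
  ∨ (∃ v a r b L, isTerm r ∧ FreeFor r v a ∧ Sub a v r b
       ∧ G1 ≐ b ::: L ∧ G ≐ cAll v a ::: L ∧ D ≐ D1)
  ∨ (∃ v a r b L, isTerm r ∧ FreeFor r v a ∧ Sub a v r b
       ∧ D1 ≐ b ::: L ∧ D ≐ cEx v a ::: L ∧ G ≐ G1)
  ∨ (∃ v a u b L, NotFreeInSeq u G D
       ∧ FreeFor (cVar u) v a ∧ Sub a v (cVar u) b
       ∧ D1 ≐ b ::: L ∧ D ≐ cAll v a ::: L ∧ G ≐ G1)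
  ∨ (∃ v a u b L, NotFreeInSeq u G D
       ∧ FreeFor (cVar u) v a ∧ Sub a v (cVar u) b
       ∧ G1 ≐ b ::: L ∧ G ≐ cEx v a ::: L ∧ D ≐ D1).

Definition Rule2 (G1 D1 G2 D2 G D : term) : bform :=
    (∃ a, G1 ≐ G ∧ D1 ≐ a ::: D ∧ G2 ≐ a ::: G ∧ D2 ≐ D)
  ∨ (∃ a b L, G1 ≐ G ∧ G2 ≐ G
       ∧ D1 ≐ a ::: L ∧ D2 ≐ b ::: L ∧ D ≐ cAnd a b ::: L)
  ∨ (∃ a b L, D1 ≐ D ∧ D2 ≐ D
       ∧ G1 ≐ a ::: L ∧ G2 ≐ b ::: L ∧ G ≐ cOr a b ::: L).

(* A proof tree is coded by the pair of its end sequent and the list of its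
   immediate subtrees. *)
Definition Concl (d G D : term) : bform := ∃ l, d ≐ ⟨⟨G, D⟩, l⟩.

Definition isProof (tau : term -> bform) : term -> bform := Rec (fun R z =>
  ∃ G D, isFormList G ∧ isFormList D ∧
  (  (z ≐ ⟨⟨G, D⟩, [[]]⟩ ∧ Rule0 tau G D)
   ∨ (∃ d1 G1 D1, z ≐ ⟨⟨G, D⟩, [[d1]]⟩ ∧ R d1
        ∧ Concl d1 G1 D1 ∧ Rule1 G1 D1 G D)
   ∨ (∃ d1 G1 D1 d2 G2 D2, z ≐ ⟨⟨G, D⟩, [[d1; d2]]⟩ ∧ R d1 ∧ R d2
        ∧ Concl d1 G1 D1 ∧ Concl d2 G2 D2 ∧ Rule2 G1 D1 G2 D2 G D))).

Definition Pr (tau : term -> bform) (x : term) : bform :=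
  ∃ d, isProof tau d ∧ Concl d [[]] [[x]].

(** ** Axioms of PA *)

Fixpoint CodeOfTerm (t : term) (x : term) : bform :=
  match t with
  | Var v => x ≐ cVar (num v)
  | Zero => x ≐ cZero
  | Succ t => ∃ a, CodeOfTerm t a ∧ x ≐ cSucc a
  | Plus s t => ∃ a b, CodeOfTerm s a ∧ CodeOfTerm t b ∧ x ≐ cPlus a b
  | Times s t => ∃ a b, CodeOfTerm s a ∧ CodeOfTerm t b ∧ x ≐ cTimes a b
  end.

(* [CodeOf A] defines the code of the given formula [A]. *)
Fixpoint CodeOf (A : LPA) (x : term) : bform :=
  match A with
  | FEq s t => ∃ a b, CodeOfTerm s a ∧ CodeOfTerm t b ∧ x ≐ cEq a b
  | FPred p _ => match p with end
  | FNeg A => ∃ a, CodeOf A a ∧ x ≐ cNeg a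
  | FAnd A B => ∃ a b, CodeOf A a ∧ CodeOf B b ∧ x ≐ cAnd a b
  | FOr A B => ∃ a b, CodeOf A a ∧ CodeOf B b ∧ x ≐ cOr a b
  | FEx v A => ∃ a, CodeOf A a ∧ x ≐ cEx (num v) a
  | FAll v A => ∃ a, CodeOf A a ∧ x ≐ cAll (num v) a
  end.

(* [x] is obtained from [y] by prefixing universal quantifiers. *)
Definition Generalizes (x y : term) : bform := Rec (fun R z =>
  z ≐ y ∨ (∃ v a, z ≐ cAll v a ∧ R a)) x.

Definition isInduction (x : term) : bform :=
  ∃ v a a0 aS hyp step, isForm a ∧ Sub a v cZero a0
    ∧ Sub a v (cSucc (cVar v)) aS
    ∧ step ≐ cAll v (cImp a aS) ∧ hyp ≐ cAnd a0 step
    ∧ x ≐ cImp hyp (cAll v a).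

Definition AxPA (x : term) : bform :=
    (fold_right (fun A F => CodeOf A x ∨ F) (¬ Zero ≐ Zero) PA_basic)
  ∨ (isSent x ∧ ∃ y, isInduction y ∧ Generalizes x y).

End Arithmetization.

(** * Theories of truth *)

Definition Tr (x : term) : bform unit := fun _ => FPred tt x.

(* T(a(n)), where [n] is the numeral of [x] and is substituted for [v]. *)
Definition TrInst (a v x : term) : bform unit :=
  ∃ n b, Numeral x n ∧ Sub a v n b ∧ Tr b.

Definition CT_compositional : list LPAT :=
  [ (∀ s t, isClosedTerm s ∧ isClosedTerm t →
       (Tr (cEq s t) ↔ ∃ x y, Val s x ∧ Val t y ∧ x ≐ y)) 0;
    (∀ a b, isSent a ∧ isSent b → (Tr (cAnd a b) ↔ Tr a ∧ Tr b)) 0;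
    (∀ a b, isSent a ∧ isSent b → (Tr (cOr a b) ↔ Tr a ∨ Tr b)) 0;
    (∀ a, isSent a → (Tr (cNeg a) ↔ ¬ Tr a)) 0;
    (∀ v a, isForm1 v a → (Tr (cAll v a) ↔ ∀ x, TrInst a v x)) 0;
    (∀ v a, isForm1 v a → (Tr (cEx v a) ↔ ∃ x, TrInst a v x)) 0 ].

Inductive CTminus : LPAT -> Prop :=
| CTminus_PA A : PA A -> CTminus (embed A)
| CTminus_comp A : In A CT_compositional -> CTminus A.

(* v <= t. As the language has no symbol for <=, the bounded quantifiers of
   Delta_0 formulae are abbreviations. *)
Definition FLe P (w v : nat) (t : term) : form P :=
  FEx w (FEq (Plus (Var w) (Var v)) t).

Inductive Delta0 P : form P -> Prop :=
| Delta0_eq s t : Delta0 (FEq s t)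
| Delta0_pred p t : Delta0 (FPred p t)
| Delta0_neg A : Delta0 A -> Delta0 (FNeg A)
| Delta0_and A B : Delta0 A -> Delta0 B -> Delta0 (FAnd A B)
| Delta0_or A B : Delta0 A -> Delta0 B -> Delta0 (FOr A B)
| Delta0_ex v w t A : ~ In v (fvt t) -> w <> v -> ~ In w (fvt t) ->
    Delta0 A -> Delta0 (FEx v (FAnd (FLe w v t) A))
| Delta0_all v w t A : ~ In v (fvt t) -> w <> v -> ~ In w (fvt t) ->
    Delta0 A -> Delta0 (FAll v (FImp (FLe w v t) A)).

Inductive CT0 : LPAT -> Prop :=
| CT0_CTminus A : CTminus A -> CT0 A
| CT0_induction v A B : Delta0 A -> closure_of (induction v A) B -> CT0 B.

Definition GRP : LPAT := (∀ a, isSent a → (Pr Tr a → Tr a)) 0.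

(* Axioms of PA are sentences. *)
Definition ASP : LPAT := (∀ a, isSent a → (AxPA a → Tr a)) 0.

Inductive CT0_GRP_ASP : LPAT -> Prop :=
| CT0_GRP_ASP_CT0 A : CT0 A -> CT0_GRP_ASP A
| CT0_GRP_ASP_GRP : CT0_GRP_ASP GRP
| CT0_GRP_ASP_ASP : CT0_GRP_ASP ASP.

(* Main.v *)
Require Import Defs.
From Stdlib Require Import List Arith Lia Ring.
From Stdlib Require Import Classical ClassicalEpsilon.
From Stdlib Require Import FunctionalExtensionality PropExtensionality.
Import ListNotations.

Set Implicit Arguments.
Unset Strict Implicit.

(** Both claims are about provability, but by the completeness theorem for the
    sequent calculus it is enough to argue in an arbitrary structure [M] with a
    class [T] that satisfies [CT0].

    The predicate [T] is compositional, but the obvious induction on formulae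
    does not prove much about it, for instance that truth does not change when
    a closed term is replaced by one with the same value: the quantifier
    clauses make the induction statement speak about unboundedly many
    sentences, and only bounded induction is at hand. The remedy is to look at
    the classes that are defined, by way of [T], by a possibly nonstandard
    formula [a] with one free variable, that is, at the sets of all [x] such
    that the numeral instance of [a] at [x] is true. If a standard formula
    speaks about such a class, its translation, with [a] plugged in, is a
    single formula of [M], and by compositionality the standard formula holds
    iff its translation is true ([truth_of_code]). An induction over a standard
    formula thus becomes an induction over the truth of one sentence for each
    number, and for this bounded induction suffices ([truth_ind]): these
    classes satisfy full induction ([class_ind]).

    One step of Tarski's definition of satisfaction is a standard formula, so
    it can be iterated [c] times inside [M], for every [c], to give a formula
    [tower c] of possibly nonstandard depth. Its class [level c] comprises [c]
    satisfaction predicates at once, the new one at index 0. An old predicate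
    is reached from a new one without passing a quantifier, so that bounded
    induction for [T] identifies the one at index [i] of [level c] with the
    newest one of the tower that is [i] steps lower ([level_add]). That two
    satisfaction predicates agree on the formulae for which both are deep
    enough does pass quantifiers, but here both belong to one class with full
    induction ([level_coherent]). The union [Sat] of the tower obeys Tarski's
    clauses for all formulae of [M] ([Sat_clause]), and below each bound it
    agrees with a class with full induction ([Sat_bounded]).

    The new truth predicate is satisfaction under the zero assignment. The
    usual proofs by induction on formulae and on proofs now work, since they
    only involve formulae below a bound: they give the substitution lemma, from
    which the compositional axioms follow ([Truth0_CT]), the soundness of all
    proofs from true sentences ([Truth0_GRP]) and the truth of the axioms of PA
    ([Truth0_ASP]). A bounded formula depends on the truth of boundedly many
    sentences, whence bounded induction ([Truth0_ind]).

    For the second claim let [G] say of itself that PA does not prove it. If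
    [M] thought that PA proves [G], then [G] would be true in the sense of the
    new predicate, hence hold, by reflection; so [CT0] proves [G]. But PA does
    not, for a proof would be coded by a number, which would refute [G] in the
    standard model of PA. *)

(** * Tarskian semantics *)

Record str := Str {
  dom :> Type; o0 : dom; oS : dom -> dom;
  oA : dom -> dom -> dom; oM : dom -> dom -> dom }.
Arguments o0 {_}. Arguments oS {_} _. Arguments oA {_} _ _. Arguments oM {_} _ _.

Section Semantics.
Context {M : str}.

Fixpoint eval (e : nat -> M) (t : term) : M :=
  match t with
  | Var v => e v
  | Zero => o0
  | Succ t => oS (eval e t)
  | Plus s t => oA (eval e s) (eval e t)
  | Times s t => oM (eval e s) (eval e t)
  end.

Fixpoint sat P (I : P -> M -> Prop) (e : nat -> M) (A : form P) : Prop :=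
  match A with
  | FEq s t => eval e s = eval e t
  | FPred p t => I p (eval e t)
  | FNeg A => ~ sat I e A
  | FAnd A B => sat I e A /\ sat I e B
  | FOr A B => sat I e A \/ sat I e B
  | FEx v A => exists x, sat I (upd e v x) A
  | FAll v A => forall x, sat I (upd e v x) A
  end.

Lemma upd_same X (e : nat -> X) v x : upd e v x v = x.
Proof. unfold upd. now rewrite Nat.eqb_refl. Qed.

Lemma upd_other X (e : nat -> X) v x u : u <> v -> upd e v x u = e u.
Proof. unfold upd. intros H. apply Nat.eqb_neq in H. now rewrite H. Qed.

Lemma upd_id X (e : nat -> X) v : upd e v (e v) = e.
Proof.
  extensionality u. unfold upd. destruct (Nat.eqb_spec u v); congruence.
Qed.

Lemma eval_ext e e' t :
  (forall v, In v (fvt t) -> e v = e' v) -> eval e t = eval e' t.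
Proof.
  induction t; simpl; intros H; try f_equal; auto using in_or_app.
Qed.

Lemma sat_ext P (I : P -> M -> Prop) A : forall e e',
  (forall v, In v (fv A) -> e v = e' v) -> sat I e A <-> sat I e' A.
Proof.
  induction A as [s t|p t|A IH|A IHA B IHB|A IHA B IHB|v A IH|v A IH];
    simpl; intros e e' H.
  6, 7: assert (K : forall x, sat I (upd e v x) A <-> sat I (upd e' v x) A) by
    (intros x; apply IH; intros u Hu; unfold upd; destruct (Nat.eqb_spec u v);
     auto using in_in_remove); now setoid_rewrite K.
  - rewrite (@eval_ext e e' s), (@eval_ext e e' t); tauto || auto using in_or_app.
  - rewrite (@eval_ext e e' t); tauto || auto.
  - rewrite (IH e e'); tauto || auto.
  - rewrite (IHA e e'), (IHB e e'); tauto || auto using in_or_app.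
  - rewrite (IHA e e'), (IHB e e'); tauto || auto using in_or_app.
Qed.

Lemma sat_sentence P (I : P -> M -> Prop) A e e' :
  sentence A -> sat I e A <-> sat I e' A.
Proof. intros H. apply sat_ext. rewrite H. now intros. Qed.

Lemma eval_substt e v r t :
  eval e (substt v r t) = eval (upd e v (eval e r)) t.
Proof.
  induction t; simpl; try congruence.
  unfold upd. destruct (Nat.eqb_spec v0 v); reflexivity.
Qed.

Lemma sat_notin P (I : P -> M -> Prop) A e v x :
  ~ In v (fv A) -> sat I (upd e v x) A <-> sat I e A.
Proof.
  intros H. apply sat_ext. intros u Hu. apply upd_other. congruence.
Qed.

Lemma subst_notin_t v r t : ~ In v (fvt t) -> substt v r t = t.
Proof.
  induction t; simpl; intros H; try f_equal; auto 8 using in_or_app.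
  destruct (Nat.eqb_spec v0 v); tauto.
Qed.

Lemma subst_notin P v r (A : form P) : ~ In v (fv A) -> subst v r A = A.
Proof.
  induction A; simpl; intros H; try f_equal; auto 8 using subst_notin_t, in_or_app.
  - destruct (Nat.eqb_spec v0 v); auto 8 using in_in_remove, not_eq_sym.
  - destruct (Nat.eqb_spec v0 v); auto 8 using in_in_remove, not_eq_sym.
Qed.

Lemma upd_upd_same X (e : nat -> X) v x y : upd (upd e v x) v y = upd e v y.
Proof. extensionality u. unfold upd. now destruct (u =? v). Qed.

Lemma upd_comm X (e : nat -> X) v x u y :
  u <> v -> upd (upd e v x) u y = upd (upd e u y) v x.
Proof.
  intros H. extensionality w. unfold upd.
  destruct (Nat.eqb_spec w u), (Nat.eqb_spec w v); congruence.
Qed.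

Lemma sat_subst P (I : P -> M -> Prop) v r A : forall e, free_for r v A ->
  sat I e (subst v r A) <-> sat I (upd e v (eval e r)) A.
Proof.
  induction A as [s t|p t|A IH|A IHA B IHB|A IHA B IHB|u A IH|u A IH];
    intros e H.
  6, 7: cbn [fv free_for subst sat] in *; destruct (Nat.eqb_spec u v) as [->|N];
    [now setoid_rewrite upd_upd_same|];
    assert (K : forall x, sat I (upd e u x) (subst v r A) <->
                          sat I (upd (upd e v (eval e r)) u x) A);
    [|now setoid_rewrite K];
    intros x; rewrite upd_comm by auto; destruct H as [H|[H1 H2]];
    [rewrite subst_notin, (@sat_notin P I A (upd e u x) v)
       by auto using in_in_remove, not_eq_sym; reflexivity|];
    rewrite IH by auto; rewrite (@eval_ext (upd e u x) e); [reflexivity|];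
    intros w Hw; apply upd_other; congruence.
  - simpl. now rewrite !eval_substt.
  - simpl. now rewrite !eval_substt.
  - simpl. now rewrite IH.
  - simpl in *. rewrite IHA, IHB; tauto.
  - simpl in *. rewrite IHA, IHB; tauto.
Qed.

Lemma eval_csubstt e s t : eval e (csubstt s t) = eval (fun v => eval e (s v)) t.
Proof. induction t; simpl; congruence. Qed.

Lemma fresh_notin s vs u : In u vs -> ~ In (fresh s vs) (fvt (s u)).
Proof.
  intros Hu Hf. unfold fresh in Hf.
  assert (K : forall x l, In x l -> x <= list_max l).
  { intros x l Hx. pose proof (proj1 (list_max_le l (list_max l)) (Nat.le_refl _)) as F.
    rewrite Forall_forall in F. auto. }
  assert (In (S (list_max (flat_map (fun u => fvt (s u)) vs)))
             (flat_map (fun u => fvt (s u)) vs)) as J.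
  { apply in_flat_map. eauto. }
  apply K in J. lia.
Qed.

Lemma sat_csubst P (I : P -> M -> Prop) A : forall s e,
  sat I e (csubst s A) <-> sat I (fun v => eval e (s v)) A.
Proof.
  induction A as [t1 t2|p t|A IH|A IHA B IHB|A IHA B IHB|v A IH|v A IH];
    intros s e; simpl.
  6, 7: set (w := fresh s (remove Nat.eq_dec v (fv A)));
    assert (K : forall x, sat I (upd e w x) (csubst (upd s v (Var w)) A) <->
                          sat I (upd (fun u => eval e (s u)) v x) A);
    [|now setoid_rewrite K];
    intros x; rewrite IH; apply sat_ext; intros u Hu; unfold upd at 2 3;
    destruct (Nat.eqb_spec u v); simpl; [apply upd_same|];
    apply eval_ext; intros z Hz; apply upd_other; intros ->;
    (eapply fresh_notin; [|exact Hz]); now apply in_in_remove.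
  - now rewrite !eval_csubstt.
  - now rewrite !eval_csubstt.
  - now rewrite IH.
  - now rewrite IHA, IHB.
  - now rewrite IHA, IHB.
Qed.

Lemma sat_replace P Q (I : P -> M -> Prop) (J : Q -> M -> Prop)
    (F : P -> term -> form Q) A :
  (forall e p t, sat J e (F p t) <-> I p (eval e t)) ->
  forall e, sat J e (replace_preds F A) <-> sat I e A.
Proof.
  intros H. induction A as [s t|p t|A IH|A IHA B IHB|A IHA B IHB|v A IH|v A IH];
    intros e; simpl.
  - tauto.
  - apply H.
  - now rewrite IH.
  - now rewrite IHA, IHB.
  - now rewrite IHA, IHB.
  - split; intros [x Hx]; exists x; now apply IH.
  - split; intros Hx x; now apply IH.
Qed.

Lemma sat_embed P (I : P -> M -> Prop) (J : Empty_set -> M -> Prop) A e :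
  sat I e (embed A) <-> sat J e A.
Proof. apply sat_replace. now intros ? []. Qed.

Lemma sat_replace_T (I : unit -> M -> Prop) T' A (d : nat -> M) :
  (forall v, In v (fv T') -> v = 0) -> forall e,
  sat I e (replace_T T' A) <->
  sat (fun _ x => sat I (upd d 0 x) T') e A.
Proof.
  intros H. apply sat_replace. intros e p t. rewrite sat_csubst.
  apply sat_ext. intros v Hv. apply H in Hv. subst. reflexivity.
Qed.

Lemma sat_closure P (I : P -> M -> Prop) A vs :
  (forall e, sat I e (fold_right (@FAll P) A vs)) <-> (forall e, sat I e A).
Proof.
  induction vs as [|v vs IH]; simpl; [tauto|].
  rewrite <- IH. split; intros H e; [|now intros].
  specialize (H e (e v)). now rewrite upd_id in H.
Qed.

End Semantics.

Lemma fvt_csubstt s t v :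
  In v (fvt (csubstt s t)) -> exists u, In u (fvt t) /\ In v (fvt (s u)).
Proof.
  induction t; simpl; intros H; eauto; try tauto;
    apply in_app_or in H as [H|H];
      [apply IHt1 in H|apply IHt2 in H|apply IHt1 in H|apply IHt2 in H];
    destruct H as (u & H1 & H2); exists u; auto using in_or_app.
Qed.

Lemma fv_csubst P (A : form P) : forall s v,
  In v (fv (csubst s A)) -> exists u, In u (fv A) /\ In v (fvt (s u)).
Proof.
  assert (Q : forall (A : form P) s v u,
     (forall s v, In v (fv (csubst s A)) ->
        exists u, In u (fv A) /\ In v (fvt (s u))) ->
     let w := fresh s (remove Nat.eq_dec u (fv A)) in
     In v (remove Nat.eq_dec w (fv (csubst (upd s u (Var w)) A))) ->
     exists x, In x (remove Nat.eq_dec u (fv A)) /\ In v (fvt (s x))).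
  { intros B s v u IH w H. apply in_remove in H as [H N].
    apply IH in H as (x & H1 & H2). exists x. unfold upd in H2.
    destruct (Nat.eqb_spec x u) as [->|N'].
    - simpl in H2. destruct H2; [congruence|tauto].
    - split; auto. now apply in_in_remove. }
  induction A as [t1 t2|p t|A IH|A IHA B IHB|A IHA B IHB|u A IH|u A IH];
    intros s v H; simpl in *; auto.
  - apply in_app_or in H as [H|H]; apply fvt_csubstt in H;
      destruct H as (u & H1 & H2); exists u; split; auto; apply in_or_app; auto.
  - now apply fvt_csubstt in H.
  - apply in_app_or in H as [H|H]; [apply IHA in H|apply IHB in H];
      destruct H as (u & H1 & H2); exists u; split; auto; apply in_or_app; auto.
  - apply in_app_or in H as [H|H]; [apply IHA in H|apply IHB in H];
      destruct H as (u & H1 & H2); exists u; split; auto; apply in_or_app; auto.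
Qed.

Lemma fv_replace P Q (F : P -> term -> form Q) A v :
  (forall p t, incl (fv (F p t)) (fvt t)) ->
  In v (fv (replace_preds F A)) -> In v (fv A).
Proof.
  intros H. induction A; simpl; auto.
  - apply H.
  - rewrite !in_app_iff. tauto.
  - rewrite !in_app_iff. tauto.
  - intros K. apply in_remove in K. apply in_in_remove; tauto.
  - intros K. apply in_remove in K. apply in_in_remove; tauto.
Qed.

Lemma nil_of_notin X (l : list X) : (forall x, ~ In x l) -> l = [].
Proof. destruct l as [|x l]; auto. intros H. destruct (H x). now left. Qed.

Lemma sentence_replace P Q (F : P -> term -> form Q) A :
  (forall p t, incl (fv (F p t)) (fvt t)) ->
  sentence A -> sentence (replace_preds F A).
Proof.
  intros H HA. apply nil_of_notin. intros v Hv.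
  apply fv_replace in Hv; auto. now rewrite HA in Hv.
Qed.

Lemma sentence_embed P (A : LPA) : sentence A -> sentence (embed (P:=P) A).
Proof. apply sentence_replace. now intros []. Qed.

Lemma sentence_replace_T T' A :
  (forall v, In v (fv T') -> v = 0) -> sentence A -> sentence (replace_T T' A).
Proof.
  intros H. apply sentence_replace. intros _ t v Hv.
  apply fv_csubst in Hv as (u & H1 & H2). apply H in H1. now subst.
Qed.

(** Putting zero for all variables but one bounds the free variables of a
    formula that is too large for them to be computed. *)
Lemma restrict_fv P (A : form P) : exists B : form P,
  (forall v, In v (fv B) -> v = 0) /\
  forall (M : str) (I : P -> M -> Prop) e,
    sat I e B <-> sat I (fun v => if v =? 0 then e 0 else o0) A.
Proof.
  exists (csubst (fun v => if v =? 0 then Var 0 else Zero) A). split.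
  - intros v Hv. apply fv_csubst in Hv as (u & _ & H).
    destruct (u =? 0); simpl in H; intuition.
  - intros M I e. rewrite sat_csubst. apply sat_ext. intros v _.
    now destruct (v =? 0).
Qed.

Lemma closure_exists P (A : form P) : exists B, closure_of A B.
Proof.
  exists (fold_right (@FAll P) A (fv A)). split; [|eauto].
  apply nil_of_notin. intros v Hv.
  assert (K : forall l, In v (fv (fold_right (@FAll P) A l)) ->
                        In v (fv A) /\ ~ In v l).
  { induction l as [|u l IH]; simpl; [tauto|]. intros H.
    apply in_remove in H as [H N]. apply IH in H. intuition. }
  apply K in Hv. tauto.
Qed.

Section Soundness.
Variables (M : str) (P : Type) (I : P -> M -> Prop) (Ax : form P -> Prop).
Hypothesis HAx : forall A e, sentence A -> Ax A -> sat I e A.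

(* In the rules with an eigenvariable the value of the latter is changed, which
   affects no formula of the conclusion. *)
Lemma LK_sound G D : LK Ax G D -> forall e,
  (forall A, In A G -> sat I e A) -> exists B, In B D /\ sat I e B.
Proof.
  induction 1 as [A|A S A0|t|s t v A HA|G D G' D' H IH HG HD|A G D _ IH1 _ IH2
    |A G D _ IH|A G D _ IH|A B G D _ IH|A B G D _ IH1 _ IH2|A B G D _ IH1 _ IH2
    |A B G D _ IH|v A r G D F _ IH|v A u G D F HF _ IH|v A u G D F HF _ IH
    |v A r G D F _ IH]; intros e HG0.
  - exists A. split; [now left|]. apply HG0. now left.
  - exists A. split; [now left|]. auto.
  - exists (FEq t t). split; [now left|]. reflexivity.
  - exists (subst v t A). split; [now left|].
    assert (F : forall r, free_for r v A) by (destruct A; simpl in *; tauto).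
    pose proof (HG0 _ (or_introl eq_refl)) as E.
    pose proof (HG0 _ (or_intror (or_introl eq_refl))) as K.
    rewrite sat_subst in K |- * by auto. simpl in E. now rewrite <- E.
  - destruct (IH e) as (B & HB & K); eauto.
  - destruct (IH1 e) as (B & [<-|HB] & K); eauto.
    apply (IH2 e). intros C [<-|HC]; auto.
  - destruct (IH e) as (B & [<-|HB] & K); eauto.
    + intros C HC. apply HG0. now right.
    + destruct (HG0 (FNeg A) (or_introl eq_refl) K).
  - destruct (classic (sat I e A)) as [HA|HA].
    + destruct (IH e) as (B & HB & K).
      * intros C [<-|HC]; auto.
      * exists B. split; auto. now right.
    + exists (FNeg A). split; [now left|]. exact HA.
  - apply (IH e). pose proof (HG0 _ (or_introl eq_refl)) as [KA KB].
    intros C [<-|[<-|HC]]; auto. apply HG0. now right.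
  - destruct (IH1 e) as (C & [<-|HC] & K); auto.
    2:{ exists C. split; auto. now right. }
    destruct (IH2 e) as (C & [<-|HC] & K'); auto.
    2:{ exists C. split; auto. now right. }
    exists (FAnd A B). split; [now left|]. now split.
  - destruct (HG0 _ (or_introl eq_refl)) as [K|K]; [apply (IH1 e)|apply (IH2 e)];
      intros C [<-|HC]; auto; apply HG0; now right.
  - destruct (IH e) as (C & [<-|[<-|HC]] & K); auto.
    + exists (FOr A B). split; [now left|]. now left.
    + exists (FOr A B). split; [now left|]. now right.
    + exists C. split; auto. now right.
  - apply (IH e). intros C [<-|HC].
    + rewrite sat_subst by auto.
      exact (HG0 _ (or_introl eq_refl) (eval e r)).
    + apply HG0. now right.
  - destruct (classic (exists B, In B D /\ sat I e B)) as [(B & HB & K)|N].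
    { exists B. split; auto. now right. }
    exists (FAll v A). split; [now left|]. intros x.
    destruct (IH (upd e u x)) as (B & [<-|HB] & K).
    + intros C HC. rewrite sat_notin; auto.
      apply HF, in_or_app. now left.
    + rewrite sat_subst in K by auto. simpl in K. rewrite upd_same in K.
      destruct (Nat.eq_dec u v) as [->|Nuv].
      { now rewrite upd_upd_same in K. }
      rewrite upd_comm in K by auto. rewrite sat_notin in K; auto.
      intros Hu. apply (HF (FAll v A)).
      { apply in_or_app. right. now left. }
      simpl. now apply in_in_remove.
    + exfalso. apply N. exists B. split; auto. rewrite sat_notin in K; auto.
      apply HF, in_or_app. right. now right.
  - destruct (HG0 _ (or_introl eq_refl)) as [x Hx].
    destruct (IH (upd e u x)) as (B & HB & K).
    + intros C [<-|HC].
      * rewrite sat_subst by auto. simpl. rewrite upd_same.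
        destruct (Nat.eq_dec u v) as [->|Nuv].
        { now rewrite upd_upd_same. }
        rewrite upd_comm by auto. rewrite sat_notin; auto.
        intros Hu. apply (HF (FEx v A)). { now left. }
        simpl. now apply in_in_remove.
      * rewrite sat_notin. { apply HG0. now right. }
        apply HF. right. apply in_or_app. now left.
    + exists B. split; auto. rewrite sat_notin in K; auto.
      apply HF. right. apply in_or_app. now right.
  - destruct (IH e) as (B & [<-|HB] & K); auto.
    + exists (FEx v A). split; [now left|]. rewrite sat_subst in K by auto.
      now exists (eval e r).
    + exists B. split; auto. now right.
Qed.

End Soundness.

(** * Arithmetic in a structure with induction *)

Declare Scope model_scope.
Delimit Scope model_scope with M.
Infix "⊕" := oA (at level 50, left associativity) : model_scope.
Infix "⊗" := oM (at level 40, left associativity) : model_scope.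
Local Open Scope model_scope.

(** The axioms of PA, with induction for all formulae that may also speak about
    the class [X]. *)
Record inductive_class (M : str) (X : M -> Prop) : Prop := {
  pa_S0 : forall x : M, oS x <> o0;
  pa_inj : forall x y : M, oS x = oS y -> x = y;
  pa_A0 : forall x : M, x ⊕ o0 = x;
  pa_AS : forall x y : M, x ⊕ oS y = oS (x ⊕ y);
  pa_M0 : forall x : M, x ⊗ o0 = o0;
  pa_MS : forall x y : M, x ⊗ oS y = x ⊗ y ⊕ x;
  pa_ind : forall (A : LPAT) (e : nat -> M) v,
    sat (fun _ => X) (upd e v o0) A ->
    (forall x, sat (fun _ => X) (upd e v x) A ->
               sat (fun _ => X) (upd e v (oS x)) A) ->
    forall x, sat (fun _ => X) (upd e v x) A }.

Definition le {M : str} (x y : M) : Prop := exists z, z ⊕ x = y.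
Definition lt {M : str} (x y : M) : Prop := le (oS x) y.
Infix "≼" := le (at level 70) : model_scope.
Infix "≺" := lt (at level 70) : model_scope.

(** ** Definability with parameters *)

(* Parameters are the values of the odd variables. *)
Definition mix X (e r : nat -> X) (v : nat) : X :=
  if Nat.even v then e (Nat.div2 v) else r (Nat.div2 v).

Lemma mix_even X (e r : nat -> X) n : mix e r (2 * n) = e n.
Proof. unfold mix. now rewrite Nat.even_even, Nat.div2_double. Qed.

Lemma mix_odd X (e r : nat -> X) n : mix e r (S (2 * n)) = r n.
Proof.
  unfold mix. rewrite Nat.div2_succ_double.
  replace (S (2 * n)) with (2 * n + 1) by lia. now rewrite Nat.even_odd.
Qed.

Lemma parity n : (exists k, n = 2 * k) \/ (exists k, n = S (2 * k)).
Proof.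
  induction n as [|n [[k ->]|[k ->]]].
  - left. now exists 0.
  - right. now exists k.
  - left. exists (S k). lia.
Qed.

Section Definability.
Context {M : str} (X : M -> Prop).
Local Notation satX := (sat (P:=unit) (fun _ => X)).

(** Definability, with parameters, of relations between the values of infinitely
    many variables, so that no arity has to be fixed. *)
Definition Def (Y : (nat -> M) -> Prop) : Prop :=
  exists (A : LPAT) (r : nat -> M), forall e, Y e <-> satX (mix e r) A.

Definition DefT (f : (nat -> M) -> M) : Prop :=
  exists (t : term) (r : nat -> M), forall e, f e = eval (mix e r) t.

(* Where the parameters are found after two lists of them have been merged. *)
Let left_ren v := if Nat.even v then v else S (2 * (2 * Nat.div2 v)).
Let right_ren v := if Nat.even v then v else S (2 * S (2 * Nat.div2 v)).

Lemma mix_left (e r1 r2 : nat -> M) v :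
  mix e (mix r1 r2) (left_ren v) = mix e r1 v.
Proof.
  unfold left_ren. destruct (parity v) as [[k ->]|[k ->]].
  - now rewrite Nat.even_even, !mix_even.
  - replace (Nat.even (S (2 * k))) with false
      by (rewrite <- (Nat.even_odd k); f_equal; lia).
    now rewrite Nat.div2_succ_double, !mix_odd, mix_even.
Qed.

Lemma mix_right (e r1 r2 : nat -> M) v :
  mix e (mix r1 r2) (right_ren v) = mix e r2 v.
Proof.
  unfold right_ren. destruct (parity v) as [[k ->]|[k ->]].
  - now rewrite Nat.even_even, !mix_even.
  - replace (Nat.even (S (2 * k))) with false
      by (rewrite <- (Nat.even_odd k); f_equal; lia).
    now rewrite Nat.div2_succ_double, !mix_odd.
Qed.

Lemma def_merge Y Z : Def Y -> Def Z -> exists A B r,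
  (forall e, Y e <-> satX (mix e r) A) /\ (forall e, Z e <-> satX (mix e r) B).
Proof.
  intros (A & r1 & HA) (B & r2 & HB).
  exists (csubst (fun v => Var (left_ren v)) A),
         (csubst (fun v => Var (right_ren v)) B), (mix r1 r2).
  split; intros e; rewrite sat_csubst.
  - rewrite HA. apply sat_ext. intros. simpl. symmetry. apply mix_left.
  - rewrite HB. apply sat_ext. intros. simpl. symmetry. apply mix_right.
Qed.

Lemma defT_merge f g : DefT f -> DefT g -> exists s t r,
  (forall e, f e = eval (mix e r) s) /\ (forall e, g e = eval (mix e r) t).
Proof.
  intros (s & r1 & Hs) (t & r2 & Ht).
  exists (csubstt (fun v => Var (left_ren v)) s),
         (csubstt (fun v => Var (right_ren v)) t), (mix r1 r2).
  split; intros e; rewrite eval_csubstt.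
  - rewrite Hs. apply eval_ext. intros. simpl. symmetry. apply mix_left.
  - rewrite Ht. apply eval_ext. intros. simpl. symmetry. apply mix_right.
Qed.

Lemma defT_var n : DefT (fun e => e n).
Proof. exists (Var (2 * n)), (fun _ => o0). intros e. simpl eval. symmetry. apply mix_even. Qed.

Lemma defT_const c : DefT (fun _ => c).
Proof. exists (Var 1), (fun _ => c). reflexivity. Qed.

Lemma defT_S f : DefT f -> DefT (fun e => oS (f e)).
Proof. intros (t & r & H). exists (Succ t), r. intros e. simpl. now rewrite H. Qed.

Lemma defT_A f g : DefT f -> DefT g -> DefT (fun e => f e ⊕ g e).
Proof.
  intros Hf Hg. destruct (defT_merge Hf Hg) as (s & t & r & Hs & Ht).
  exists (Plus s t), r. intros e. simpl. now rewrite Hs, Ht.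
Qed.

Lemma defT_M f g : DefT f -> DefT g -> DefT (fun e => f e ⊗ g e).
Proof.
  intros Hf Hg. destruct (defT_merge Hf Hg) as (s & t & r & Hs & Ht).
  exists (Times s t), r. intros e. simpl. now rewrite Hs, Ht.
Qed.

Lemma def_ext Y Z : Def Y -> (forall e, Z e <-> Y e) -> Def Z.
Proof. intros (A & r & H) K. exists A, r. intros e. now rewrite K. Qed.

Lemma def_eq f g : DefT f -> DefT g -> Def (fun e => f e = g e).
Proof.
  intros Hf Hg. destruct (defT_merge Hf Hg) as (s & t & r & Hs & Ht).
  exists (FEq s t), r. intros e. simpl. now rewrite Hs, Ht.
Qed.

Lemma def_pred f : DefT f -> Def (fun e => X (f e)).
Proof. intros (t & r & H). exists (FPred tt t), r. intros e. simpl. now rewrite H. Qed.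

Lemma def_not Y : Def Y -> Def (fun e => ~ Y e).
Proof. intros (A & r & H). exists (FNeg A), r. intros e. simpl. now rewrite H. Qed.

Lemma def_and Y Z : Def Y -> Def Z -> Def (fun e => Y e /\ Z e).
Proof.
  intros HY HZ. destruct (def_merge HY HZ) as (A & B & r & HA & HB).
  exists (FAnd A B), r. intros e. simpl. now rewrite HA, HB.
Qed.

Lemma def_or Y Z : Def Y -> Def Z -> Def (fun e => Y e \/ Z e).
Proof.
  intros HY HZ. destruct (def_merge HY HZ) as (A & B & r & HA & HB).
  exists (FOr A B), r. intros e. simpl. now rewrite HA, HB.
Qed.

Lemma def_imp Y Z : Def Y -> Def Z -> Def (fun e => Y e -> Z e).
Proof.
  intros HY HZ. eapply def_ext. { exact (def_or (def_not HY) HZ). }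
  intros e. destruct (classic (Y e)); tauto.
Qed.

Lemma def_iff Y Z : Def Y -> Def Z -> Def (fun e => Y e <-> Z e).
Proof. intros HY HZ. apply def_and; apply def_imp; auto. Qed.

Lemma def_prop Q : Def (fun _ => Q).
Proof.
  destruct (classic Q) as [H|H].
  - exists (FEq Zero Zero), (fun _ => o0). simpl. tauto.
  - exists (FNeg (FEq Zero Zero)), (fun _ => o0). simpl. tauto.
Qed.

Lemma def_ex (Y : M -> (nat -> M) -> Prop) :
  Def (fun e => Y (e 0) (fun n => e (S n))) -> Def (fun e => exists x, Y x e).
Proof.
  intros (A & r & H).
  set (s := fun v => if Nat.even v then v - 2 else v).
  set (w := fresh (fun v => Var (s v)) (fv A)).
  exists (FEx w (csubst (fun v => if v =? 0 then Var w else Var (s v)) A)), r.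
  intros e. simpl.
  assert (K : forall x, satX (upd (mix e r) w x)
      (csubst (fun v => if v =? 0 then Var w else Var (s v)) A) <-> Y x e).
  { intros x. rewrite sat_csubst.
    specialize (H (fun n => match n with 0 => x | S n => e n end)). simpl in H.
    rewrite H. apply sat_ext. intros v Hv.
    assert (N : v <> 0 -> s v <> w).
    { intros _ E. apply (@fresh_notin (fun v => Var (s v)) (fv A) v Hv).
      left. exact E. }
    destruct (Nat.eqb_spec v 0) as [->|Hv0].
    - simpl eval. rewrite upd_same. reflexivity.
    - simpl eval. rewrite upd_other by auto.
      unfold s. destruct (parity v) as [[k ->]|[k ->]].
      + rewrite Nat.even_even, mix_even.
        destruct k as [|k]; [lia|].
        replace (2 * S k - 2) with (2 * k) by lia. now rewrite mix_even.
      + replace (Nat.even (S (2 * k))) with false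
          by (rewrite <- (Nat.even_odd k); f_equal; lia).
        now rewrite !mix_odd. }
  split; intros [x Hx]; exists x; now apply K.
Qed.

Lemma def_all (Y : M -> (nat -> M) -> Prop) :
  Def (fun e => Y (e 0) (fun n => e (S n))) -> Def (fun e => forall x, Y x e).
Proof.
  intros H. eapply def_ext.
  { apply def_not. apply (@def_ex (fun x e => ~ Y x e)). apply def_not. exact H. }
  intros e. split; intros K.
  - intros [x Hx]. auto.
  - intros x. apply NNPP. intros N. apply K. eauto.
Qed.

Lemma mix_shift (e r : nat -> M) g v :
  mix e r (if Nat.even v then 2 * g (Nat.div2 v) else v) =
  mix (fun n => e (g n)) r v.
Proof.
  destruct (parity v) as [[k ->]|[k ->]].
  - now rewrite Nat.even_even, Nat.div2_double, !mix_even.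
  - replace (Nat.even (S (2 * k))) with false
      by (rewrite <- (Nat.even_odd k); f_equal; lia).
    now rewrite !mix_odd.
Qed.

Lemma def_shift Y g : Def Y -> Def (fun e => Y (fun n => e (g n))).
Proof.
  intros (A & r & H).
  exists (csubst (fun v => Var (if Nat.even v then 2 * g (Nat.div2 v) else v)) A), r.
  intros e. rewrite sat_csubst, H. apply sat_ext. intros v _. symmetry.
  apply mix_shift.
Qed.

Lemma defT_shift f g : DefT f -> DefT (fun e => f (fun n => e (g n))).
Proof.
  intros (t & r & H).
  exists (csubstt (fun v => Var (if Nat.even v then 2 * g (Nat.div2 v) else v)) t), r.
  intros e. rewrite eval_csubstt, H. apply eval_ext. intros v _. symmetry.
  apply mix_shift.
Qed.

Lemma def_subst1 (Q : M -> Prop) : Def (fun e => Q (e 0)) ->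
  forall f, DefT f -> Def (fun e => Q (f e)).
Proof.
  intros HQ f Hf. eapply def_ext.
  - apply (@def_ex (fun x e => x = f e /\ Q x)). apply def_and; auto.
    apply def_eq. { apply defT_var. } exact (@defT_shift f S Hf).
  - intros e. split.
    + intros H. exists (f e). auto.
    + now intros (x & -> & H).
Qed.

Lemma def_subst2 (Q : M -> M -> Prop) : Def (fun e => Q (e 0) (e 1)) ->
  forall f g, DefT f -> DefT g -> Def (fun e => Q (f e) (g e)).
Proof.
  intros HQ f g Hf Hg. eapply def_ext.
  - apply (@def_ex (fun x e => x = f e /\ exists y, y = g e /\ Q x y)).
    apply def_and; auto.
    { apply def_eq. { apply defT_var. } exact (@defT_shift f S Hf). }
    apply (@def_ex (fun y e => y = g (fun n => e (S n)) /\ Q (e 0) y)).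
    apply def_and.
    { apply def_eq. { apply defT_var. }
      exact (@defT_shift g (fun n => S (S n)) Hg). }
    exact (@def_shift _ (fun n => match n with 0 => 1 | _ => 0 end) HQ).
  - intros e. split.
    + intros H. exists (f e). split; auto. exists (g e). auto.
    + now intros (x & -> & y & -> & H).
Qed.

Lemma def_subst3 (Q : M -> M -> M -> Prop) : Def (fun e => Q (e 0) (e 1) (e 2)) ->
  forall f g h, DefT f -> DefT g -> DefT h -> Def (fun e => Q (f e) (g e) (h e)).
Proof.
  intros HQ f g h Hf Hg Hh. eapply def_ext.
  - apply (@def_ex (fun x e => x = f e /\ exists y, y = g e /\ Q x y (h e))).
    apply def_and.
    { apply def_eq. { apply defT_var. } exact (@defT_shift f S Hf). }
    apply (@def_ex (fun y e => y = g (fun n => e (S n)) /\ Q (e 0) y (h (fun n => e (S n))))).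
    apply def_and.
    { apply def_eq. { apply defT_var. }
      exact (@defT_shift g (fun n => S (S n)) Hg). }
    eapply def_ext.
    + apply (@def_ex (fun z e => z = h (fun n => e (S (S n))) /\ Q (e 1) (e 0) z)).
      apply def_and.
      { apply def_eq. { apply defT_var. }
        exact (@defT_shift h (fun n => S (S (S n))) Hh). }
      exact (@def_shift _ (fun n => match n with 0 => 2 | 1 => 1 | _ => 0 end) HQ).
    + intros e. split. { intros H. eauto. } now intros (z & -> & H).
  - intros e. split.
    + intros H. exists (f e). split; auto. exists (g e). auto.
    + now intros (x & -> & y & -> & H).
Qed.

End Definability.

(* The hooks are extended below with one case for each definable notion. *)
Ltac solve_def_hook := fail.
Ltac solve_defT_hook := fail.

Ltac solve_defT := repeat first
  [ assumption
  | lazymatch goal with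
    | |- DefT (fun _ => ?c) => apply (defT_const c)
    | |- DefT (fun e => e ?n) => apply (@defT_var _ n)
    | |- DefT (fun e => oS _) => apply defT_S
    | |- DefT (fun e => oA _ _) => apply defT_A
    | |- DefT (fun e => oM _ _) => apply defT_M
    | |- DefT (fun e => ?f (fun n => e (@?g n))) =>
        apply (@defT_shift _ f g)
    | |- DefT _ => solve_defT_hook
    end ].

(* Proves definability along the shape of the predicate. *)
Ltac solve_def_step :=
  first
  [ assumption
  | lazymatch goal with
    | |- DefT _ => solve_defT
    | |- Def _ (fun _ => ?Q) => apply (def_prop _ Q)
    | |- Def _ (fun e => _ = _) => apply def_eq
    | |- Def _ (fun e => _ /\ _) => apply def_and
    | |- Def _ (fun e => _ \/ _) => apply def_or
    | |- Def _ (fun e => _ <-> _) => apply def_iff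
    | |- Def _ (fun e => ~ _) => apply def_not
    | |- Def _ (fun e => ex _) => apply def_ex; cbv beta
    | |- Def ?X (fun e => ?X _) => apply def_pred
    | HQ : Def ?X (fun e => ?Q (e 0)) |- Def ?X (fun e => ?Q _) =>
        apply (def_subst1 HQ)
    | HQ : Def ?X (fun e => ?Q (e 0) (e 1)) |- Def ?X (fun e => ?Q _ _) =>
        apply (def_subst2 HQ)
    | HQ : Def ?X (fun e => ?Q (e 0) (e 1) (e 2)) |- Def ?X (fun e => ?Q _ _ _) =>
        apply (def_subst3 HQ)
    | |- Def _ _ => solve_def_hook
    end
  | lazymatch goal with
    | |- Def _ (fun e => forall x, _) => first [apply def_imp | apply def_all; cbv beta]
    end ].
Ltac solve_def := repeat solve_def_step.

(** ** Order and pairing *)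

Section Arith.
Context {M : str} {X : M -> Prop} (H : inductive_class X).
Implicit Types x y z w a b : M.

Lemma ind (Y : M -> Prop) : Def X (fun e => Y (e 0)) ->
  Y o0 -> (forall x, Y x -> Y (oS x)) -> forall x, Y x.
Proof.
  intros (A & r & HA) H0 HS.
  assert (K : forall y,
    Y y <-> sat (fun _ : unit => X) (upd (mix (fun _ => o0) r) 0 y) A).
  { intros y. rewrite (HA (upd (fun _ => o0) 0 y)). apply sat_ext.
    intros v _. unfold upd at 2. destruct (Nat.eqb_spec v 0) as [->|N]; auto.
    unfold mix. destruct (Nat.even v) eqn:E; auto. apply upd_other.
    destruct v as [|[|v]]; simpl in *; congruence. }
  intros x. apply K. apply (pa_ind H); [now apply K|].
  intros y Hy. apply K, HS, K, Hy.
Qed.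

Lemma add0x x : o0 ⊕ x = x.
Proof.
  revert x. apply ind; [solve_def|apply (pa_A0 H)|].
  intros x IH. now rewrite (pa_AS H), IH.
Qed.

Lemma addSx x y : oS x ⊕ y = oS (x ⊕ y).
Proof.
  revert y. apply ind; [solve_def| |].
  - now rewrite !(pa_A0 H).
  - intros y IH. now rewrite !(pa_AS H), IH.
Qed.

Lemma addC x y : x ⊕ y = y ⊕ x.
Proof.
  revert y. apply ind; [solve_def| |].
  - now rewrite add0x, (pa_A0 H).
  - intros y IH. now rewrite (pa_AS H), addSx, IH.
Qed.

Lemma addA x y z : x ⊕ (y ⊕ z) = x ⊕ y ⊕ z.
Proof.
  revert z. apply ind; [solve_def| |].
  - now rewrite !(pa_A0 H).
  - intros z IH. now rewrite !(pa_AS H), IH.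
Qed.

Lemma mul0x x : o0 ⊗ x = o0.
Proof.
  revert x. apply ind; [solve_def|apply (pa_M0 H)|].
  intros x IH. now rewrite (pa_MS H), IH, (pa_A0 H).
Qed.

Lemma mulSx x y : oS x ⊗ y = x ⊗ y ⊕ y.
Proof.
  revert y. apply ind; [solve_def| |].
  - now rewrite !(pa_M0 H), (pa_A0 H).
  - intros y IH. rewrite !(pa_MS H), IH, !(pa_AS H). f_equal.
    now rewrite <- !addA, (addC x y).
Qed.

Lemma mulC x y : x ⊗ y = y ⊗ x.
Proof.
  revert y. apply ind; [solve_def| |].
  - now rewrite mul0x, (pa_M0 H).
  - intros y IH. now rewrite (pa_MS H), mulSx, IH.
Qed.

Lemma mulDr x y z : x ⊗ (y ⊕ z) = x ⊗ y ⊕ x ⊗ z.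
Proof.
  revert z. apply ind; [solve_def| |].
  - now rewrite (pa_M0 H), !(pa_A0 H).
  - intros z IH. now rewrite (pa_AS H), !(pa_MS H), IH, addA.
Qed.

Lemma mulA x y z : x ⊗ (y ⊗ z) = x ⊗ y ⊗ z.
Proof.
  revert z. apply ind; [solve_def| |].
  - now rewrite !(pa_M0 H).
  - intros z IH. now rewrite !(pa_MS H), mulDr, IH.
Qed.

Lemma mul1x x : oS o0 ⊗ x = x.
Proof. now rewrite mulSx, mul0x, add0x. Qed.

Lemma model_semiring :
  semi_ring_theory (@o0 M) (oS o0) (@oA M) (@oM M) (@eq M).
Proof.
  split; auto using add0x, addC, addA, mul1x, mul0x, mulC, mulA.
  intros x y z. now rewrite !(mulC _ z), mulDr.
Qed.

Lemma S_add1 x : oS x = x ⊕ oS o0.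
Proof. now rewrite (pa_AS H), (pa_A0 H). Qed.

Add Ring model_ring : model_semiring.

(* Proves equations between polynomials that may contain [oS]. *)
Ltac mring :=
  repeat match goal with |- context [oS ?x] =>
    lazymatch x with o0 => fail | _ => rewrite (S_add1 x) end end; ring.

Lemma cases x : x = o0 \/ exists y, x = oS y.
Proof. revert x. apply ind; [solve_def|auto|eauto]. Qed.

Lemma addI x y z : z ⊕ x = z ⊕ y -> x = y.
Proof.
  revert z. apply (ind (Y:=fun z => z ⊕ x = z ⊕ y -> x = y)); [solve_def| |].
  - now rewrite !add0x.
  - intros z IH E. rewrite !addSx in E. apply (pa_inj H) in E. auto.
Qed.

Lemma le_refl x : x ≼ x.
Proof. exists o0. apply add0x. Qed.

Lemma le_trans x y z : x ≼ y -> y ≼ z -> x ≼ z.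
Proof. intros [a <-] [b <-]. exists (b ⊕ a). ring. Qed.

Lemma le_antisym x y : x ≼ y -> y ≼ x -> x = y.
Proof.
  intros [a <-] [b E].
  destruct (cases a) as [->|[c ->]]. { symmetry. apply add0x. }
  exfalso. apply (pa_S0 H (x:=b ⊕ c)).
  apply (addI (z:=x)). rewrite (pa_A0 H). etransitivity; [|exact E]. mring.
Qed.

Lemma le0x x : o0 ≼ x.
Proof. exists x. apply (pa_A0 H). Qed.

Lemma le_S x : x ≼ oS x.
Proof. exists (oS o0). mring. Qed.

Lemma le_total x y : x ≼ y \/ y ≺ x.
Proof.
  revert x. apply (ind (Y:=fun x => x ≼ y \/ y ≺ x)).
  { unfold lt, le. solve_def. }
  - left. apply le0x.
  - intros x [[z E]|K].
    + destruct (cases z) as [->|[w ->]].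
      * right. rewrite add0x in E. subst. apply le_refl.
      * left. exists w. rewrite <- E. mring.
    + right. eapply le_trans; [exact K|apply le_S].
Qed.

Lemma lt_le x y : x ≺ y -> x ≼ y.
Proof. intros K. eapply le_trans; [apply le_S|exact K]. Qed.

Lemma lt_irrefl x : ~ x ≺ x.
Proof.
  intros [z E]. apply (pa_S0 H (x:=z)). apply (addI (z:=x)).
  rewrite (pa_A0 H). etransitivity; [|exact E]. mring.
Qed.

Lemma lt_nle x y : x ≺ y -> ~ y ≼ x.
Proof. intros K L. apply (@lt_irrefl x). eapply le_trans; eauto. Qed.

Lemma le_SS x y : oS x ≼ oS y <-> x ≼ y.
Proof.
  split; intros [z E]; exists z.
  - apply (pa_inj H). rewrite <- E. now rewrite (pa_AS H).
  - now rewrite (pa_AS H), E.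
Qed.

Lemma lt_S x y : x ≺ oS y -> x ≼ y.
Proof. apply le_SS. Qed.

Lemma le_lt_S x y : x ≼ y -> x ≺ oS y.
Proof. apply le_SS. Qed.

Lemma lt_0 x : ~ x ≺ o0.
Proof. intros K. apply lt_nle in K. apply K, le0x. Qed.

Lemma le_eq_lt x y : x ≼ y -> x = y \/ x ≺ y.
Proof.
  intros [z E]. destruct (cases z) as [->|[w ->]].
  - left. now rewrite add0x in E.
  - right. exists w. rewrite <- E. mring.
Qed.

Lemma le_lt_trans x y z : x ≼ y -> y ≺ z -> x ≺ z.
Proof. intros K L. eapply le_trans; [apply le_SS; exact K|exact L]. Qed.

Lemma lt_le_trans x y z : x ≺ y -> y ≼ z -> x ≺ z.
Proof. apply le_trans. Qed.

Lemma le_addl x y : x ≼ y ⊕ x.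
Proof. now exists y. Qed.

Lemma le_addr x y : x ≼ x ⊕ y.
Proof. exists y. ring. Qed.

Lemma le_add x y z w : x ≼ y -> z ≼ w -> x ⊕ z ≼ y ⊕ w.
Proof. intros [a <-] [b <-]. exists (a ⊕ b). ring. Qed.

Lemma le_mul x y z w : x ≼ y -> z ≼ w -> x ⊗ z ≼ y ⊗ w.
Proof. intros [a <-] [b <-]. exists (a ⊗ b ⊕ a ⊗ z ⊕ x ⊗ b). ring. Qed.

Lemma strong_ind (Y : M -> Prop) : Def X (fun e => Y (e 0)) ->
  (forall x, (forall y, y ≺ x -> Y y) -> Y x) -> forall x, Y x.
Proof.
  intros HY HS x. apply HS.
  apply (ind (Y:=fun x => forall y, y ≺ x -> Y y)).
  - unfold lt, le. solve_def.
  - intros y Hy. now apply lt_0 in Hy.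
  - intros z IH y Hy. apply lt_S in Hy. apply HS. intros u Hu.
    apply IH. eapply lt_le_trans; eauto.
Qed.

End Arith.

(** * Pairs and coded sets in a structure *)

Section Codes.
Context {M : str}.

Fixpoint numM (n : nat) : M := match n with 0 => o0 | S n => oS (numM n) end.
Definition pairM (x y : M) : M := (x ⊕ y) ⊗ (x ⊕ y) ⊕ x.
Definition consM (x l : M) : M := oS (pairM x l).
Definition cVarM (i : M) : M := pairM (numM 1) i.
Definition cZeroM : M := pairM (numM 0) (numM 0).
Definition cSuccM (t : M) : M := pairM (numM 2) t.
Definition cPlusM (s t : M) : M := pairM (numM 3) (pairM s t).
Definition cTimesM (s t : M) : M := pairM (numM 4) (pairM s t).
Definition cEqM (s t : M) : M := pairM (numM 5) (pairM s t).
Definition cNegM (a : M) : M := pairM (numM 6) a.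
Definition cAndM (a b : M) : M := pairM (numM 7) (pairM a b).
Definition cOrM (a b : M) : M := pairM (numM 8) (pairM a b).
Definition cExM (v a : M) : M := pairM (numM 9) (pairM v a).
Definition cAllM (v a : M) : M := pairM (numM 10) (pairM v a).
Definition cImpM (a b : M) : M := cOrM (cNegM a) b.

Definition InSetM (x s : M) : Prop :=
  exists m a b q, s = pairM m (pairM a b) /\ x ≼ m /\ a = q ⊗ oS (oS x ⊗ b).

Definition RecM (J : (M -> Prop) -> M -> Prop) (x : M) : Prop :=
  exists s, InSetM x s /\ forall z, InSetM z s -> J (fun y => InSetM y s) z.

Definition dvd (u w : M) : Prop := exists q, q ⊗ u = w.

Lemma defT_pair f g : DefT f -> DefT g -> DefT (fun e => pairM (f e) (g e)).
Proof. intros. unfold pairM. solve_defT. Qed.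

End Codes.

Ltac unfold_codes :=
  unfold cVarM, cZeroM, cSuccM, cPlusM, cTimesM, cEqM, cNegM, cImpM, cAndM, cOrM,
    cExM, cAllM, consM in *.

Ltac solve_defT_hook ::=
  lazymatch goal with
  | |- DefT (fun e => pairM _ _) => apply defT_pair
  | |- DefT (fun e => numM _) => apply defT_const
  | |- DefT (fun e => cVarM _) => unfold cVarM
  | |- DefT (fun e => cSuccM _) => unfold cSuccM
  | |- DefT (fun e => cPlusM _ _) => unfold cPlusM
  | |- DefT (fun e => cTimesM _ _) => unfold cTimesM
  | |- DefT (fun e => cEqM _ _) => unfold cEqM
  | |- DefT (fun e => cNegM _) => unfold cNegM
  | |- DefT (fun e => cAndM _ _) => unfold cAndM
  | |- DefT (fun e => cOrM _ _) => unfold cOrM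
  | |- DefT (fun e => cExM _ _) => unfold cExM
  | |- DefT (fun e => cAllM _ _) => unfold cAllM
  | |- DefT (fun e => cImpM _ _) => unfold cImpM
  | |- DefT (fun e => consM _ _) => unfold consM
  end.

Lemma le_def (M : str) (X : M -> Prop) f g : DefT f -> DefT g -> Def X (fun e => f e ≼ g e).
Proof. unfold le. intros. solve_def. Qed.

Ltac solve_def_order :=
  lazymatch goal with
  | |- Def _ (fun e => _ ≼ _) => apply le_def
  | |- Def _ (fun e => _ ≺ _) => unfold lt; apply le_def
  end.
Ltac solve_def_hook ::= solve_def_order.

Lemma dvd_def (M : str) (X : M -> Prop) f g : DefT f -> DefT g -> Def X (fun e => dvd (f e) (g e)).
Proof. unfold dvd. intros. solve_def. Qed.

Lemma InSetM_def (M : str) (X : M -> Prop) f g :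
  DefT f -> DefT g -> Def X (fun e => InSetM (f e) (g e)).
Proof. unfold InSetM. intros. solve_def. Qed.

Ltac solve_def_sets :=
  lazymatch goal with
  | |- Def _ (fun e => InSetM _ _) => apply InSetM_def
  | |- Def _ (fun e => dvd _ _) => apply dvd_def
  | |- Def _ (fun e => RecM _ _) => unfold RecM
  | |- _ => solve_def_order
  end.
Ltac solve_def_hook ::= solve_def_sets.

Section Sets.
Context {M : str} {X : M -> Prop} (H : inductive_class X).
Implicit Types x y z w a b c d m s t u v i j k l n p q : M.

Add Ring model_ring : (model_semiring H).
Ltac mring :=
  repeat match goal with |- context [oS ?x] =>
    lazymatch x with o0 => fail | _ => rewrite (S_add1 H x) end end; ring.

Lemma square_le_pair x y : (x ⊕ y) ⊗ (x ⊕ y) ≼ pairM x y.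
Proof. apply (le_addr H). Qed.

Lemma le_square x : x ≼ x ⊗ x.
Proof.
  destruct (cases H x) as [->|[y ->]]; [apply (le0x H)|].
  exists (y ⊗ oS y). mring.
Qed.

Lemma pair_le x y x' y' : x ≼ x' -> y ≼ y' -> pairM x y ≼ pairM x' y'.
Proof. intros. unfold pairM. repeat (apply (le_add H) || apply (le_mul H)); auto. Qed.

Lemma le_pair1 x y : x ≼ pairM x y.
Proof. apply (le_addl). Qed.

Lemma le_pair2 x y : y ≼ pairM x y.
Proof.
  eapply (le_trans H); [|apply square_le_pair].
  eapply (le_trans H); [|apply le_square]. apply le_addl.
Qed.

Lemma lt_pair2 x y : y ≺ pairM (oS x) y.
Proof.
  exists ((x ⊕ y) ⊗ (x ⊕ y) ⊕ x ⊕ x ⊕ x ⊕ y ⊕ oS o0). unfold pairM. mring.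
Qed.

Lemma pair_lt x y x' y' : x ⊕ y ≺ x' ⊕ y' -> pairM x y ≺ pairM x' y'.
Proof.
  intros K. eapply (lt_le_trans H); [|apply square_le_pair].
  eapply (le_trans H); [|apply (le_mul H); exact K].
  exists (x ⊕ y ⊕ y). unfold pairM. mring.
Qed.

Lemma pair_inj x y x' y' : pairM x y = pairM x' y' -> x = x' /\ y = y'.
Proof.
  intros E.
  assert (K : x ⊕ y = x' ⊕ y').
  { destruct (le_total H (x ⊕ y) (x' ⊕ y')) as [K|K].
    - destruct (le_eq_lt H K) as [|L]; auto.
      apply pair_lt in L. rewrite E in L. destruct (lt_irrefl H L).
    - apply pair_lt in K. rewrite E in K. destruct (lt_irrefl H K). }
  assert (x = x'); [|subst; split; auto; eapply (addI H); eauto].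
  unfold pairM in E. rewrite K in E. eapply (addI H); eauto.
Qed.

Lemma numM_inj (i j : nat) : numM (M:=M) i = numM j -> i = j.
Proof.
  revert j. induction i as [|i IH]; intros [|j] E; simpl in E; auto.
  - symmetry in E. now apply (pa_S0 H) in E.
  - now apply (pa_S0 H) in E.
  - f_equal. apply IH. now apply (pa_inj H).
Qed.

(** For such a multiple [b] of [1, ..., m] the moduli 1 + (x + 1) b with [x <= m]
    are pairwise coprime. *)
Lemma common_multiple m : exists b, forall d, oS d ≼ m -> dvd (oS d) (oS b).
Proof.
  revert m. apply (ind H); [solve_def| |].
  - exists o0. intros d Hd. now apply (lt_0 H) in Hd.
  - intros m [b Hb]. exists (b ⊗ oS m ⊕ m). intros d Hd.
    replace (oS (b ⊗ oS m ⊕ m)) with (oS b ⊗ oS m) by mring.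
    apply (le_eq_lt H) in Hd as [E|Hd].
    + apply (pa_inj H) in E. subst. now exists (oS b).
    + apply (lt_S H) in Hd. apply Hb in Hd as [q <-].
      exists (q ⊗ oS m). mring.
Qed.

Lemma dvd_sub u p q : dvd u (p ⊕ q) -> dvd u p -> dvd u q.
Proof.
  intros [i Ei] [j Ej]. destruct (le_total H j i) as [[k <-]|[k <-]].
  - exists k. apply (addI H (z:=p)). rewrite <- Ei, <- Ej. ring.
  - exists o0. rewrite (mul0x H). apply (le_antisym H); [apply (le0x H)|].
    exists (k ⊗ u ⊕ u). apply (addI H (z:=p)).
    transitivity (i ⊗ u ⊕ k ⊗ u ⊕ u); [rewrite Ei; ring|].
    rewrite <- Ej. mring.
Qed.

Lemma dvd_mul u p q : dvd u p -> dvd u (q ⊗ p).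
Proof. intros [i <-]. exists (q ⊗ i). ring. Qed.

Section Moduli.
Variables m b0 : M.
Hypothesis Hb : forall d, oS d ≼ m -> dvd (oS d) (oS b0).
Let modulus y := oS (oS y ⊗ oS b0).

Lemma modulus_b y w : dvd (modulus y) (oS b0 ⊗ w) -> dvd (modulus y) w.
Proof.
  intros K. apply (dvd_mul (oS y)) in K. eapply dvd_sub; [|exact K].
  exists w. unfold modulus. mring.
Qed.

(** Coprimality is expressed by what it is used for, cancellation of a factor,
    which avoids greatest common divisors. The difference of two moduli is
    [d b] with [d <= m]; the modulus is prime to [b], and [d] divides [b]. *)
Lemma modulus_coprime x y w : x ≼ m -> y ≼ m -> x <> y ->
  dvd (modulus y) (modulus x ⊗ w) -> dvd (modulus y) w.
Proof.
  intros Hx Hy N K.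
  assert (J : exists d, oS d ≼ m /\ dvd (modulus y) (oS d ⊗ oS b0 ⊗ w)).
  { destruct (le_total H x y) as [L|[d E]].
    - destruct (le_eq_lt H L) as [|[d E]]; [tauto|]. exists d. split.
      + eapply (le_trans H); [|exact Hy]. rewrite <- E. exists x. mring.
      + eapply dvd_sub; [|exact K]. exists w. subst y. unfold modulus. mring.
    - exists d. split.
      + eapply (le_trans H); [|exact Hx]. rewrite <- E. exists y. mring.
      + apply dvd_sub with (p:=modulus y ⊗ w).
        * replace (modulus y ⊗ w ⊕ oS d ⊗ oS b0 ⊗ w) with (modulus x ⊗ w); auto.
          subst x. unfold modulus. mring.
        * exists w. ring. }
  destruct J as (d & Hd & J). apply Hb in Hd as [c Hc].
  replace (oS d ⊗ oS b0 ⊗ w) with (oS b0 ⊗ (oS d ⊗ w)) in J by ring.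
  apply modulus_b in J. apply (dvd_mul c) in J.
  replace (c ⊗ (oS d ⊗ w)) with (oS b0 ⊗ w) in J by (rewrite <- Hc; ring).
  now apply modulus_b in J.
Qed.

Lemma modulus_1 y : ~ dvd (modulus y) (oS o0).
Proof.
  intros [q E]. unfold modulus in E.
  destruct (cases H q) as [->|[p ->]].
  - rewrite (mul0x H) in E. now apply (pa_S0 H (x:=o0)).
  - apply (@lt_irrefl _ _ H (oS o0)). rewrite <- E at 2.
    exists (p ⊕ p ⊗ (oS y ⊗ oS b0) ⊕ y ⊗ oS b0 ⊕ b0). mring.
Qed.

(** The product of the moduli of the elements below [k] is coprime to all other
    moduli. *)
Lemma comprehension_aux (Y : M -> Prop) : Def X (fun e => Y (e 0)) ->
  forall k, exists a, forall y, y ≼ m ->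
    (y ≺ k /\ Y y -> dvd (modulus y) a) /\
    (~ (y ≺ k /\ Y y) -> forall w, dvd (modulus y) (a ⊗ w) -> dvd (modulus y) w).
Proof.
  intros HY. apply (ind H); [unfold modulus; solve_def| |].
  - exists (oS o0). intros y _. split.
    + intros [K _]. now apply (lt_0 H) in K.
    + intros _ w. now rewrite (mul1x H).
  - intros k [a Ha]. destruct (classic (k ≼ m /\ Y k)) as [[Hk1 Hk2]|Hk].
    + exists (modulus k ⊗ a). intros y Hy. destruct (Ha y Hy) as [H1 H2]. split.
      * intros [K1 K2]. apply (lt_S H) in K1.
        apply (le_eq_lt H) in K1 as [->|K1].
        -- exists a. ring.
        -- apply dvd_mul. auto.
      * intros N w K. assert (y <> k).
        { intros ->. apply N. split; auto. apply (le_refl H). }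
        apply H2.
        -- intros [K1 K2]. apply N. split; auto.
           eapply (lt_le_trans H); [exact K1|apply (le_S H)].
        -- apply modulus_coprime with k; auto.
           replace (modulus k ⊗ (a ⊗ w)) with (modulus k ⊗ a ⊗ w) by ring. auto.
    + exists a. intros y Hy. destruct (Ha y Hy) as [H1 H2]. split.
      * intros [K1 K2]. apply H1. split; auto. apply (lt_S H) in K1.
        apply (le_eq_lt H) in K1 as [->|K1]; tauto.
      * intros N. apply H2. intros [K1 K2]. apply N. split; auto.
        eapply (lt_le_trans H); [exact K1|apply (le_S H)].
Qed.

End Moduli.

Lemma comprehension_dvd (Y : M -> Prop) m : Def X (fun e => Y (e 0)) ->
  exists a b, forall x, x ≼ m -> (dvd (oS (oS x ⊗ b)) a <-> Y x).
Proof.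
  intros HY. destruct (common_multiple m) as [b Hb].
  destruct (comprehension_aux Hb HY (oS m)) as [a Ha].
  exists a, (oS b). intros x Hx. destruct (Ha x Hx) as [K1 K2]. split.
  - intros [q E]. apply NNPP. intros N. apply (@modulus_1 b x).
    apply K2; [tauto|]. exists q. rewrite <- E. ring.
  - intros K. apply K1. split; auto. apply (le_lt_S H Hx).
Qed.

Lemma comprehension (Y : M -> Prop) m : Def X (fun e => Y (e 0)) ->
  exists s, forall x, InSetM x s <-> x ≼ m /\ Y x.
Proof.
  intros HY. destruct (comprehension_dvd m HY) as (a & b & K).
  exists (pairM m (pairM a b)). intros x. split.
  - intros (m' & a' & b' & q & E & Hx & Eq).
    apply pair_inj in E as [<- E]. apply pair_inj in E as [<- <-].
    split; auto. apply K; auto. now exists q.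
  - intros [Hx Kx]. apply K in Kx as [q E]; auto. exists m, a, b, q. auto.
Qed.

Lemma InSet_le x s : InSetM x s -> x ≼ s.
Proof.
  intros (m & a & b & q & -> & Hx & _). eapply (le_trans H); [exact Hx|].
  apply le_pair1.
Qed.

Lemma set_empty : exists s, forall x, ~ InSetM x s.
Proof.
  destruct (comprehension (Y:=fun _ => False) o0) as [s Hs]; [solve_def|].
  exists s. intros x K. now apply Hs in K.
Qed.

Lemma set_union s t : exists u, forall x, InSetM x u <-> InSetM x s \/ InSetM x t.
Proof.
  destruct (comprehension (Y:=fun x => InSetM x s \/ InSetM x t) (s ⊕ t))
    as [u Hu]; [solve_def|].
  exists u. intros x. rewrite Hu. split; [tauto|]. intros K. split; auto.
  destruct K as [K|K]; apply InSet_le in K; eapply (le_trans H); try exact K;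
    [apply (le_addr H)|apply le_addl].
Qed.

Lemma set_single x : exists u, forall y, InSetM y u <-> y = x.
Proof.
  destruct (comprehension (Y:=fun y => y = x) x) as [u Hu]; [solve_def|].
  exists u. intros y. rewrite Hu. split; [tauto|]. intros ->. split; auto.
  apply (le_refl H).
Qed.

End Sets.

(** ** Definition by recursion on codes *)

Section Recursion.
Context {M : str} {X : M -> Prop} (H : inductive_class X).
Implicit Types x y z s : M.

(** Scott continuity with respect to unions of coded sets. The first components
    of the recursive calls are bounded, but not always the calls themselves, as
    in the case of the value of a product with a factor zero; hence a fixed
    point is not found by comprehension below a bound but by the union of the
    witnesses of the finitely many calls. *)
Definition Cont (Phi : (M -> Prop) -> Prop) : Prop :=
  (forall R R' : M -> Prop, (forall x, R x -> R' x) -> Phi R -> Phi R') /\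
  (forall G : M -> Prop,
     (exists s, G s /\ forall x, ~ InSetM x s) ->
     (forall s t, G s -> G t ->
        exists u, G u /\ forall x, InSetM x u <-> InSetM x s \/ InSetM x t) ->
     Phi (fun x => exists s, G s /\ InSetM x s) ->
     exists s, G s /\ Phi (fun x => InSetM x s)).

Lemma cont_const Q : Cont (fun _ => Q).
Proof. split; [tauto|]. intros G (s & Hs & _) _ K. eauto. Qed.

Lemma cont_call x : Cont (fun R => R x).
Proof. split; auto. Qed.

Lemma cont_and Phi Psi : Cont Phi -> Cont Psi -> Cont (fun R => Phi R /\ Psi R).
Proof.
  intros [M1 C1] [M2 C2]. split.
  - intros R R' HR [K1 K2]. split; eauto.
  - intros G G0 GU [K1 K2].
    destruct (C1 G G0 GU K1) as (s & Hs & Ks).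
    destruct (C2 G G0 GU K2) as (t & Ht & Kt).
    destruct (GU s t Hs Ht) as (u & Hu & E). exists u. split; auto.
    split; [eapply M1|eapply M2]; eauto; intros x Hx; apply E; auto.
Qed.

Lemma cont_or Phi Psi : Cont Phi -> Cont Psi -> Cont (fun R => Phi R \/ Psi R).
Proof.
  intros [M1 C1] [M2 C2]. split.
  - intros R R' HR [K|K]; [left|right]; eauto.
  - intros G G0 GU [K|K];
      [destruct (C1 G G0 GU K) as (s & Hs & Ks)
      |destruct (C2 G G0 GU K) as (s & Hs & Ks)]; eauto.
Qed.

Lemma cont_ex (Phi : M -> (M -> Prop) -> Prop) :
  (forall x, Cont (Phi x)) -> Cont (fun R => exists x, Phi x R).
Proof.
  intros C. split.
  - intros R R' HR [x K]. exists x. eapply (proj1 (C x)); eauto.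
  - intros G G0 GU [x K].
    destruct (proj2 (C x) G G0 GU K) as (s & Hs & Ks). eauto.
Qed.

(** From right to left, the sets that witness the recursive calls are united,
    and the new element is added. *)
Lemma rec_unfold J : (forall z, Cont (fun R => J R z)) ->
  forall x, RecM J x <-> J (RecM J) x.
Proof.
  intros C x. split.
  - intros (s & Hx & Hs). eapply (proj1 (C x)); [|exact (Hs x Hx)].
    intros y Hy. now exists s.
  - intros K.
    pose (G := fun s => forall z, InSetM z s -> J (fun y => InSetM y s) z).
    assert (GU : forall s t, G s -> G t ->
        exists u, G u /\ forall x, InSetM x u <-> InSetM x s \/ InSetM x t).
    { intros s t Hs Ht. destruct (set_union H s t) as [u Hu]. exists u. split; auto.
      intros z Hz. apply Hu in Hz as [Hz|Hz];
        [apply Hs in Hz|apply Ht in Hz]; eapply (proj1 (C z)); try exact Hz;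
        intros y Hy; apply Hu; auto. }
    destruct (proj2 (C x) G) as (s & Hs & Ks); auto.
    { destruct (set_empty H) as [s Hs]. exists s. split; auto.
      intros z Hz. now apply Hs in Hz. }
    { eapply (proj1 (C x)); [|exact K]. intros y (s & Hy & Hs). now exists s. }
    destruct (set_single H x) as [t Ht].
    destruct (set_union H s t) as [u Hu]. exists u. split.
    + apply Hu. right. now apply Ht.
    + intros z Hz. apply (proj1 (C z) (fun y => InSetM y s)).
      { intros y Hy. apply Hu. auto. }
      apply Hu in Hz as [Hz|Hz]; auto. apply Ht in Hz. now subst.
Qed.

End Recursion.

Ltac solve_cont := repeat first
  [ apply cont_const | apply cont_call | apply cont_and | apply cont_or
  | apply cont_ex; intro ].

(** * The arithmetized syntax, read in a structure *)

Section SyntaxM.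
Context {M : str}.
Implicit Types x y z : M.

Definition isTermJ (R : M -> Prop) (z : M) : Prop :=
    z = cZeroM
  \/ (exists i, z = cVarM i)
  \/ (exists t, z = cSuccM t /\ R t)
  \/ (exists s t, (z = cPlusM s t \/ z = cTimesM s t) /\ R s /\ R t).
Definition isTermM : M -> Prop := RecM isTermJ.

Definition isFormJ (R : M -> Prop) (z : M) : Prop :=
    (exists s t, z = cEqM s t /\ isTermM s /\ isTermM t)
  \/ (exists a, z = cNegM a /\ R a)
  \/ (exists a b, (z = cAndM a b \/ z = cOrM a b) /\ R a /\ R b)
  \/ (exists v a, (z = cExM v a \/ z = cAllM v a) /\ R a).
Definition isFormM : M -> Prop := RecM isFormJ.

Definition FreeInJ (v : M) (R : M -> Prop) (z : M) : Prop :=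
    z = cVarM v
  \/ (exists a, (z = cSuccM a \/ z = cNegM a) /\ R a)
  \/ (exists a b, (z = cPlusM a b \/ z = cTimesM a b \/ z = cEqM a b
             \/ z = cAndM a b \/ z = cOrM a b) /\ (R a \/ R b))
  \/ (exists u a, (z = cExM u a \/ z = cAllM u a) /\ ~ u = v /\ R a).
Definition FreeInM (v : M) : M -> Prop := RecM (FreeInJ v).

Definition isClosedTermM (x : M) : Prop := isTermM x /\ forall v, ~ FreeInM v x.
Definition isSentM (x : M) : Prop := isFormM x /\ forall v, ~ FreeInM v x.
Definition isForm1M (v x : M) : Prop :=
  isFormM x /\ forall u, FreeInM u x -> u = v.

Definition SubJ (v r : M) (R : M -> Prop) (z : M) : Prop :=
    z = pairM cZeroM cZeroM
  \/ z = pairM (cVarM v) r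
  \/ (exists u, ~ u = v /\ z = pairM (cVarM u) (cVarM u))
  \/ (exists a a', R (pairM a a')
       /\ (z = pairM (cSuccM a) (cSuccM a') \/ z = pairM (cNegM a) (cNegM a')))
  \/ (exists a a' b b', R (pairM a a') /\ R (pairM b b')
       /\ (z = pairM (cPlusM a b) (cPlusM a' b')
          \/ z = pairM (cTimesM a b) (cTimesM a' b')
          \/ z = pairM (cEqM a b) (cEqM a' b')
          \/ z = pairM (cAndM a b) (cAndM a' b')
          \/ z = pairM (cOrM a b) (cOrM a' b')))
  \/ (exists u a a', ~ u = v /\ R (pairM a a')
       /\ (z = pairM (cExM u a) (cExM u a') \/ z = pairM (cAllM u a) (cAllM u a')))
  \/ (exists a, z = pairM (cExM v a) (cExM v a)
               \/ z = pairM (cAllM v a) (cAllM v a)).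
Definition SubM (x v r y : M) : Prop := RecM (SubJ v r) (pairM x y).

Definition FreeForJ (r v : M) (R : M -> Prop) (z : M) : Prop :=
    (exists s t, z = cEqM s t)
  \/ (exists a, z = cNegM a /\ R a)
  \/ (exists a b, (z = cAndM a b \/ z = cOrM a b) /\ R a /\ R b)
  \/ (exists u a, (z = cExM u a \/ z = cAllM u a)
       /\ (~ FreeInM v z \/ (~ FreeInM u r /\ R a))).
Definition FreeForM (r v : M) : M -> Prop := RecM (FreeForJ r v).

Definition NumeralJ (R : M -> Prop) (z : M) : Prop :=
    z = pairM o0 cZeroM
  \/ (exists y m, z = pairM (oS y) (cSuccM m) /\ R (pairM y m)).
Definition NumeralM (x n : M) : Prop := RecM NumeralJ (pairM x n).

Definition ValJ (R : M -> Prop) (z : M) : Prop :=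
    z = pairM cZeroM o0
  \/ (exists s y, R (pairM s y) /\ z = pairM (cSuccM s) (oS y))
  \/ (exists s y s' y', R (pairM s y) /\ R (pairM s' y')
       /\ (z = pairM (cPlusM s s') (y ⊕ y')
          \/ z = pairM (cTimesM s s') (y ⊗ y'))).
Definition ValM (t x : M) : Prop := RecM ValJ (pairM t x).

Definition MemJ (x : M) (R : M -> Prop) (z : M) : Prop :=
  exists y l, z = consM y l /\ (y = x \/ R l).
Definition MemM (x : M) : M -> Prop := RecM (MemJ x).

Definition isFormListJ (R : M -> Prop) (z : M) : Prop :=
  z = o0 \/ (exists y l, z = consM y l /\ isFormM y /\ R l).
Definition isFormListM : M -> Prop := RecM isFormListJ.

Definition NotFreeInSeqM (u G D : M) : Prop :=
  forall x, MemM x G \/ MemM x D -> ~ FreeInM u x.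

Definition Rule0M (tau : M -> Prop) (G D : M) : Prop :=
    (exists a, G = consM a o0 /\ D = consM a o0)
  \/ (exists a, G = o0 /\ D = consM a o0 /\ isSentM a /\ tau a)
  \/ (exists t, G = o0 /\ D = consM (cEqM t t) o0)
  \/ (exists s t v p q a b, isTermM p /\ isTermM q
       /\ G = consM (cEqM s t) (consM a o0) /\ D = consM b o0
       /\ SubM (cEqM p q) v s a /\ SubM (cEqM p q) v t b).

Definition Rule1M (G1 D1 G D : M) : Prop :=
    (forall x, (MemM x G1 -> MemM x G) /\ (MemM x D1 -> MemM x D))
  \/ (exists a, D1 = consM a D /\ G = consM (cNegM a) G1)
  \/ (exists a, G1 = consM a G /\ D = consM (cNegM a) D1)
  \/ (exists a b L, G1 = consM a (consM b L) /\ G = consM (cAndM a b) L /\ D = D1)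
  \/ (exists a b L, D1 = consM a (consM b L) /\ D = consM (cOrM a b) L /\ G = G1)
  \/ (exists v a r b L, isTermM r /\ FreeForM r v a /\ SubM a v r b
       /\ G1 = consM b L /\ G = consM (cAllM v a) L /\ D = D1)
  \/ (exists v a r b L, isTermM r /\ FreeForM r v a /\ SubM a v r b
       /\ D1 = consM b L /\ D = consM (cExM v a) L /\ G = G1)
  \/ (exists v a u b L, NotFreeInSeqM u G D
       /\ FreeForM (cVarM u) v a /\ SubM a v (cVarM u) b
       /\ D1 = consM b L /\ D = consM (cAllM v a) L /\ G = G1)
  \/ (exists v a u b L, NotFreeInSeqM u G D
       /\ FreeForM (cVarM u) v a /\ SubM a v (cVarM u) b
       /\ G1 = consM b L /\ G = consM (cExM v a) L /\ D = D1).

Definition Rule2M (G1 D1 G2 D2 G D : M) : Prop :=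
    (exists a, G1 = G /\ D1 = consM a D /\ G2 = consM a G /\ D2 = D)
  \/ (exists a b L, G1 = G /\ G2 = G
       /\ D1 = consM a L /\ D2 = consM b L /\ D = consM (cAndM a b) L)
  \/ (exists a b L, D1 = D /\ D2 = D
       /\ G1 = consM a L /\ G2 = consM b L /\ G = consM (cOrM a b) L).

Definition ConclM (d G D : M) : Prop := exists l, d = pairM (pairM G D) l.

Definition isProofJ (tau : M -> Prop) (R : M -> Prop) (z : M) : Prop :=
  exists G D, isFormListM G /\ isFormListM D /\
  (  (z = pairM (pairM G D) o0 /\ Rule0M tau G D)
   \/ (exists d1 G1 D1, z = pairM (pairM G D) (consM d1 o0) /\ R d1
        /\ ConclM d1 G1 D1 /\ Rule1M G1 D1 G D)
   \/ (exists d1 G1 D1 d2 G2 D2,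
        z = pairM (pairM G D) (consM d1 (consM d2 o0)) /\ R d1 /\ R d2
        /\ ConclM d1 G1 D1 /\ ConclM d2 G2 D2 /\ Rule2M G1 D1 G2 D2 G D)).
Definition isProofM (tau : M -> Prop) : M -> Prop := RecM (isProofJ tau).

Definition PrM (tau : M -> Prop) (x : M) : Prop :=
  exists d, isProofM tau d /\ ConclM d o0 (consM x o0).

(** The code of a formula, for several purposes at once: [sg] renumbers the
    variables, [pl] translates the atoms with predicates, and [e] plugs in terms
    for some of the free variables. *)
Fixpoint codeT (sg : nat -> nat) (e : nat -> option M) (t : term) : M :=
  match t with
  | Var v => match e v with Some c => c | None => cVarM (numM (sg v)) end
  | Zero => cZeroM
  | Succ t => cSuccM (codeT sg e t)
  | Plus s t => cPlusM (codeT sg e s) (codeT sg e t)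
  | Times s t => cTimesM (codeT sg e s) (codeT sg e t)
  end.

Fixpoint codeF P (sg : nat -> nat) (pl : P -> M -> M) (e : nat -> option M)
    (A : form P) : M :=
  match A with
  | FEq s t => cEqM (codeT sg e s) (codeT sg e t)
  | FPred p t => pl p (codeT sg e t)
  | FNeg A => cNegM (codeF sg pl e A)
  | FAnd A B => cAndM (codeF sg pl e A) (codeF sg pl e B)
  | FOr A B => cOrM (codeF sg pl e A) (codeF sg pl e B)
  | FEx v A => cExM (numM (sg v)) (codeF sg pl (upd e v None) A)
  | FAll v A => cAllM (numM (sg v)) (codeF sg pl (upd e v None) A)
  end.

Definition code (A : LPA) : M :=
  codeF (fun v => v) (fun p : Empty_set => match p with end) (fun _ => None) A.

Definition GeneralizesJ (y : M) (R : M -> Prop) (z : M) : Prop :=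
  z = y \/ (exists v a, z = cAllM v a /\ R a).
Definition GeneralizesM (x y : M) : Prop := RecM (GeneralizesJ y) x.

Definition isInductionM (x : M) : Prop :=
  exists v a a0 aS hyp step, isFormM a /\ SubM a v cZeroM a0
    /\ SubM a v (cSuccM (cVarM v)) aS
    /\ step = cAllM v (cImpM a aS) /\ hyp = cAndM a0 step
    /\ x = cImpM hyp (cAllM v a).

Definition AxPAM (x : M) : Prop :=
    (exists A, In A PA_basic /\ x = code A)
  \/ (isSentM x /\ exists y, isInductionM y /\ GeneralizesM x y).

Definition TrInstM (T : M -> Prop) (a v x : M) : Prop :=
  exists n b, NumeralM x n /\ SubM a v n b /\ T b.

End SyntaxM.

(** ** Agreement with the formulae *)

Section Agreement.
Context {M : str} {P : Type} (I : P -> M -> Prop).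
Implicit Types (e : nat -> M) (n : nat) (t : term) (F G : bform P).

(** The formulae are functions of the first unused variable [n], and only the
    environment below [n] matters. A term or a predicate of terms agrees with
    an object or a class of the structure if it does so in all extensions of
    this environment: binders only ever extend it. *)
Definition Ext e n e' n' : Prop := n <= n' /\ forall v, v < n -> e' v = e v.
Definition TRel e n t (a : M) : Prop :=
  (forall v, In v (fvt t) -> v < n) /\ eval e t = a.
Definition BSem e n F (Y : Prop) : Prop := sat I e (F n) <-> Y.
Definition RRel e n (R : term -> bform P) (Y : M -> Prop) : Prop :=
  forall e' n' t a, Ext e n e' n' -> TRel e' n' t a -> BSem e' n' (R t) (Y a).

Lemma ext_trans e n e' n' e'' n'' :
  Ext e n e' n' -> Ext e' n' e'' n'' -> Ext e n e'' n''.
Proof.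
  intros [L1 H1] [L2 H2]. split; [lia|]. intros v Hv. rewrite H2, H1; auto. lia.
Qed.

Lemma ext_refl e n : Ext e n e n.
Proof. now split. Qed.

Lemma trel_ext e n e' n' t a : Ext e n e' n' -> TRel e n t a -> TRel e' n' t a.
Proof.
  intros [L E] [V K]. split.
  - intros v Hv. apply V in Hv. lia.
  - rewrite <- K. apply eval_ext. auto.
Qed.

Lemma rrel_ext e n e' n' R Y : Ext e n e' n' -> RRel e n R Y -> RRel e' n' R Y.
Proof. intros E HR e'' n'' t a E'. apply HR. eapply ext_trans; eauto. Qed.

Lemma rrel_call e n R Y t a : RRel e n R Y -> TRel e n t a -> BSem e n (R t) (Y a).
Proof. intros HR. apply HR, ext_refl. Qed.

Lemma trel_zero e n : TRel e n Zero o0.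
Proof. split; simpl; tauto. Qed.

Lemma trel_succ e n t a : TRel e n t a -> TRel e n (Succ t) (oS a).
Proof. intros [V <-]. split; auto. Qed.

Lemma trel_plus e n s t a b :
  TRel e n s a -> TRel e n t b -> TRel e n (Plus s t) (a ⊕ b).
Proof.
  intros [V <-] [W <-]. split; auto. simpl. intros v Hv.
  apply in_app_or in Hv as [Hv|Hv]; auto.
Qed.

Lemma trel_times e n s t a b :
  TRel e n s a -> TRel e n t b -> TRel e n (Times s t) (a ⊗ b).
Proof.
  intros [V <-] [W <-]. split; auto. simpl. intros v Hv.
  apply in_app_or in Hv as [Hv|Hv]; auto.
Qed.

Lemma trel_pair e n s t a b :
  TRel e n s a -> TRel e n t b -> TRel e n (tpair s t) (pairM a b).
Proof. intros. unfold tpair, pairM. auto using trel_plus, trel_times. Qed.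

Lemma trel_num e n k : TRel e n (num k) (numM k).
Proof. induction k; [apply trel_zero|now apply trel_succ]. Qed.

Lemma bsem_eq e n s t a b :
  TRel e n s a -> TRel e n t b -> BSem e n (beq s t) (a = b).
Proof. intros [_ <-] [_ <-]. unfold BSem; simpl; tauto. Qed.

Lemma bsem_neg e n F Y : BSem e n F Y -> BSem e n (bneg F) (~ Y).
Proof. unfold BSem. simpl. tauto. Qed.

Lemma bsem_and e n F G Y Z :
  BSem e n F Y -> BSem e n G Z -> BSem e n (band F G) (Y /\ Z).
Proof. unfold BSem. simpl. tauto. Qed.

Lemma bsem_or e n F G Y Z :
  BSem e n F Y -> BSem e n G Z -> BSem e n (bor F G) (Y \/ Z).
Proof. unfold BSem. simpl. tauto. Qed.

Lemma bsem_imp e n F G Y Z :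
  BSem e n F Y -> BSem e n G Z -> BSem e n (bimp F G) (Y -> Z).
Proof. unfold BSem. simpl. intros. destruct (classic Y); tauto. Qed.

Lemma bsem_iff e n F G Y Z :
  BSem e n F Y -> BSem e n G Z -> BSem e n (biff F G) (Y <-> Z).
Proof. unfold BSem. simpl. intros. destruct (classic Y); tauto. Qed.

Lemma ext_upd e n x : Ext e n (upd e n x) (S n).
Proof. split; auto. intros v Hv. apply upd_other. lia. Qed.

Lemma trel_upd e n x : TRel (upd e n x) (S n) (Var n) x.
Proof. split. { simpl. intros v [<-|[]]. auto. } apply upd_same. Qed.

Lemma bsem_ex e n (F : term -> bform P) (Y : M -> Prop) :
  (forall x e' n' t, Ext e n e' n' -> TRel e' n' t x -> BSem e' n' (F t) (Y x)) ->
  BSem e n (bex F) (exists x, Y x).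
Proof.
  intros H. unfold BSem. simpl.
  split; intros [x Hx]; exists x; eapply H; eauto using ext_upd, trel_upd.
Qed.

Lemma bsem_all e n (F : term -> bform P) (Y : M -> Prop) :
  (forall x e' n' t, Ext e n e' n' -> TRel e' n' t x -> BSem e' n' (F t) (Y x)) ->
  BSem e n (ball F) (forall x, Y x).
Proof.
  intros H. unfold BSem. simpl.
  split; intros Hx x; eapply H; eauto using ext_upd, trel_upd.
Qed.

End Agreement.

Ltac solve_trel := repeat first
  [ assumption
  | lazymatch goal with
    | |- TRel _ _ Zero _ => apply trel_zero
    | |- TRel _ _ lnil _ => apply trel_zero
    | |- TRel _ _ (Succ _) _ => apply trel_succ
    | |- TRel _ _ (Plus _ _) _ => apply trel_plus
    | |- TRel _ _ (Times _ _) _ => apply trel_times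
    | |- TRel _ _ (tpair _ _) _ => apply trel_pair
    | |- TRel _ _ (num _) _ => apply trel_num
    | |- TRel _ _ (lcons _ _) _ => apply trel_succ, trel_pair
    | |- TRel _ _ _ _ => progress (
        unfold cVar, cZero, cSucc, cPlus, cTimes, cEq, cNeg, cImp, cAnd, cOr, cEx,
          cAll, cVarM, cZeroM, cSuccM, cPlusM, cTimesM, cEqM, cNegM, cImpM, cAndM,
          cOrM, cExM, cAllM, consM)
    end ].

(* Moves the hypotheses to the extended environment below a binder. *)
Ltac transport E :=
  repeat match goal with
  | K : TRel _ _ _ _ |- _ => apply (trel_ext E) in K
  | K : RRel _ _ _ _ _ |- _ => apply (rrel_ext E) in K
  end; clear E.

(* Compares a formula with its reading in the structure, binder by binder. *)
Ltac bsem_hook := fail.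
Ltac bsem_step :=
  first
  [ solve [solve_trel]
  | lazymatch goal with
    | |- TRel _ _ _ _ => solve_trel
    | |- BSem _ _ _ (beq _ _) _ => apply bsem_eq
    | |- BSem _ _ _ (bneg _) _ => apply bsem_neg
    | |- BSem _ _ _ (band _ _) _ => apply bsem_and
    | |- BSem _ _ _ (bor _ _) _ => apply bsem_or
    | |- BSem _ _ _ (bimp _ _) _ => apply bsem_imp
    | |- BSem _ _ _ (biff _ _) _ => apply bsem_iff
    | |- BSem _ _ _ (bex _) _ =>
        apply bsem_ex; let E := fresh "E" in intros ? ? ? ? E ?; transport E
    | |- BSem _ _ _ (ball _) _ =>
        apply bsem_all; let E := fresh "E" in intros ? ? ? ? E ?; transport E
    | K : RRel _ _ _ ?R _ |- BSem _ _ _ (?R _) _ => apply (rrel_call K)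
    | |- _ => bsem_hook
    end ].
Ltac bsem := repeat bsem_step.

(* Closes [(exists y, y = a /\ x = f y) <-> x = f a], also with two variables. *)
Ltac eq_ex :=
  split; [intros K'; decompose [ex and] K'; subst; reflexivity
         |intros ->; repeat first [eexists|split]].

Notation agree1 F Y := (forall (M : str) (P : Type) (I : P -> M -> Prop) e n x a,
  TRel e n x a -> BSem I e n (F x) (Y a)) (only parsing).
Notation agree2 F Y := (forall (M : str) (P : Type) (I : P -> M -> Prop) e n x y a b,
  TRel e n x a -> TRel e n y b -> BSem I e n (F x y) (Y a b)) (only parsing).
Notation agree3 F Y := (forall (M : str) (P : Type) (I : P -> M -> Prop) e n x y z a b c,
  TRel e n x a -> TRel e n y b -> TRel e n z c ->
  BSem I e n (F x y z) (Y a b c)) (only parsing).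
Notation agree4 F Y := (forall (M : str) (P : Type) (I : P -> M -> Prop) e n
  x y z w a b c d, TRel e n x a -> TRel e n y b -> TRel e n z c -> TRel e n w d ->
  BSem I e n (F x y z w) (Y a b c d)) (only parsing).

#[export] Hint Extern 1 (TRel _ _ _ _) => solve_trel : bsem.

Lemma bsem_Le : agree2 (@Le _) (@le _).
Proof. intros. unfold Le, le. bsem. Qed.
#[export] Hint Resolve bsem_Le : bsem.

Lemma bsem_InSet : agree2 (@InSet _) (@InSetM _).
Proof. intros. unfold InSet, InSetM. bsem; auto with bsem. Qed.
#[export] Hint Resolve bsem_InSet : bsem.

Lemma bsem_rec (M : str) P (I : P -> M -> Prop) e n J JM x a :
  (forall e' n' R Y t z, Ext e n e' n' -> RRel I e' n' R Y -> TRel e' n' t z ->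
     BSem I e' n' (J R t) (JM Y z)) ->
  TRel e n x a -> BSem I e n (Rec J x) (RecM JM a).
Proof.
  intros HJ Hx. unfold Rec, RecM. apply bsem_ex. intros s e' n' ts E Hs.
  apply bsem_and.
  - apply bsem_InSet; auto. eapply trel_ext; eauto.
  - apply bsem_all. intros z e'' n'' tz E' Hz. apply bsem_imp.
    + apply bsem_InSet; auto. eapply trel_ext; eauto.
    + apply HJ; auto. { eapply ext_trans; eauto. }
      intros e3 n3 t y E3 Ht. apply bsem_InSet; auto.
      eapply trel_ext; [exact E3|]. eapply trel_ext; eauto.
Qed.

Ltac bsem_hook ::=
  lazymatch goal with
  | |- BSem _ _ _ (Rec _ _) _ =>
      apply bsem_rec;
      [let E := fresh "E" in intros ? ? ? ? ? ? E ? ?; transport E|bsem]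
  | |- BSem _ _ _ _ _ => solve [auto 2 with bsem nocore]
  end.

Lemma bsem_isTerm : agree1 (@isTerm _) (@isTermM _).
Proof. intros. unfold isTerm, isTermM, isTermJ. bsem. Qed.
#[export] Hint Resolve bsem_isTerm : bsem.

Lemma bsem_isForm : agree1 (@isForm _) (@isFormM _).
Proof. intros. unfold isForm, isFormM, isFormJ. bsem. Qed.
#[export] Hint Resolve bsem_isForm : bsem.

Lemma bsem_FreeIn : agree2 (@FreeIn _) (@FreeInM _).
Proof. intros. unfold FreeIn, FreeInM, FreeInJ. bsem. Qed.
#[export] Hint Resolve bsem_FreeIn : bsem.

Lemma bsem_isClosedTerm : agree1 (@isClosedTerm _) (@isClosedTermM _).
Proof. intros. unfold isClosedTerm, isClosedTermM. bsem. Qed.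
#[export] Hint Resolve bsem_isClosedTerm : bsem.

Lemma bsem_isSent : agree1 (@isSent _) (@isSentM _).
Proof. intros. unfold isSent, isSentM. bsem. Qed.
#[export] Hint Resolve bsem_isSent : bsem.

Lemma bsem_isForm1 : agree2 (@isForm1 _) (@isForm1M _).
Proof. intros. unfold isForm1, isForm1M. bsem. Qed.
#[export] Hint Resolve bsem_isForm1 : bsem.

Lemma bsem_Sub : agree4 (@Sub _) (@SubM _).
Proof. intros. unfold Sub, SubM, SubJ. bsem. Qed.
#[export] Hint Resolve bsem_Sub : bsem.

Lemma bsem_FreeFor : agree3 (@FreeFor _) (@FreeForM _).
Proof. intros. unfold FreeFor, FreeForM, FreeForJ. bsem. Qed.
#[export] Hint Resolve bsem_FreeFor : bsem.

Lemma bsem_Numeral : agree2 (@Numeral _) (@NumeralM _).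
Proof. intros. unfold Numeral, NumeralM, NumeralJ. bsem. Qed.
#[export] Hint Resolve bsem_Numeral : bsem.

Lemma bsem_Val : agree2 (@Val _) (@ValM _).
Proof. intros. unfold Val, ValM, ValJ. bsem. Qed.
#[export] Hint Resolve bsem_Val : bsem.

Lemma bsem_Mem : agree2 (@Mem _) (@MemM _).
Proof. intros. unfold Mem, MemM, MemJ. bsem. Qed.
#[export] Hint Resolve bsem_Mem : bsem.

Lemma bsem_isFormList : agree1 (@isFormList _) (@isFormListM _).
Proof. intros. unfold isFormList, isFormListM, isFormListJ. bsem. Qed.
#[export] Hint Resolve bsem_isFormList : bsem.

Lemma bsem_NotFreeInSeq : agree3 (@NotFreeInSeq _) (@NotFreeInSeqM _).
Proof. intros. unfold NotFreeInSeq, NotFreeInSeqM. bsem. Qed.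
#[export] Hint Resolve bsem_NotFreeInSeq : bsem.

Lemma bsem_Concl : agree3 (@Concl _) (@ConclM _).
Proof. intros. unfold Concl, ConclM. bsem. Qed.
#[export] Hint Resolve bsem_Concl : bsem.

Lemma bsem_Generalizes : agree2 (@Generalizes _) (@GeneralizesM _).
Proof. intros. unfold Generalizes, GeneralizesM, GeneralizesJ. bsem. Qed.
#[export] Hint Resolve bsem_Generalizes : bsem.

Lemma bsem_isInduction : agree1 (@isInduction _) (@isInductionM _).
Proof. intros. unfold isInduction, isInductionM. bsem. Qed.
#[export] Hint Resolve bsem_isInduction : bsem.

Lemma bsem_Rule1 : agree4 (@Rule1 _) (@Rule1M _).
Proof. intros. unfold Rule1, Rule1M. bsem. Qed.

Lemma bsem_isProof (M : str) P (I : P -> M -> Prop) e n tau Tau x a :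
  RRel I e n tau Tau -> TRel e n x a -> BSem I e n (isProof tau x) (isProofM Tau a).
Proof.
  intros. unfold isProof, isProofM, isProofJ. bsem;
    first [apply bsem_Rule1; assumption
          |progress unfold Rule0, Rule0M; bsem|unfold Rule2, Rule2M; bsem].
Qed.
#[export] Hint Resolve bsem_isProof : bsem.

Lemma bsem_Pr (M : str) P (I : P -> M -> Prop) e n tau Tau x a :
  RRel I e n tau Tau -> TRel e n x a -> BSem I e n (Pr tau x) (PrM Tau a).
Proof. intros. unfold Pr, PrM. bsem. Qed.
#[export] Hint Resolve bsem_Pr : bsem.

Lemma bsem_CodeOfTerm (M : str) P (I : P -> M -> Prop) t : forall e n x a,
  TRel e n x a -> BSem I e n (CodeOfTerm t x) (a = codeT (fun v => v) (fun _ => None) t).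
Proof.
  induction t as [v| |t IH|s IHs t IHt|s IHs t IHt]; intros e n x a Hx.
  - simpl. bsem.
  - simpl. bsem.
  - assert (K : BSem I e n (CodeOfTerm (Succ t) x)
      (exists b, b = codeT (fun v => v) (fun _ => None) t /\ a = cSuccM b)).
    { simpl. bsem. }
    unfold BSem in *. rewrite K. simpl. eq_ex.
  - assert (K : BSem I e n (CodeOfTerm (Plus s t) x)
      (exists b c, b = codeT (fun v => v) (fun _ => None) s /\
                   c = codeT (fun v => v) (fun _ => None) t /\ a = cPlusM b c)).
    { simpl. bsem. }
    unfold BSem in *. rewrite K. simpl. eq_ex.
  - assert (K : BSem I e n (CodeOfTerm (Times s t) x)
      (exists b c, b = codeT (fun v => v) (fun _ => None) s /\
                   c = codeT (fun v => v) (fun _ => None) t /\ a = cTimesM b c)).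
    { simpl. bsem. }
    unfold BSem in *. rewrite K. simpl. eq_ex.
Qed.

Lemma upd_None (M : str) v : upd (fun _ : nat => @None M) v None = fun _ => None.
Proof. extensionality u. unfold upd. now destruct (u =? v). Qed.

Lemma bsem_CodeOf (M : str) P (I : P -> M -> Prop) A : forall e n x a,
  TRel e n x a -> BSem I e n (CodeOf A x) (a = code A).
Proof.
  induction A as [s t|[]|A IH|A IHA B IHB|A IHA B IHB|v A IH|v A IH];
    intros e n x a Hx.
  - assert (K : BSem I e n (CodeOf (FEq s t) x)
      (exists b c, b = codeT (fun v => v) (fun _ => None) s /\
                   c = codeT (fun v => v) (fun _ => None) t /\ a = cEqM b c)).
    { simpl. bsem; apply bsem_CodeOfTerm; auto. }
    unfold BSem in *. rewrite K. unfold code. simpl. eq_ex.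
  - assert (K : BSem I e n (CodeOf (FNeg A) x) (exists b, b = code A /\ a = cNegM b)).
    { simpl. bsem. }
    unfold BSem in *. rewrite K. unfold code. simpl. eq_ex.
  - assert (K : BSem I e n (CodeOf (FAnd A B) x)
      (exists b c, b = code A /\ c = code B /\ a = cAndM b c)).
    { simpl. bsem. }
    unfold BSem in *. rewrite K. unfold code. simpl. eq_ex.
  - assert (K : BSem I e n (CodeOf (FOr A B) x)
      (exists b c, b = code A /\ c = code B /\ a = cOrM b c)).
    { simpl. bsem. }
    unfold BSem in *. rewrite K. unfold code. simpl. eq_ex.
  - assert (K : BSem I e n (CodeOf (FEx v A) x)
      (exists b, b = code A /\ a = cExM (numM v) b)).
    { simpl. bsem. }
    unfold BSem in *. rewrite K. unfold code. simpl. rewrite upd_None.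
    eq_ex.
  - assert (K : BSem I e n (CodeOf (FAll v A) x)
      (exists b, b = code A /\ a = cAllM (numM v) b)).
    { simpl. bsem. }
    unfold BSem in *. rewrite K. unfold code. simpl. rewrite upd_None.
    eq_ex.
Qed.

Lemma bsem_AxPA : agree1 (@AxPA _) (@AxPAM _).
Proof.
  intros M P I e n x a Hx. unfold AxPA, AxPAM. apply bsem_or; [|bsem].
  assert (K : forall l, BSem I e n
     (fold_right (fun A F => bor (CodeOf A x) F) (bneg (beq Zero Zero)) l)
     (exists A, In A l /\ a = code A)).
  { induction l as [|A l IH]; simpl.
    - unfold BSem. simpl. firstorder.
    - pose proof (bsem_CodeOf I A Hx) as J. unfold BSem in *. simpl.
      rewrite IH, J. firstorder congruence. }
  apply K.
Qed.
#[export] Hint Resolve bsem_AxPA : bsem.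

Arguments numM : simpl never.

(** * Assignments *)

Section Assignments.
Local Open Scope arith_scope.
Variable P : Type.

(** An assignment is a list of pairs of a variable and a value; the first
    entry for a variable counts, and variables without entry have the value
    zero, so that every object of a structure is an assignment. *)
Definition Look (v al x : term) : bform P := Rec (fun R z =>
    (∃ w r, z ≐ ⟨lcons ⟨v, w⟩ r, w⟩)
  ∨ (∃ u y r w, ¬ u ≐ v ∧ z ≐ ⟨lcons ⟨u, y⟩ r, w⟩ ∧ R ⟨r, w⟩)
  ∨ (∃ r, (∀ u y r', ¬ r ≐ lcons ⟨u, y⟩ r') ∧ z ≐ ⟨r, Zero⟩)) ⟨al, x⟩.

Definition TVal (al t x : term) : bform P := Rec (fun R z =>
    z ≐ ⟨cZero, Zero⟩
  ∨ (∃ i y, Look i al y ∧ z ≐ ⟨cVar i, y⟩)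
  ∨ (∃ s y, R ⟨s, y⟩ ∧ z ≐ ⟨cSucc s, Succ y⟩)
  ∨ (∃ s y s' y', R ⟨s, y⟩ ∧ R ⟨s', y'⟩
       ∧ (z ≐ ⟨cPlus s s', Plus y y'⟩
          ∨ z ≐ ⟨cTimes s s', Times y y'⟩))) ⟨t, x⟩.

End Assignments.
Arguments Look {P} v al x.
Arguments TVal {P} al t x.

Section AssignmentsM.
Context {M : str}.

Definition LookJ (v : M) (R : M -> Prop) (z : M) : Prop :=
    (exists w r, z = pairM (consM (pairM v w) r) w)
  \/ (exists u y r w, ~ u = v /\ z = pairM (consM (pairM u y) r) w /\ R (pairM r w))
  \/ (exists r, (forall u y r', ~ r = consM (pairM u y) r') /\ z = pairM r o0).
Definition LookM (v al x : M) : Prop := RecM (LookJ v) (pairM al x).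

Definition TValJ (al : M) (R : M -> Prop) (z : M) : Prop :=
    z = pairM cZeroM o0
  \/ (exists i y, LookM i al y /\ z = pairM (cVarM i) y)
  \/ (exists s y, R (pairM s y) /\ z = pairM (cSuccM s) (oS y))
  \/ (exists s y s' y', R (pairM s y) /\ R (pairM s' y')
       /\ (z = pairM (cPlusM s s') (y ⊕ y')
          \/ z = pairM (cTimesM s s') (y ⊗ y'))).
Definition TValM (al t x : M) : Prop := RecM (TValJ al) (pairM t x).

End AssignmentsM.

Lemma bsem_Look : agree3 (@Look _) (@LookM _).
Proof. intros. unfold Look, LookM, LookJ. bsem. Qed.
#[export] Hint Resolve bsem_Look : bsem.

Lemma bsem_TVal : agree3 (@TVal _) (@TValM _).
Proof. intros. unfold TVal, TValM, TValJ. bsem. Qed.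
#[export] Hint Resolve bsem_TVal : bsem.

(** * Definability of the syntactic notions *)

Section SyntaxDef.
Context {M : str} (X : M -> Prop).

Lemma isTermM_def f : DefT f -> Def X (fun e => isTermM (f e)).
Proof. intros. unfold isTermM, isTermJ. solve_def. Qed.

Ltac solve_def_hook ::=
  lazymatch goal with
  | |- Def _ (fun e => isTermM _) => apply isTermM_def
  | |- _ => solve_def_sets
  end.

Lemma isFormM_def f : DefT f -> Def X (fun e => isFormM (f e)).
Proof. intros. unfold isFormM, isFormJ. solve_def. Qed.

Lemma FreeInM_def f g : DefT f -> DefT g -> Def X (fun e => FreeInM (f e) (g e)).
Proof. intros. unfold FreeInM, FreeInJ. solve_def. Qed.

Lemma SubM_def f g h k : DefT f -> DefT g -> DefT h -> DefT k ->
  Def X (fun e => SubM (f e) (g e) (h e) (k e)).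
Proof. intros. unfold SubM, SubJ. solve_def. Qed.

Ltac solve_def_hook ::=
  lazymatch goal with
  | |- Def _ (fun e => FreeInM _ _) => apply FreeInM_def
  | |- _ => solve_def_sets
  end.

Lemma FreeForM_def f g h : DefT f -> DefT g -> DefT h ->
  Def X (fun e => FreeForM (f e) (g e) (h e)).
Proof. intros. unfold FreeForM, FreeForJ. solve_def. Qed.

Lemma NumeralM_def f g : DefT f -> DefT g -> Def X (fun e => NumeralM (f e) (g e)).
Proof. intros. unfold NumeralM, NumeralJ. solve_def. Qed.

Lemma ValM_def f g : DefT f -> DefT g -> Def X (fun e => ValM (f e) (g e)).
Proof. intros. unfold ValM, ValJ. solve_def. Qed.

Lemma MemM_def f g : DefT f -> DefT g -> Def X (fun e => MemM (f e) (g e)).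
Proof. intros. unfold MemM, MemJ. solve_def. Qed.

Lemma LookM_def f g h : DefT f -> DefT g -> DefT h ->
  Def X (fun e => LookM (f e) (g e) (h e)).
Proof. intros. unfold LookM, LookJ. solve_def. Qed.

Ltac solve_def_hook ::=
  lazymatch goal with
  | |- Def _ (fun e => LookM _ _ _) => apply LookM_def
  | |- _ => solve_def_sets
  end.

Lemma TValM_def f g h : DefT f -> DefT g -> DefT h ->
  Def X (fun e => TValM (f e) (g e) (h e)).
Proof. intros. unfold TValM, TValJ. solve_def. Qed.

End SyntaxDef.

Ltac solve_def_hook ::=
  lazymatch goal with
  | |- Def _ (fun e => isTermM _) => apply isTermM_def
  | |- Def _ (fun e => isFormM _) => apply isFormM_def
  | |- Def _ (fun e => FreeInM _ _) => apply FreeInM_def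
  | |- Def _ (fun e => SubM _ _ _ _) => apply SubM_def
  | |- Def _ (fun e => FreeForM _ _ _) => apply FreeForM_def
  | |- Def _ (fun e => NumeralM _ _) => apply NumeralM_def
  | |- Def _ (fun e => ValM _ _) => apply ValM_def
  | |- Def _ (fun e => MemM _ _) => apply MemM_def
  | |- Def _ (fun e => LookM _ _ _) => apply LookM_def
  | |- Def _ (fun e => TValM _ _ _) => apply TValM_def
  | |- _ => solve_def_sets
  end.

(** * The theory of the syntactic notions *)

(* Decomposes equations between codes and refutes impossible ones. *)
Ltac code_inv H :=
  unfold_codes; repeat
  match goal with
  | E : pairM _ _ = pairM _ _ |- _ => apply (pair_inj H) in E; destruct E
  | E : numM _ = numM _ |- _ => apply (numM_inj H) in E;
      lazymatch type of E with ?i = ?i => clear E | _ => try discriminate E end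
  | E : oS _ = oS _ |- _ => apply (pa_inj H) in E
  | E : oS _ = o0 |- _ => destruct (pa_S0 H E)
  | E : o0 = oS _ |- _ => destruct (pa_S0 H (eq_sym E))
  end; subst.

(* Proves a disjunctive clause from the hypotheses, with backtracking over the
   disjuncts and over the witnesses. *)
Ltac search :=
  lazymatch goal with
  | |- _ \/ _ => (left; search) + (right; search)
  | |- ex _ => eexists; search
  | |- _ /\ _ => split; search
  | |- _ => reflexivity + (multimatch goal with K : _ |- _ => exact K end)
  end.

Ltac destr K := repeat
  match type of K with
  | _ \/ _ => destruct K as [K|K]
  | ex _ => let x := fresh in destruct K as [x K]
  | _ /\ _ => let K1 := fresh in destruct K as [K1 K]; destr K1
  end.

Section SyntaxTheory.
Context {M : str} {X : M -> Prop} (H : inductive_class X).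
Implicit Types x y z w a b c d m s t u v i j k l n p q r : M.

Lemma isTermM_eq z : isTermM z <-> isTermJ isTermM z.
Proof. apply (rec_unfold H). intros. unfold isTermJ. solve_cont. Qed.

Lemma isFormM_eq z : isFormM z <-> isFormJ isFormM z.
Proof. apply (rec_unfold H). intros. unfold isFormJ. solve_cont. Qed.

Lemma FreeInM_eq v z : FreeInM v z <-> FreeInJ v (FreeInM v) z.
Proof. apply (rec_unfold H). intros. unfold FreeInJ. solve_cont. Qed.

Lemma FreeForM_eq r v z : FreeForM r v z <-> FreeForJ r v (FreeForM r v) z.
Proof. apply (rec_unfold H). intros. unfold FreeForJ. solve_cont. Qed.

Lemma SubM_eq x v r y : SubM x v r y <-> SubJ v r (RecM (SubJ v r)) (pairM x y).
Proof. apply (rec_unfold H). intros. unfold SubJ. solve_cont. Qed.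

Lemma NumeralM_eq x n : NumeralM x n <-> NumeralJ (RecM NumeralJ) (pairM x n).
Proof. apply (rec_unfold H). intros. unfold NumeralJ. solve_cont. Qed.

Lemma ValM_eq x n : ValM x n <-> ValJ (RecM ValJ) (pairM x n).
Proof. apply (rec_unfold H). intros. unfold ValJ. solve_cont. Qed.

Lemma MemM_eq x z : MemM x z <-> MemJ x (MemM x) z.
Proof. apply (rec_unfold H). intros. unfold MemJ. solve_cont. Qed.

Lemma isFormListM_eq z : isFormListM z <-> isFormListJ isFormListM z.
Proof. apply (rec_unfold H). intros. unfold isFormListJ. solve_cont. Qed.

Lemma isProofM_eq tau z : isProofM tau z <-> isProofJ tau (isProofM tau) z.
Proof. apply (rec_unfold H). intros. unfold isProofJ. solve_cont. Qed.

Lemma GeneralizesM_eq x y :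
  GeneralizesM x y <-> GeneralizesJ y (fun z => GeneralizesM z y) x.
Proof. apply (rec_unfold H). intros. unfold GeneralizesJ. solve_cont. Qed.

Lemma LookM_eq v al x : LookM v al x <-> LookJ v (RecM (LookJ v)) (pairM al x).
Proof. apply (rec_unfold H). intros. unfold LookJ. solve_cont. Qed.

Lemma TValM_eq al t x : TValM al t x <-> TValJ al (RecM (TValJ al)) (pairM t x).
Proof. apply (rec_unfold H). intros. unfold TValJ. solve_cont. Qed.

Tactic Notation "clauses" constr(E) reference(J) := rewrite E; unfold J at 1; split;
  [let K := fresh "K" in intros K; destr K; code_inv H
  |let K := fresh "K" in intros K; destr K; subst]; search.

Lemma isTerm_zero : isTermM (M:=M) cZeroM.
Proof. rewrite isTermM_eq. unfold isTermJ. search. Qed.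
Lemma isTerm_var i : isTermM (cVarM i).
Proof. rewrite isTermM_eq. unfold isTermJ. search. Qed.
Lemma isTerm_succ t : isTermM (cSuccM t) <-> isTermM t.
Proof. clauses isTermM_eq isTermJ. Qed.
Lemma isTerm_plus s t : isTermM (cPlusM s t) <-> isTermM s /\ isTermM t.
Proof. clauses isTermM_eq isTermJ. Qed.
Lemma isTerm_times s t : isTermM (cTimesM s t) <-> isTermM s /\ isTermM t.
Proof. clauses isTermM_eq isTermJ. Qed.

Lemma isForm_eq s t : isFormM (cEqM s t) <-> isTermM s /\ isTermM t.
Proof. clauses isFormM_eq isFormJ. Qed.
Lemma isForm_neg a : isFormM (cNegM a) <-> isFormM a.
Proof. clauses isFormM_eq isFormJ. Qed.
Lemma isForm_and a b : isFormM (cAndM a b) <-> isFormM a /\ isFormM b.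
Proof. clauses isFormM_eq isFormJ. Qed.
Lemma isForm_or a b : isFormM (cOrM a b) <-> isFormM a /\ isFormM b.
Proof. clauses isFormM_eq isFormJ. Qed.
Lemma isForm_ex v a : isFormM (cExM v a) <-> isFormM a.
Proof. clauses isFormM_eq isFormJ. Qed.
Lemma isForm_all v a : isFormM (cAllM v a) <-> isFormM a.
Proof. clauses isFormM_eq isFormJ. Qed.

Lemma freeIn_var v i : FreeInM v (cVarM i) <-> v = i.
Proof. clauses FreeInM_eq FreeInJ. Qed.
Lemma freeIn_zero v : ~ FreeInM v cZeroM.
Proof. rewrite FreeInM_eq. unfold FreeInJ. intros K. destr K; code_inv H. Qed.
Lemma freeIn_succ v t : FreeInM v (cSuccM t) <-> FreeInM v t.
Proof. clauses FreeInM_eq FreeInJ. Qed.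
Lemma freeIn_plus v s t : FreeInM v (cPlusM s t) <-> FreeInM v s \/ FreeInM v t.
Proof. clauses FreeInM_eq FreeInJ. Qed.
Lemma freeIn_times v s t : FreeInM v (cTimesM s t) <-> FreeInM v s \/ FreeInM v t.
Proof. clauses FreeInM_eq FreeInJ. Qed.
Lemma freeIn_eq v s t : FreeInM v (cEqM s t) <-> FreeInM v s \/ FreeInM v t.
Proof. clauses FreeInM_eq FreeInJ. Qed.
Lemma freeIn_neg v t : FreeInM v (cNegM t) <-> FreeInM v t.
Proof. clauses FreeInM_eq FreeInJ. Qed.
Lemma freeIn_and v s t : FreeInM v (cAndM s t) <-> FreeInM v s \/ FreeInM v t.
Proof. clauses FreeInM_eq FreeInJ. Qed.
Lemma freeIn_or v s t : FreeInM v (cOrM s t) <-> FreeInM v s \/ FreeInM v t.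
Proof. clauses FreeInM_eq FreeInJ. Qed.
Lemma freeIn_ex v u a : FreeInM v (cExM u a) <-> u <> v /\ FreeInM v a.
Proof. clauses FreeInM_eq FreeInJ. Qed.
Lemma freeIn_all v u a : FreeInM v (cAllM u a) <-> u <> v /\ FreeInM v a.
Proof. clauses FreeInM_eq FreeInJ. Qed.

Lemma freeFor_eq r v s t : FreeForM r v (cEqM s t).
Proof. rewrite FreeForM_eq. unfold FreeForJ. search. Qed.
Lemma freeFor_neg r v a : FreeForM r v (cNegM a) <-> FreeForM r v a.
Proof. clauses FreeForM_eq FreeForJ. Qed.
Lemma freeFor_and r v a b :
  FreeForM r v (cAndM a b) <-> FreeForM r v a /\ FreeForM r v b.
Proof. clauses FreeForM_eq FreeForJ. Qed.
Lemma freeFor_or r v a b :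
  FreeForM r v (cOrM a b) <-> FreeForM r v a /\ FreeForM r v b.
Proof. clauses FreeForM_eq FreeForJ. Qed.
Lemma freeFor_ex r v u a : FreeForM r v (cExM u a) <->
  ~ FreeInM v (cExM u a) \/ (~ FreeInM u r /\ FreeForM r v a).
Proof. clauses FreeForM_eq FreeForJ. Qed.
Lemma freeFor_all r v u a : FreeForM r v (cAllM u a) <->
  ~ FreeInM v (cAllM u a) \/ (~ FreeInM u r /\ FreeForM r v a).
Proof. clauses FreeForM_eq FreeForJ. Qed.

Lemma sub_zero v r y : SubM cZeroM v r y <-> y = cZeroM.
Proof. clauses SubM_eq SubJ. Qed.
Lemma sub_var i v r y : SubM (cVarM i) v r y <->
  (i = v /\ y = r) \/ (i <> v /\ y = cVarM i).
Proof. clauses SubM_eq SubJ. Qed.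
Lemma sub_succ a v r y :
  SubM (cSuccM a) v r y <-> exists a', y = cSuccM a' /\ SubM a v r a'.
Proof. clauses SubM_eq SubJ. Qed.
Lemma sub_neg a v r y :
  SubM (cNegM a) v r y <-> exists a', y = cNegM a' /\ SubM a v r a'.
Proof. clauses SubM_eq SubJ. Qed.
Lemma sub_plus a b v r y : SubM (cPlusM a b) v r y <->
  exists a' b', y = cPlusM a' b' /\ SubM a v r a' /\ SubM b v r b'.
Proof. clauses SubM_eq SubJ. Qed.
Lemma sub_times a b v r y : SubM (cTimesM a b) v r y <->
  exists a' b', y = cTimesM a' b' /\ SubM a v r a' /\ SubM b v r b'.
Proof. clauses SubM_eq SubJ. Qed.
Lemma sub_eq a b v r y : SubM (cEqM a b) v r y <->
  exists a' b', y = cEqM a' b' /\ SubM a v r a' /\ SubM b v r b'.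
Proof. clauses SubM_eq SubJ. Qed.
Lemma sub_and a b v r y : SubM (cAndM a b) v r y <->
  exists a' b', y = cAndM a' b' /\ SubM a v r a' /\ SubM b v r b'.
Proof. clauses SubM_eq SubJ. Qed.
Lemma sub_or a b v r y : SubM (cOrM a b) v r y <->
  exists a' b', y = cOrM a' b' /\ SubM a v r a' /\ SubM b v r b'.
Proof. clauses SubM_eq SubJ. Qed.
Lemma sub_ex u a v r y : SubM (cExM u a) v r y <->
  (u = v /\ y = cExM u a) \/ (u <> v /\ exists a', y = cExM u a' /\ SubM a v r a').
Proof. clauses SubM_eq SubJ. Qed.
Lemma sub_all u a v r y : SubM (cAllM u a) v r y <->
  (u = v /\ y = cAllM u a) \/ (u <> v /\ exists a', y = cAllM u a' /\ SubM a v r a').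
Proof. clauses SubM_eq SubJ. Qed.

Lemma numeral_0 n : NumeralM o0 n <-> n = cZeroM.
Proof. clauses NumeralM_eq NumeralJ. Qed.
Lemma numeral_S x n : NumeralM (oS x) n <-> exists m, n = cSuccM m /\ NumeralM x m.
Proof. clauses NumeralM_eq NumeralJ. Qed.

Lemma val_zero x : ValM cZeroM x <-> x = o0.
Proof. clauses ValM_eq ValJ. Qed.
Lemma val_succ t x : ValM (cSuccM t) x <-> exists y, x = oS y /\ ValM t y.
Proof. clauses ValM_eq ValJ. Qed.
Lemma val_plus s t x : ValM (cPlusM s t) x <->
  exists y y', x = y ⊕ y' /\ ValM s y /\ ValM t y'.
Proof. clauses ValM_eq ValJ. Qed.
Lemma val_times s t x : ValM (cTimesM s t) x <->
  exists y y', x = y ⊗ y' /\ ValM s y /\ ValM t y'.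
Proof. clauses ValM_eq ValJ. Qed.

Lemma tval_zero al x : TValM al cZeroM x <-> x = o0.
Proof. clauses TValM_eq TValJ. Qed.
Lemma tval_var al i x : TValM al (cVarM i) x <-> LookM i al x.
Proof. clauses TValM_eq TValJ. Qed.
Lemma tval_succ al t x : TValM al (cSuccM t) x <-> exists y, x = oS y /\ TValM al t y.
Proof. clauses TValM_eq TValJ. Qed.
Lemma tval_plus al s t x : TValM al (cPlusM s t) x <->
  exists y y', x = y ⊕ y' /\ TValM al s y /\ TValM al t y'.
Proof. clauses TValM_eq TValJ. Qed.
Lemma tval_times al s t x : TValM al (cTimesM s t) x <->
  exists y y', x = y ⊗ y' /\ TValM al s y /\ TValM al t y'.
Proof. clauses TValM_eq TValJ. Qed.

Lemma mem_nil x : ~ MemM x o0.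
Proof. rewrite MemM_eq. unfold MemJ. intros K. destr K; code_inv H. Qed.
Lemma mem_cons x y l : MemM x (consM y l) <-> y = x \/ MemM x l.
Proof. clauses MemM_eq MemJ. Qed.

Lemma isFormList_nil : isFormListM (M:=M) o0.
Proof. rewrite isFormListM_eq. unfold isFormListJ. search. Qed.
Lemma isFormList_cons y l : isFormListM (consM y l) <-> isFormM y /\ isFormListM l.
Proof. clauses isFormListM_eq isFormListJ. Qed.

End SyntaxTheory.

(** * Terms, substitution and values *)

Section Syntax.
Context {M : str} {X : M -> Prop} (H : inductive_class X).
Implicit Types x y z w a b c d m s t u v i j k l n p q r : M.

Lemma lt_tag (k : nat) a : a ≺ pairM (numM (S k)) a.
Proof. apply (lt_pair2 H). Qed.

Lemma lt_tag1 (k : nat) a b : a ≺ pairM (numM (S k)) (pairM a b).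
Proof. eapply (le_lt_trans H); [apply (le_pair1 a b)|apply lt_tag]. Qed.

Lemma lt_tag2 (k : nat) a b : b ≺ pairM (numM (S k)) (pairM a b).
Proof. eapply (le_lt_trans H); [apply (le_pair2 H a b)|apply lt_tag]. Qed.

Lemma lt_cons1 x l : x ≺ consM x l.
Proof. apply (le_lt_S H), le_pair1. Qed.

Lemma lt_cons2 x l : l ≺ consM x l.
Proof. apply (le_lt_S H), (le_pair2 H). Qed.

Lemma term_ind (Y : M -> Prop) : Def X (fun e => Y (e 0)) ->
  Y cZeroM -> (forall i, Y (cVarM i)) ->
  (forall t, isTermM t -> Y t -> Y (cSuccM t)) ->
  (forall s t, isTermM s -> Y s -> isTermM t -> Y t -> Y (cPlusM s t)) ->
  (forall s t, isTermM s -> Y s -> isTermM t -> Y t -> Y (cTimesM s t)) ->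
  forall t, isTermM t -> Y t.
Proof.
  intros HY Y0 YV YS YA YM. apply (strong_ind H (Y:=fun t => isTermM t -> Y t)); [solve_def|].
  intros t IH Ht. rewrite (isTermM_eq H) in Ht. unfold isTermJ in Ht.
  destruct Ht as [->|[[i ->]|[(s & -> & Hs)|(s & u & [->| ->] & Hs & Hu)]]]; auto.
  - apply YS; auto. apply IH; auto. apply lt_tag.
  - apply YA; auto; apply IH; auto; [apply lt_tag1|apply lt_tag2].
  - apply YM; auto; apply IH; auto; [apply lt_tag1|apply lt_tag2].
Qed.

Lemma form_ind (Y : M -> Prop) : Def X (fun e => Y (e 0)) ->
  (forall s t, isTermM s -> isTermM t -> Y (cEqM s t)) ->
  (forall a, isFormM a -> Y a -> Y (cNegM a)) ->
  (forall a b, isFormM a -> Y a -> isFormM b -> Y b -> Y (cAndM a b)) ->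
  (forall a b, isFormM a -> Y a -> isFormM b -> Y b -> Y (cOrM a b)) ->
  (forall v a, isFormM a -> Y a -> Y (cExM v a)) ->
  (forall v a, isFormM a -> Y a -> Y (cAllM v a)) ->
  forall a, isFormM a -> Y a.
Proof.
  intros HY YE YN YA YO Yex Yall. apply (strong_ind H (Y:=fun t => isFormM t -> Y t)); [solve_def|].
  intros t IH Ht. rewrite (isFormM_eq H) in Ht. unfold isFormJ in Ht.
  destruct Ht as [(s & u & -> & Hs & Hu)|[(a & -> & Ha)
    |[(a & b & [->| ->] & Ha & Hb)|(v & a & [->| ->] & Ha)]]]; auto.
  - apply YN; auto. apply IH; auto. apply lt_tag.
  - apply YA; auto; apply IH; auto; [apply lt_tag1|apply lt_tag2].
  - apply YO; auto; apply IH; auto; [apply lt_tag1|apply lt_tag2].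
  - apply Yex; auto. apply IH; auto. apply lt_tag2.
  - apply Yall; auto. apply IH; auto. apply lt_tag2.
Qed.

(** ** Substitution *)

Lemma sub_notfree_t t v r : isTermM t -> ~ FreeInM v t -> SubM t v r t.
Proof.
  revert t. apply (term_ind (Y:=fun t => ~ FreeInM v t -> SubM t v r t)); [solve_def|..].
  4, 5: intros s t _ IHs _ IHt K; rewrite ?(freeIn_plus H), ?(freeIn_times H) in K;
    rewrite ?(sub_plus H), ?(sub_times H); exists s, t; intuition.
  - intros _. now apply (sub_zero H).
  - intros i K. rewrite (freeIn_var H) in K. apply (sub_var H). right. split; congruence.
  - intros t _ IH K. rewrite (freeIn_succ H) in K. apply (sub_succ H). eauto.
Qed.

Lemma sub_notfree a v r : isFormM a -> ~ FreeInM v a -> SubM a v r a.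
Proof.
  revert a. apply (form_ind (Y:=fun a => ~ FreeInM v a -> SubM a v r a)); [solve_def|..].
  3, 4: intros a b _ IHa _ IHb K; rewrite ?(freeIn_and H), ?(freeIn_or H) in K;
    rewrite ?(sub_and H), ?(sub_or H); exists a, b; intuition.
  3, 4: intros u a _ IH K; rewrite ?(freeIn_ex H), ?(freeIn_all H) in K;
    rewrite ?(sub_ex H), ?(sub_all H); destruct (classic (u = v)); [now left|right];
    split; auto; exists a; tauto.
  - intros s t Hs Ht K. rewrite (freeIn_eq H) in K. apply (sub_eq H).
    exists s, t. repeat split; apply sub_notfree_t; tauto.
  - intros a _ IH K. rewrite (freeIn_neg H) in K. apply (sub_neg H). eauto.
Qed.

Lemma sub_total_t t v r : isTermM t -> exists y, SubM t v r y.
Proof.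
  revert t. apply (term_ind (Y:=fun t => exists y, SubM t v r y)); [solve_def|..].
  - exists cZeroM. now apply (sub_zero H).
  - intros i. destruct (classic (i = v)).
    + exists r. apply (sub_var H). auto.
    + exists (cVarM i). apply (sub_var H). auto.
  - intros t _ [y Hy]. exists (cSuccM y). apply (sub_succ H). eauto.
  - intros s t _ [y Hy] _ [y' Hy']. exists (cPlusM y y'). apply (sub_plus H). eauto.
  - intros s t _ [y Hy] _ [y' Hy']. exists (cTimesM y y'). apply (sub_times H). eauto.
Qed.

Lemma sub_total a v r : isFormM a -> exists y, SubM a v r y.
Proof.
  revert a. apply (form_ind (Y:=fun t => exists y, SubM t v r y)); [solve_def|..].
  - intros s t Hs Ht. destruct (sub_total_t v r Hs) as [y Hy].
    destruct (sub_total_t v r Ht) as [y' Hy'].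
    exists (cEqM y y'). apply (sub_eq H). eauto.
  - intros t _ [y Hy]. exists (cNegM y). apply (sub_neg H). eauto.
  - intros s t _ [y Hy] _ [y' Hy']. exists (cAndM y y'). apply (sub_and H). eauto.
  - intros s t _ [y Hy] _ [y' Hy']. exists (cOrM y y'). apply (sub_or H). eauto.
  - intros u a _ [y Hy]. destruct (classic (u = v)).
    + exists (cExM u a). apply (sub_ex H). auto.
    + exists (cExM u y). apply (sub_ex H). eauto.
  - intros u a _ [y Hy]. destruct (classic (u = v)).
    + exists (cAllM u a). apply (sub_all H). auto.
    + exists (cAllM u y). apply (sub_all H). eauto.
Qed.

Lemma sub_fun_t t v r : isTermM t -> forall y y', SubM t v r y -> SubM t v r y' -> y = y'.
Proof.
  revert t. apply (term_ind (Y:=fun t => forall y y', SubM t v r y -> SubM t v r y' -> y = y'));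
    [solve_def|..].
  4, 5: intros s t _ IHs _ IHt y y' K K';
    rewrite ?(sub_plus H), ?(sub_times H) in K, K';
    destruct K as (z & w & -> & K & L), K' as (z' & w' & -> & K' & L'); f_equal; auto.
  - intros y y' K K'. rewrite (sub_zero H) in K, K'. congruence.
  - intros i y y' K K'. rewrite (sub_var H) in K, K'. intuition congruence.
  - intros t _ IH y y' K K'. rewrite (sub_succ H) in K, K'.
    destruct K as (z & -> & K), K' as (z' & -> & K'). f_equal. auto.
Qed.

Lemma sub_fun a v r : isFormM a -> forall y y', SubM a v r y -> SubM a v r y' -> y = y'.
Proof.
  revert a. apply (form_ind (Y:=fun t => forall y y', SubM t v r y -> SubM t v r y' -> y = y'));
    [solve_def|..].
  3, 4: intros s t _ IHs _ IHt y y' K K'; rewrite ?(sub_and H), ?(sub_or H) in K, K';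
    destruct K as (z & w & -> & K & L), K' as (z' & w' & -> & K' & L'); f_equal; auto.
  3, 4: intros u a _ IH y y' K K'; rewrite ?(sub_ex H), ?(sub_all H) in K, K';
    destruct K as [[-> ->]|(N & z & -> & K)], K' as [[E ->]|(N' & z' & -> & K')];
    try tauto; try congruence; f_equal; auto.
  - intros s t Hs Ht y y' K K'. rewrite (sub_eq H) in K, K'.
    destruct K as (z & w & -> & K & L), K' as (z' & w' & -> & K' & L').
    f_equal; [exact (sub_fun_t Hs K K')|exact (sub_fun_t Ht L L')].
  - intros t _ IH y y' K K'. rewrite (sub_neg H) in K, K'.
    destruct K as (z & -> & K), K' as (z' & -> & K'). f_equal. auto.
Qed.

(** A binder of [v] blocks the substitution for [v], and no other binder can
    capture a term without other variables. This covers numerals and [S v]. *)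
Lemma freeFor_only a v r : (forall u, FreeInM u r -> u = v) -> isFormM a ->
  FreeForM r v a.
Proof.
  intros Hr. revert a. apply form_ind; [solve_def|..].
  5, 6: intros u a _ IH;
    rewrite ?(freeFor_ex H), ?(freeFor_all H), ?(freeIn_ex H), ?(freeIn_all H);
    (destruct (classic (u = v)); [tauto|]); right; auto.
  - intros. apply (freeFor_eq H).
  - intros. now apply (freeFor_neg H).
  - intros. now apply (freeFor_and H).
  - intros. now apply (freeFor_or H).
Qed.

(** ** Assignments *)

Lemma look_here v w al x : LookM v (consM (pairM v w) al) x <-> x = w.
Proof.
  rewrite (LookM_eq H). unfold LookJ at 1. split.
  - intros [(y & r & E)|[(u & y & r & x' & N & E & _)|(r & N & E)]].
    + code_inv H. congruence.
    + code_inv H. tauto.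
    + apply (pair_inj H) in E as [<- _]. now destruct (N v w al).
  - intros ->. left. eauto.
Qed.

Lemma look_there v u y al x : u <> v -> LookM v (consM (pairM u y) al) x <-> LookM v al x.
Proof.
  intros Nuv. rewrite (LookM_eq H). unfold LookJ at 1. split.
  - intros [(w & r & E)|[(u' & y' & r & x' & N & E & K)|(r & N & E)]].
    + code_inv H. tauto.
    + code_inv H. exact K.
    + apply (pair_inj H) in E as [<- _]. now destruct (N u y al).
  - intros K. right. left. exists u, y, al, x. auto.
Qed.

Lemma look_else v al x : (forall u y r, al <> consM (pairM u y) r) ->
  LookM v al x <-> x = o0.
Proof.
  intros N. rewrite (LookM_eq H). unfold LookJ at 1. split.
  - intros [(w & r & E)|[(u' & y' & r & x' & _ & E & K)|(r & _ & E)]].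
    + apply (pair_inj H) in E as [E _]. now apply N in E.
    + apply (pair_inj H) in E as [E _]. now apply N in E.
    + now apply (pair_inj H) in E as [_ E].
  - intros ->. right. right. eauto.
Qed.

Lemma look_unique v al : exists x, forall y, LookM v al y <-> y = x.
Proof.
  revert al. apply (strong_ind H); [solve_def|]. intros al IH.
  destruct (classic (exists u y r, al = consM (pairM u y) r)) as [(u & y & r & ->)|N].
  - destruct (classic (u = v)) as [->|Nuv].
    + exists y. apply look_here.
    + destruct (IH r) as [x Hx]. { apply lt_cons2. }
      exists x. intros z. now rewrite look_there.
  - exists o0. intros z. apply look_else. intros u y r ->. apply N. eauto.
Qed.

Lemma tval_unique al t : isTermM t -> exists x, forall y, TValM al t y <-> y = x.
Proof.
  revert t. apply term_ind; [solve_def|..].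
  - exists o0. apply (tval_zero H).
  - intros i. destruct (look_unique i al) as [x Hx]. exists x. intros y.
    now rewrite (tval_var H).
  - intros t _ [x Hx]. exists (oS x). intros y. rewrite (tval_succ H).
    setoid_rewrite Hx. eq_ex.
  - intros s t _ [x Hx] _ [x' Hx']. exists (x ⊕ x'). intros y. rewrite (tval_plus H).
    setoid_rewrite Hx. setoid_rewrite Hx'. eq_ex.
  - intros s t _ [x Hx] _ [x' Hx']. exists (x ⊗ x'). intros y. rewrite (tval_times H).
    setoid_rewrite Hx. setoid_rewrite Hx'. eq_ex.
Qed.

Definition same_at (v al be : M) : Prop := forall x, LookM v al x <-> LookM v be x.

Lemma same_at_cons u x v al be : (u <> v -> same_at v al be) ->
  same_at v (consM (pairM u x) al) (consM (pairM u x) be).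
Proof.
  intros K y. destruct (classic (u = v)) as [->|N].
  - now rewrite !look_here.
  - rewrite !look_there by auto. now apply K.
Qed.

Lemma same_at_skip u x v al : u <> v -> same_at v (consM (pairM u x) al) al.
Proof. intros N y. now apply look_there. Qed.

Lemma same_at_swap u x v y w al : u <> v ->
  same_at w (consM (pairM u x) (consM (pairM v y) al))
            (consM (pairM v y) (consM (pairM u x) al)).
Proof.
  intros N z. destruct (classic (u = w)) as [->|N1].
  - rewrite look_here, look_there, look_here by auto. tauto.
  - rewrite (look_there _ _ _ N1). destruct (classic (v = w)) as [->|N2].
    + rewrite !look_here. tauto.
    + rewrite !look_there by auto. tauto.
Qed.

Lemma tval_local al be t : isTermM t -> (forall v, FreeInM v t -> same_at v al be) ->
  forall x, TValM al t x <-> TValM be t x.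
Proof.
  revert t. apply (term_ind (Y:=fun t => (forall v, FreeInM v t -> same_at v al be) ->
     forall x, TValM al t x <-> TValM be t x)); [unfold same_at; solve_def|..].
  4, 5: intros s t _ IHs _ IHt K x;
    rewrite ?(tval_plus H), ?(tval_times H);
    (setoid_rewrite IHs; [setoid_rewrite IHt; [reflexivity|]|]);
    intros v Hv; apply K; rewrite ?(freeIn_plus H), ?(freeIn_times H); auto.
  - intros _ x. now rewrite !(tval_zero H).
  - intros i K x. rewrite !(tval_var H). apply K. now apply (freeIn_var H).
  - intros t _ IH K x. rewrite !(tval_succ H). setoid_rewrite IH; [reflexivity|].
    intros v Hv. apply K. now apply (freeIn_succ H).
Qed.

Lemma tval_sub al v r x : (forall y, TValM al r y <-> y = x) -> forall t, isTermM t ->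
  forall t', SubM t v r t' -> forall y,
  TValM al t' y <-> TValM (consM (pairM v x) al) t y.
Proof.
  intros Hr. apply (term_ind (Y:=fun t => forall t', SubM t v r t' -> forall y,
     TValM al t' y <-> TValM (consM (pairM v x) al) t y)); [solve_def|..].
  4, 5: intros s t _ IHs _ IHt t' K y; rewrite ?(sub_plus H), ?(sub_times H) in K;
    destruct K as (s1 & t1 & -> & K1 & K2); rewrite ?(tval_plus H), ?(tval_times H);
    setoid_rewrite (IHs _ K1); setoid_rewrite (IHt _ K2); reflexivity.
  - intros t' K y. apply (sub_zero H) in K as ->. now rewrite !(tval_zero H).
  - intros i t' K y. apply (sub_var H) in K as [[-> ->]|[N ->]]; rewrite !(tval_var H).
    + now rewrite Hr, look_here.
    + now rewrite look_there by auto.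
  - intros t _ IH t' K y. apply (sub_succ H) in K as (t1 & -> & K).
    rewrite !(tval_succ H). now setoid_rewrite (IH _ K).
Qed.

Lemma val_tval al t : isTermM t -> (forall v, ~ FreeInM v t) ->
  forall x, ValM t x <-> TValM al t x.
Proof.
  revert t. apply (term_ind (Y:=fun t => (forall v, ~ FreeInM v t) ->
     forall x, ValM t x <-> TValM al t x)); [solve_def|..].
  4, 5: intros s t _ IHs _ IHt K x;
    rewrite ?(val_plus H), ?(tval_plus H), ?(val_times H), ?(tval_times H);
    (setoid_rewrite IHs; [setoid_rewrite IHt; [reflexivity|]|]);
    intros v Hv; apply (K v); rewrite ?(freeIn_plus H), ?(freeIn_times H); auto.
  - intros _ x. now rewrite (val_zero H), (tval_zero H).
  - intros i K. destruct (K i). now apply (freeIn_var H).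
  - intros t _ IH K x. rewrite (val_succ H), (tval_succ H).
    setoid_rewrite IH; [reflexivity|]. intros v Hv. apply (K v). now apply (freeIn_succ H).
Qed.

(** ** Numerals *)

Lemma numeral_unique x : exists n, forall m, NumeralM x m <-> m = n.
Proof.
  revert x. apply (ind H); [solve_def| |].
  - exists cZeroM. apply (numeral_0 H).
  - intros x [n Hn]. exists (cSuccM n). intros m. rewrite (numeral_S H). split.
    + intros (k & -> & K). apply Hn in K. congruence.
    + intros ->. exists n. split; auto. now apply Hn.
Qed.

Definition nm (x : M) : M :=
  proj1_sig (constructive_indefinite_description _ (numeral_unique x)).

Lemma nm_spec x n : NumeralM x n <-> n = nm x.
Proof.
  unfold nm. apply (proj2_sig (constructive_indefinite_description _ (numeral_unique x))).
Qed.

Lemma numeral_props x : forall n, NumeralM x n ->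
  isTermM n /\ (forall v, ~ FreeInM v n) /\ ValM n x.
Proof.
  revert x.
  apply (ind H (Y:=fun x => forall n, NumeralM x n ->
    isTermM n /\ (forall v, ~ FreeInM v n) /\ ValM n x)); [solve_def| |].
  - intros n K. apply (numeral_0 H) in K as ->. split; [apply (isTerm_zero H)|].
    split; [apply (freeIn_zero H)|]. now apply (val_zero H).
  - intros x IH n K. apply (numeral_S H) in K as (m & -> & K).
    apply IH in K as (K1 & K2 & K3). split; [now apply (isTerm_succ H)|].
    split; [intros v; now rewrite (freeIn_succ H)|]. apply (val_succ H). eauto.
Qed.

Lemma nm_term x : isTermM (nm x).
Proof. now apply (numeral_props (x:=x)), nm_spec. Qed.

Lemma nm_closed x v : ~ FreeInM v (nm x).
Proof. now apply (numeral_props (x:=x)), nm_spec. Qed.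

Lemma nm_closedTerm x : isClosedTermM (nm x).
Proof. split; [apply nm_term|apply nm_closed]. Qed.

Lemma val_unique t : isClosedTermM t -> exists x, forall y, ValM t y <-> y = x.
Proof.
  intros [Ht Hc]. destruct (tval_unique o0 Ht) as [x Hx]. exists x. intros y.
  rewrite <- Hx. now apply val_tval.
Qed.

Lemma val_nm x y : ValM (nm x) y <-> y = x.
Proof.
  destruct (val_unique (nm_closedTerm x)) as [z Hz].
  assert (K : ValM (nm x) x) by now apply (numeral_props (x:=x)), nm_spec.
  rewrite Hz in K |- *. subst. tauto.
Qed.

Lemma tval_nm al x y : TValM al (nm x) y <-> y = x.
Proof.
  rewrite <- val_nm. symmetry. apply val_tval; [apply nm_term|apply nm_closed].
Qed.

Lemma mem_lt x l : MemM x l -> x ≺ l.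
Proof.
  revert l. apply (strong_ind H (Y:=fun l => MemM x l -> x ≺ l)); [solve_def|].
  intros l IH K. rewrite (MemM_eq H) in K. destruct K as (y & r & -> & [->|K]).
  - apply lt_cons1.
  - apply IH in K; [|apply lt_cons2]. eapply (le_trans H); [exact K|].
    apply (lt_le H), lt_cons2.
Qed.

Lemma isFormList_mem x l : isFormListM l -> MemM x l -> isFormM x.
Proof.
  revert l. apply (strong_ind H (Y:=fun l => isFormListM l -> MemM x l -> isFormM x)).
  { unfold isFormListM, isFormListJ. solve_def. }
  intros l IH L K. rewrite (MemM_eq H) in K. destruct K as (y & r & -> & K).
  apply (isFormList_cons H) in L as [L1 L2]. destruct K as [->|K]; auto.
  apply (IH r); auto. apply lt_cons2.
Qed.

End Syntax.

(** * Codes of standard formulae *)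

Section CodeTheory.
Context {M : str} {X : M -> Prop} (H : inductive_class X).
Implicit Types x y z w a b c d m s i j k l n q r : M.

Lemma sub_form_t v r t : isTermM r -> isTermM t -> forall b, SubM t v r b -> isTermM b.
Proof.
  intros Hr. revert t.
  apply (term_ind H (Y:=fun t => forall b, SubM t v r b -> isTermM b)); [solve_def|..].
  4, 5: intros s t _ IHs _ IHt b K; rewrite ?(sub_plus H), ?(sub_times H) in K;
    destruct K as (s1 & t1 & -> & K1 & K2);
    rewrite ?(isTerm_plus H), ?(isTerm_times H); auto.
  - intros b K. apply (sub_zero H) in K as ->. apply (isTerm_zero H).
  - intros i b K. apply (sub_var H) in K as [[_ ->]|[_ ->]]; auto. apply (isTerm_var H).
  - intros t _ IH b K. apply (sub_succ H) in K as (t1 & -> & K).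
    apply (isTerm_succ H). auto.
Qed.

Lemma sub_form v r a : isTermM r -> isFormM a -> forall b, SubM a v r b -> isFormM b.
Proof.
  intros Hr. revert a.
  apply (form_ind H (Y:=fun t => forall b, SubM t v r b -> isFormM b)); [solve_def|..].
  3, 4: intros s t _ IHs _ IHt b K; rewrite ?(sub_and H), ?(sub_or H) in K;
    destruct K as (s1 & t1 & -> & K1 & K2); rewrite ?(isForm_and H), ?(isForm_or H); auto.
  3, 4: intros u t Ht IH b K; rewrite ?(sub_ex H), ?(sub_all H) in K;
    destruct K as [[_ ->]|(_ & t1 & -> & K)];
    rewrite ?(isForm_ex H), ?(isForm_all H); auto.
  - intros s t Hs Ht b K. apply (sub_eq H) in K as (s1 & t1 & -> & K1 & K2).
    apply (isForm_eq H).
    split; [exact (sub_form_t Hr Hs K1)|exact (sub_form_t Hr Ht K2)].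
  - intros t _ IH b K. apply (sub_neg H) in K as (t1 & -> & K).
    apply (isForm_neg H). auto.
Qed.

Lemma sub_free_t v r w t : isTermM t -> forall b, SubM t v r b -> FreeInM w b ->
  (FreeInM w t /\ w <> v) \/ FreeInM w r.
Proof.
  revert t. apply (term_ind H (Y:=fun t => forall b, SubM t v r b -> FreeInM w b ->
    (FreeInM w t /\ w <> v) \/ FreeInM w r)); [solve_def|..].
  4, 5: intros s t _ IHs _ IHt b K F; rewrite ?(sub_plus H), ?(sub_times H) in K;
    destruct K as (s1 & t1 & -> & K1 & K2);
    rewrite ?(freeIn_plus H), ?(freeIn_times H) in F |- *;
    destruct F as [F|F]; [apply (IHs _ K1) in F|apply (IHt _ K2) in F]; tauto.
  - intros b K F. apply (sub_zero H) in K as ->. now apply (freeIn_zero H) in F.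
  - intros i b K F. apply (sub_var H) in K as [[_ ->]|[N ->]]; auto. left. split; auto.
    apply (freeIn_var H) in F. congruence.
  - intros t _ IH b K F. apply (sub_succ H) in K as (t1 & -> & K).
    rewrite (freeIn_succ H) in F |- *. eauto.
Qed.

Lemma sub_free v r w a : isFormM a -> forall b, SubM a v r b -> FreeInM w b ->
  (FreeInM w a /\ w <> v) \/ FreeInM w r.
Proof.
  revert a. apply (form_ind H (Y:=fun t => forall b, SubM t v r b -> FreeInM w b ->
    (FreeInM w t /\ w <> v) \/ FreeInM w r)); [solve_def|..].
  3, 4: intros s t _ IHs _ IHt b K F; rewrite ?(sub_and H), ?(sub_or H) in K;
    destruct K as (s1 & t1 & -> & K1 & K2);
    rewrite ?(freeIn_and H), ?(freeIn_or H) in F |- *;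
    destruct F as [F|F]; [apply (IHs _ K1) in F|apply (IHt _ K2) in F]; tauto.
  3, 4: intros u t _ IH b K F; rewrite ?(sub_ex H), ?(sub_all H) in K;
    destruct K as [[-> ->]|(N & t1 & -> & K)];
    rewrite ?(freeIn_ex H), ?(freeIn_all H) in F |- *; destruct F as [F1 F2];
    [left; auto|destruct (IH _ K F2); tauto].
  - intros s t Hs Ht b K F. apply (sub_eq H) in K as (s1 & t1 & -> & K1 & K2).
    rewrite (freeIn_eq H) in F |- *.
    destruct F as [F|F]; [apply (sub_free_t Hs K1) in F|apply (sub_free_t Ht K2) in F];
      tauto.
  - intros t _ IH b K F. apply (sub_neg H) in K as (t1 & -> & K).
    rewrite (freeIn_neg H) in F |- *. eauto.
Qed.

Lemma sub_sentence v r a b :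
  isForm1M v a -> isClosedTermM r -> SubM a v r b -> isSentM b.
Proof.
  intros [Ha Fa] [Hr Fr] K. split. { exact (sub_form Hr Ha K). }
  intros w Hw. destruct (sub_free Ha K Hw) as [[Hw' N]|Hw']; auto.
  now apply Fr in Hw'.
Qed.

Lemma ex_app (Z : Type) (l l' : list Z) (Q : Z -> Prop) :
  (exists v, In v l /\ Q v) \/ (exists v, In v l' /\ Q v) <->
  exists v, In v (l ++ l') /\ Q v.
Proof.
  split.
  - intros [(v & Hv & K)|(v & Hv & K)]; exists v; rewrite in_app_iff; tauto.
  - intros (v & Hv & K). apply in_app_or in Hv as [Hv|Hv]; [left|right]; eauto.
Qed.

Section Code.
Variables (P : Type) (sg : nat -> nat) (pl : P -> M -> M).

Definition coded_term (n : M) : Prop :=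
  isTermM n /\ forall w, FreeInM w n -> exists v, w = numM (sg v).

(** What the translation of the atoms has to fulfil for the code of a formula
    to be a formula with the expected free variables and instances. *)
Record plug_ok : Prop := {
  plug_form : forall (p : P) n, coded_term n -> isFormM (pl p n);
  plug_free : forall (p : P) n w, coded_term n -> FreeInM w (pl p n) <-> FreeInM w n;
  plug_sub : forall (p : P) n (v : nat) r (n' : M), coded_term n -> SubM n (numM (sg v)) r n' ->
    SubM (pl p n) (numM (sg v)) r (pl p n') }.

Definition closing (e : nat -> option M) : Prop :=
  forall v c, e v = Some c -> isClosedTermM c.

Lemma none_closing : closing (fun _ => None).
Proof. now intros v c K. Qed.

Lemma closing_upd e v : closing e -> closing (upd e v None).
Proof.
  intros K u c. unfold upd. destruct (u =? v); [discriminate|]. apply K.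
Qed.

Lemma codeT_ext e e' t : (forall v, In v (fvt t) -> e v = e' v) ->
  codeT (M:=M) sg e t = codeT sg e' t.
Proof.
  induction t; simpl; intros K; try (f_equal; auto using in_or_app; fail).
  now rewrite K by auto.
Qed.

Lemma codeF_ext A : forall e e', (forall v, In v (fv A) -> e v = e' v) ->
  codeF sg pl e A = codeF sg pl e' A.
Proof.
  induction A; simpl; intros e e' K; f_equal; auto using in_or_app, codeT_ext.
  - apply IHA. intros u Hu. unfold upd. destruct (Nat.eqb_spec u v); auto.
    apply K. now apply in_in_remove.
  - apply IHA. intros u Hu. unfold upd. destruct (Nat.eqb_spec u v); auto.
    apply K. now apply in_in_remove.
Qed.

Lemma codeT_term e t : closing e -> isTermM (codeT sg e t).
Proof.
  intros He. induction t; simpl.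
  - destruct (e v) eqn:E; [now apply He in E as []|apply (isTerm_var H)].
  - apply (isTerm_zero H).
  - now apply (isTerm_succ H).
  - now apply (isTerm_plus H).
  - now apply (isTerm_times H).
Qed.

Lemma codeT_free e t w : closing e -> FreeInM w (codeT sg e t) <->
  exists v, In v (fvt t) /\ e v = None /\ w = numM (sg v).
Proof.
  intros He. induction t; simpl.
  - destruct (e v) eqn:E.
    + split.
      * intros K. apply He in E as [_ E]. now apply E in K.
      * intros (u & [<-|[]] & K & _). congruence.
    + rewrite (freeIn_var H). split.
      * intros ->. exists v. auto.
      * now intros (u & [<-|[]] & _ & ->).
  - split; [intros K; now apply (freeIn_zero H) in K|now intros (u & [] & _)].
  - now rewrite (freeIn_succ H).
  - rewrite (freeIn_plus H), IHt1, IHt2.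
    apply ex_app.
  - rewrite (freeIn_times H), IHt1, IHt2. apply ex_app.
Qed.

Lemma codeT_coded e t : closing e -> coded_term (codeT sg e t).
Proof.
  intros He. split; [now apply codeT_term|]. intros w Hw.
  apply codeT_free in Hw as (v & _ & _ & K); eauto.
Qed.

Hypothesis sg_inj : forall u v, sg u = sg v -> u = v.

Lemma codeT_sub e t v r : closing e -> e v = None ->
  SubM (codeT sg e t) (numM (sg v)) r (codeT sg (upd e v (Some r)) t).
Proof.
  intros He Hv. induction t as [u| |t IH|s IHs t IHt|s IHs t IHt]; simpl.
  - unfold upd. destruct (Nat.eqb_spec u v) as [->|N].
    + rewrite Hv. apply (sub_var H). auto.
    + destruct (e u) eqn:E.
      * apply He in E as [E1 E2]. apply (sub_notfree_t H); auto.
      * apply (sub_var H). right. split; auto. intros K.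
        now apply (numM_inj H), sg_inj in K.
  - now apply (sub_zero H).
  - apply (sub_succ H). eauto.
  - apply (sub_plus H). eauto.
  - apply (sub_times H). eauto.
Qed.

Hypothesis Hpl : plug_ok.

Lemma codeF_form A : forall e, closing e -> isFormM (codeF sg pl e A).
Proof.
  induction A as [s t|p t|A IH|A IHA B IHB|A IHA B IHB|v A IH|v A IH];
    intros e He; simpl.
  - apply (isForm_eq H). split; now apply codeT_term.
  - now apply (plug_form Hpl), codeT_coded.
  - apply (isForm_neg H). auto.
  - apply (isForm_and H). auto.
  - apply (isForm_or H). auto.
  - apply (isForm_ex H). apply IH. now apply closing_upd.
  - apply (isForm_all H). apply IH. now apply closing_upd.
Qed.

Lemma codeF_free w A : forall e, closing e -> FreeInM w (codeF sg pl e A) <->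
  exists v, In v (fv A) /\ e v = None /\ w = numM (sg v).
Proof.
  assert (Q : forall (e : nat -> option M) v (B : form P),
    (numM (sg v) <> w /\ (exists u, In u (fv B) /\ upd e v None u = None /\ w = numM (sg u)))
    <-> exists u, In u (remove Nat.eq_dec v (fv B)) /\ e u = None /\ w = numM (sg u)).
  { intros e v B. split.
    - intros (N & u & Hu & K & ->). exists u.
      assert (u <> v) by congruence. rewrite upd_other in K by auto.
      split; auto. now apply in_in_remove.
    - intros (u & Hu & K & ->). apply in_remove in Hu as [Hu N]. split.
      + intros E. apply (numM_inj H), sg_inj in E. congruence.
      + exists u. now rewrite upd_other. }
  induction A as [s t|p t|A IH|A IHA B IHB|A IHA B IHB|v A IH|v A IH];
    intros e He; simpl.
  - rewrite (freeIn_eq H), !codeT_free by auto. apply ex_app.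
  - rewrite (plug_free Hpl) by now apply codeT_coded. now apply codeT_free.
  - rewrite (freeIn_neg H). auto.
  - rewrite (freeIn_and H), IHA, IHB by auto. apply ex_app.
  - rewrite (freeIn_or H), IHA, IHB by auto. apply ex_app.
  - rewrite (freeIn_ex H), IH by now apply closing_upd. apply Q.
  - rewrite (freeIn_all H), IH by now apply closing_upd. apply Q.
Qed.

Lemma codeF_sub A v r : forall e, closing e -> e v = None ->
  SubM (codeF sg pl e A) (numM (sg v)) r (codeF sg pl (upd e v (Some r)) A).
Proof.
  induction A as [s t|p t|A IH|A IHA B IHB|A IHA B IHB|u A IH|u A IH];
    intros e He Hv; simpl.
  6, 7: rewrite ?(sub_ex H), ?(sub_all H); destruct (Nat.eq_dec u v) as [->|N];
    [left; now rewrite upd_upd_same|right];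
    (split; [intros E; now apply (numM_inj H), sg_inj in E|]);
    rewrite upd_comm by auto; (eexists; split; [reflexivity|]); apply IH;
    [now apply closing_upd|now rewrite upd_other by auto].
  - apply (sub_eq H). eexists _, _. split; [reflexivity|]. split; now apply codeT_sub.
  - apply (plug_sub Hpl). { now apply codeT_coded. } now apply codeT_sub.
  - apply (sub_neg H). eauto.
  - apply (sub_and H). eexists _, _. split; [reflexivity|]. split; auto.
  - apply (sub_or H). eexists _, _. split; [reflexivity|]. split; auto.
Qed.

End Code.
End CodeTheory.

(** * Compositional truth of standard formulae *)

Record compositional (M : str) (T : M -> Prop) : Prop := {
  ct_eq : forall s t : M, isClosedTermM s /\ isClosedTermM t ->
    (T (cEqM s t) <-> exists x y, ValM s x /\ ValM t y /\ x = y);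
  ct_and : forall a b : M, isSentM a /\ isSentM b -> (T (cAndM a b) <-> T a /\ T b);
  ct_or : forall a b : M, isSentM a /\ isSentM b -> (T (cOrM a b) <-> T a \/ T b);
  ct_neg : forall a : M, isSentM a -> (T (cNegM a) <-> ~ T a);
  ct_all : forall v a : M, isForm1M v a ->
    (T (cAllM v a) <-> forall x, TrInstM T a v x);
  ct_ex : forall v a : M, isForm1M v a ->
    (T (cExM v a) <-> exists x, TrInstM T a v x) }.

Section Truth.
Context {M : str} {X : M -> Prop} (H : inductive_class X) (T : M -> Prop) (HT : compositional T).
Implicit Types x y z w a b c d m s i j k l n q r : M.

Lemma TrInst_sub a v x b :
  isFormM a -> SubM a v (nm H x) b -> (TrInstM T a v x <-> T b).
Proof.
  intros Ha Hb. unfold TrInstM. split.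
  - intros (n & c & Hn & Hc & K). apply (nm_spec H) in Hn as ->.
    now rewrite (sub_fun H Ha Hb Hc).
  - intros K. exists (nm H x), b. split; auto. now apply (nm_spec H).
Qed.

Section TruthOfCodes.
Variables (P : Type) (I : P -> M -> Prop) (sg : nat -> nat) (pl : P -> M -> M).
Hypothesis sg_inj : forall u v, sg u = sg v -> u = v.
Hypothesis Hpl : plug_ok sg pl.
Hypothesis T_pl : forall p n x, isClosedTermM n -> ValM n x -> (T (pl p n) <-> I p x).

Definition numerals (e : nat -> M) : nat -> option M := fun v => Some (nm H (e v)).

Lemma numerals_closing e : closing (numerals e).
Proof. intros v c E. injection E as <-. apply nm_closedTerm. Qed.

Lemma numerals_upd e v x : upd (upd (numerals e) v None) v (Some (nm H x)) =
  numerals (upd e v x).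
Proof.
  extensionality u. unfold upd, numerals. now destruct (u =? v).
Qed.

Lemma codeT_val e (t : term) x : ValM (codeT sg (numerals e) t) x <-> x = eval e t.
Proof.
  revert x. induction t as [v| |t IH|s IHs t IHt|s IHs t IHt]; simpl; intros x.
  - apply val_nm.
  - apply (val_zero H).
  - rewrite (val_succ H). setoid_rewrite IH. eq_ex.
  - rewrite (val_plus H). setoid_rewrite IHs. setoid_rewrite IHt. eq_ex.
  - rewrite (val_times H). setoid_rewrite IHs. setoid_rewrite IHt. eq_ex.
Qed.

Lemma codeT_closed e (t : term) : isClosedTermM (codeT sg (numerals e) t).
Proof.
  split; [apply (codeT_term H), numerals_closing|]. intros w Hw.
  rewrite (codeT_free H) in Hw by apply numerals_closing.
  destruct Hw as (v & _ & K & _). discriminate.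
Qed.

Lemma codeF_sent e (A : form P) : isSentM (codeF sg pl (numerals e) A).
Proof.
  split; [apply (codeF_form H Hpl), numerals_closing|]. intros w Hw.
  rewrite (codeF_free H sg_inj Hpl) in Hw by apply numerals_closing.
  destruct Hw as (v & _ & K & _). discriminate.
Qed.

Lemma codeF_form1 e v (A : form P) :
  isForm1M (numM (sg v)) (codeF sg pl (upd (numerals e) v None) A).
Proof.
  assert (C : closing (upd (numerals e) v None)) by apply closing_upd, numerals_closing.
  split; [now apply (codeF_form H Hpl)|]. intros w Hw.
  rewrite (codeF_free H sg_inj Hpl) in Hw by exact C. destruct Hw as (u & _ & K & ->).
  destruct (Nat.eq_dec u v) as [->|N]; auto. now rewrite upd_other in K by auto.
Qed.

Lemma codeF_instance e v x (A : form P) :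
  SubM (codeF sg pl (upd (numerals e) v None) A) (numM (sg v)) (nm H x)
       (codeF sg pl (numerals (upd e v x)) A).
Proof.
  rewrite <- numerals_upd. apply (codeF_sub H sg_inj Hpl).
  - apply closing_upd, numerals_closing.
  - apply upd_same.
Qed.

(** The induction is on the standard formula, outside the structure; the atoms
    may be translated by nonstandard formulae. *)
Lemma truth_of_code (A : form P) : forall e, T (codeF sg pl (numerals e) A) <-> sat I e A.
Proof.
  induction A as [s t|p t|A IH|A IHA B IHB|A IHA B IHB|v A IH|v A IH]; intros e; simpl.
  6, 7: rewrite ?(ct_ex HT), ?(ct_all HT) by apply codeF_form1;
    assert (K : forall x, TrInstM T (codeF sg pl (upd (numerals e) v None) A)
                            (numM (sg v)) x <-> sat I (upd e v x) A) by
      (intros x; rewrite <- IH; apply TrInst_sub; [apply codeF_form1|apply codeF_instance]);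
    now setoid_rewrite K.
  - rewrite (ct_eq HT) by (split; apply codeT_closed).
    setoid_rewrite codeT_val. split.
    + intros (x & y & -> & -> & E). exact E.
    + eauto.
  - apply T_pl; [apply codeT_closed|]. now apply codeT_val.
  - rewrite (ct_neg HT) by apply codeF_sent. now rewrite IH.
  - rewrite (ct_and HT) by (split; apply codeF_sent). now rewrite IHA, IHB.
  - rewrite (ct_or HT) by (split; apply codeF_sent). now rewrite IHA, IHB.
Qed.

End TruthOfCodes.

(** ** Classes defined by nonstandard formulae *)

(* The instance of the formula [a] with variable [w] at the term [n], written
   with a quantifier to spare a substitution. *)
Definition plugM (w a n : M) : M := cExM w (cAndM (cEqM (cVarM w) n) a).

Definition ClassM (a x : M) : Prop := T (plugM (numM 0) a (nm H x)).

Lemma T_plugM w a n x b : isForm1M w a -> isClosedTermM n -> ValM n x -> SubM a w (nm H x) b ->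
  T (plugM w a n) <-> T b.
Proof.
  intros Ha Hn Hx Hb. destruct Ha as [Fa Va]. unfold plugM.
  assert (F1 : isForm1M w (cAndM (cEqM (cVarM w) n) a)).
  { split.
    - apply (isForm_and H). split; auto. apply (isForm_eq H).
      split; [apply (isTerm_var H)|apply Hn].
    - intros u. rewrite (freeIn_and H), (freeIn_eq H), (freeIn_var H).
      intros [[K|K]|K]; auto. now apply Hn in K. }
  rewrite (ct_ex HT) by exact F1.
  assert (K : forall y c, SubM a w (nm H y) c ->
    TrInstM T (cAndM (cEqM (cVarM w) n) a) w y <-> y = x /\ T c).
  { intros y c Hc.
    rewrite (TrInst_sub (b:=cAndM (cEqM (nm H y) n) c)).
    - rewrite (ct_and HT). 2:{ split.
      { split. { apply (isForm_eq H). split; [apply nm_term|apply Hn]. }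
        intros v. rewrite (freeIn_eq H). intros [K|K].
        - now apply nm_closed in K.
        - now apply Hn in K. }
      { eapply (sub_sentence H); [exact (conj Fa Va)| |exact Hc]. apply nm_closedTerm. } }
      rewrite (ct_eq HT) by (split; auto; apply nm_closedTerm).
      destruct (val_unique H Hn) as [x' Hx']. apply Hx' in Hx as E. subst x'.
      setoid_rewrite val_nm. setoid_rewrite Hx'. split.
      + intros [(y1 & x1 & -> & -> & E) L]. auto.
      + intros [-> L]. eauto 6.
    - apply F1.
    - apply (sub_and H). eexists _, _. split; [reflexivity|]. split; auto.
      apply (sub_eq H). eexists _, _. split; [reflexivity|]. split.
      + apply (sub_var H). auto.
      + apply (sub_notfree_t H); apply Hn. }
  split.
  - intros [y L]. destruct (sub_total H w (nm H y) Fa) as [c Hc].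
    destruct (proj1 (K y c Hc) L) as [E L']. subst y. now rewrite (sub_fun H Fa Hb Hc).
  - intros L. exists x. now apply (K x b Hb).
Qed.

Section Class.
Variable a : M.
Hypothesis Ha : isForm1M (numM 0) a.

(* The variables of standard formulae are shifted by one to keep variable 0 for
   [a]. *)
Lemma plugM_ok : plug_ok S (fun _ : unit => plugM (numM 0) a).
Proof.
  destruct Ha as [Fa Va].
  assert (N0 : forall v n, @coded_term _ S n -> FreeInM v n -> v <> numM 0).
  { intros v n [_ K] Hv E. apply K in Hv as [w Hw].
    rewrite E in Hw. apply (numM_inj H) in Hw. discriminate. }
  split.
  - intros p n [Hn _]. apply (isForm_ex H), (isForm_and H). split; auto.
    apply (isForm_eq H). split; auto. apply (isTerm_var H).
  - intros p n w Hn. unfold plugM.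
    rewrite (freeIn_ex H), (freeIn_and H), (freeIn_eq H), (freeIn_var H). split.
    + intros [N [[E|K]|K]]; auto; [congruence|]. apply Va in K. congruence.
    + intros K. split; auto. intros E. symmetry in E. revert E. eapply N0; eauto.
  - intros p n v r n' Hn K. apply (sub_ex H). right.
    assert (N : numM 0 <> numM (M:=M) (S v)) by (intros E; now apply (numM_inj H) in E).
    split; auto. eexists. split; [reflexivity|]. apply (sub_and H).
    eexists _, _. split; [reflexivity|]. split.
    + apply (sub_eq H). eexists _, _. split; [reflexivity|]. split; auto.
      apply (sub_var H). auto.
    + apply (sub_notfree H); auto. intros L. apply Va in L. congruence.
Qed.

Lemma T_class n x : isClosedTermM n -> ValM n x -> (T (plugM (numM 0) a n) <-> ClassM a x).
Proof.
  intros Hn Hx. unfold ClassM.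
  destruct (sub_total H (numM 0) (nm H x) (proj1 Ha)) as [b Hb].
  rewrite (T_plugM Ha Hn Hx Hb), (T_plugM Ha (nm_closedTerm H x) (x:=x) (b:=b)); auto.
  - tauto.
  - now apply val_nm.
Qed.

End Class.

(** ** Induction *)

Hypothesis HD : forall (A : LPAT) (e : nat -> M) v, Delta0 A ->
  sat (fun _ => T) (upd e v o0) A ->
  (forall x, sat (fun _ => T) (upd e v x) A -> sat (fun _ => T) (upd e v (oS x)) A) ->
  forall x, sat (fun _ => T) (upd e v x) A.

(** Here [R] is the graph of an arithmetical function. Below any bound its
    graph is a coded set, and membership in such a set, for given moduli, is
    expressed by a bounded formula. *)
Lemma truth_ind (R : M -> M -> Prop) : Def X (fun e => R (e 0) (e 1)) ->
  (forall x, exists b, forall c, R x c <-> c = b) ->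
  let Y x := exists b, R x b /\ T b in
  Y o0 -> (forall x, Y x -> Y (oS x)) -> forall x, Y x.
Proof.
  intros HR UR Y Y0 YS k.
  assert (B : forall k, exists p, forall x, x ≼ k -> forall b, R x b -> b ≼ p).
  { clear k. apply (ind H); [solve_def| |].
    - destruct (UR o0) as [p Hp]. exists p. intros x Hx b Hb.
      apply (le_antisym H) in Hx; [|apply (le0x H)]. subst. apply Hp in Hb as ->.
      apply (le_refl H).
    - intros k [p Hp]. destruct (UR (oS k)) as [p' Hp']. exists (p ⊕ p').
      intros x Hx b Hb. destruct (le_eq_lt H Hx) as [->|L].
      + apply Hp' in Hb as ->. apply le_addl.
      + apply (lt_S H) in L. eapply (le_trans H); [apply (Hp x L b Hb)|].
        apply (le_addr H). }
  destruct (B k) as [p Hp].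
  destruct (comprehension_dvd H (Y:=fun z => exists x b, z = pairM x b /\ R x b)
    (pairM k p)) as (a & c & Hac); [solve_def|].
  (* Variables 1, 2, 3 and 4 stand for [k], [p], [a] and [c]: if 0 is at most
     [k], then some true sentence 5 is coded as its value. *)
  pose (A := FOr
    (FNeg (FEx 5 (FAnd (FLe 6 5 (Var 1)) (FEq (Plus (Var 5) (Var 0)) (Var 1)))))
    (FEx 5 (FAnd (FLe 6 5 (Var 2)) (FAnd (FPred tt (Var 5))
      (FEx 7 (FAnd (FLe 8 7 (Var 3))
        (FEq (Times (Var 7)
                    (Succ (Times (Succ (tpair (Var 0) (Var 5))) (Var 4))))
             (Var 3)))))))).
  pose (e := fun v => match v with 1 => k | 2 => p | 3 => a | _ => c end).
  assert (K : forall x, sat (fun _ => T) (upd e 0 x) A <-> (x ≼ k -> Y x)).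
  { intros x. transitivity ((~ exists z, z ≼ k /\ z ⊕ x = k) \/
      exists b, b ≼ p /\ T b /\ exists q, q ≼ a /\ q ⊗ oS (oS (pairM x b) ⊗ c) = a).
    { reflexivity. }
    split.
    - intros K Hx. destruct K as [K|(b & Hb & Tb & q & _ & E)].
      + destruct Hx as [z E]. destruct K. exists z. split; auto.
        rewrite <- E. apply (le_addr H).
      + exists b. split; auto.
        assert (L : pairM x b ≼ pairM k p) by now apply (pair_le H).
        apply Hac in L. destruct L as [L _].
        destruct L as (x' & b' & E' & L); [now exists q|].
        apply (pair_inj H) in E' as [-> ->]. exact L.
    - intros K. destruct (classic (x ≼ k)) as [Hx|Hx].
      2:{ left. intros (z & _ & E). apply Hx. now exists z. }
      right. destruct (K Hx) as (b & Hb & Tb). exists b.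
      assert (Lb : b ≼ p) by eauto. split; auto. split; auto.
      assert (L : pairM x b ≼ pairM k p) by now apply (pair_le H).
      apply Hac in L. destruct L as [_ L]. destruct L as [q E]; [eauto|].
      exists q. split; auto. rewrite <- E.
      exists (q ⊗ (oS (pairM x b) ⊗ c)). rewrite (pa_MS H). reflexivity. }
  apply K; [|apply (le_refl H)]. apply HD.
  - unfold A, FLe. repeat (constructor; simpl; try (intuition discriminate)).
  - apply K. auto.
  - intros x L. apply K. intros Hx. apply YS. apply K in L; auto.
    eapply (le_trans H); [apply (le_S H)|exact Hx].
Qed.

(** For each [x], an instance of a standard formula about the class is the truth
    of one sentence, and this sentence is an arithmetical function of [x]. *)
Lemma class_ind a : isForm1M (numM 0) a -> inductive_class (ClassM a).
Proof.
  intros Ha. destruct H; split; auto. intros A e v S0 SS x.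
  set (phi := codeF S (fun _ : unit => plugM (numM 0) a) (upd (numerals e) v None) A).
  pose (R x b := exists n, NumeralM x n /\ SubM phi (numM (S v)) n b).
  assert (Sinj : forall u w : nat, S u = S w -> u = w) by congruence.
  pose proof (plugM_ok Ha) as Hok.
  assert (UR : forall x c, R x c <->
    c = codeF S (fun _ : unit => plugM (numM 0) a) (numerals (upd e v x)) A).
  { intros y c. pose proof (codeF_instance Sinj Hok e v y A) as L. split.
    - intros (n & Hn & K). apply (nm_spec H) in Hn as ->.
      eapply (sub_fun H); [|exact K|exact L]. apply (codeF_form1 Sinj Hok).
    - intros ->. exists (nm H y). split; auto. now apply (nm_spec H). }
  assert (K : forall x, sat (fun _ => ClassM a) (upd e v x) A <-> exists b, R x b /\ T b).
  { intros y. rewrite <- (truth_of_code (I:=fun _ => ClassM a) Sinj Hok).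
    - setoid_rewrite UR. split; [eauto|]. now intros (b & -> & L).
    - intros _ n z Hn Hz. now apply T_class. }
  apply K. apply truth_ind.
  - unfold R. solve_def.
  - intros y. eauto.
  - now apply K.
  - intros y Hy. apply K, SS, K, Hy.
Qed.

End Truth.

(** * A tower of satisfaction predicates *)

(* One step of Tarski's definition of satisfaction, where [R] is satisfaction
   of the immediate subformulae. *)
Definition clauseM (M : str) (R : M -> M -> Prop) (f al : M) : Prop :=
    (exists s t x, f = cEqM s t /\ TValM al s x /\ TValM al t x)
  \/ (exists a, f = cNegM a /\ ~ R a al)
  \/ (exists a b, f = cAndM a b /\ R a al /\ R b al)
  \/ (exists a b, f = cOrM a b /\ (R a al \/ R b al))
  \/ (exists v a, f = cExM v a /\ exists x, R a (consM (pairM v x) al))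
  \/ (exists v a, f = cAllM v a /\ forall x, R a (consM (pairM v x) al)).

(** The new predicate is put at index 0 and the old ones are shifted, so that one
    class contains all predicates built so far. *)
Definition stepM (M : str) (R : M -> Prop) (z : M) : Prop :=
    (exists i y, z = pairM (oS i) y /\ R (pairM i y))
  \/ (exists f al, z = pairM o0 (pairM f al) /\
        clauseM (fun a be => R (pairM o0 (pairM a be))) f al).

Section StepFormula.
Local Open Scope arith_scope.

Definition step (R : term -> bform unit) (z : term) : bform unit :=
    (∃ i y, z ≐ ⟨Succ i, y⟩ ∧ R ⟨i, y⟩)
  ∨ (∃ f al, z ≐ ⟨Zero, ⟨f, al⟩⟩ ∧
    (  (∃ s t x, f ≐ cEq s t ∧ TVal al s x ∧ TVal al t x)
     ∨ (∃ a, f ≐ cNeg a ∧ ¬ R ⟨Zero, ⟨a, al⟩⟩)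
     ∨ (∃ a b, f ≐ cAnd a b ∧ R ⟨Zero, ⟨a, al⟩⟩ ∧ R ⟨Zero, ⟨b, al⟩⟩)
     ∨ (∃ a b, f ≐ cOr a b ∧ (R ⟨Zero, ⟨a, al⟩⟩ ∨ R ⟨Zero, ⟨b, al⟩⟩))
     ∨ (∃ v a, f ≐ cEx v a ∧ ∃ x, R ⟨Zero, ⟨a, lcons ⟨v, x⟩ al⟩⟩)
     ∨ (∃ v a, f ≐ cAll v a ∧ ∀ x, R ⟨Zero, ⟨a, lcons ⟨v, x⟩ al⟩⟩))).

End StepFormula.

Lemma rrel_Tr (M : str) (I : unit -> M -> Prop) e n : RRel I e n Tr (I tt).
Proof. intros e' n' t a _ [_ <-]. unfold BSem, Tr. simpl. tauto. Qed.

Lemma trel_0 (M : str) (e : nat -> M) n x : e 0 = x -> TRel e (S n) (Var 0) x.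
Proof. intros <-. split; auto. simpl. intros v [<-|[]]. lia. Qed.

(** The formula is the same for all structures. Only its existence is kept, to
    prevent its code from being computed. *)
Lemma step_formula : exists B : LPAT, (forall v, In v (fv B) -> v = 0) /\
  forall (M : str) (Y : M -> Prop) e, sat (fun _ => Y) e B <-> stepM Y (e 0).
Proof.
  destruct (restrict_fv (step Tr (Var 0) 1)) as (B & HB & SB). exists B. split; auto.
  intros M Y e. rewrite SB.
  set (e0 := fun v => if v =? 0 then e 0 else o0).
  assert (Hx : TRel e0 1 (Var 0) (e 0)) by now apply trel_0.
  assert (HT : RRel (fun _ : unit => Y) e0 1 Tr Y) by exact (@rrel_Tr M (fun _ => Y) e0 1).
  change (BSem (fun _ => Y) e0 1 (step Tr (Var 0)) (stepM Y (e 0))).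
  unfold step, stepM, clauseM. bsem.
Qed.

(** ** The formulae of the tower, inside the theory *)

Section Next.
Variable B : LPAT.

Fixpoint tcodeT (t : term) : term :=
  match t with
  | Var v => cVar (num (S v))
  | Zero => cZero
  | Succ t => cSucc (tcodeT t)
  | Plus s t => cPlus (tcodeT s) (tcodeT t)
  | Times s t => cTimes (tcodeT s) (tcodeT t)
  end.

Definition tplug (w a n : term) : term := cEx w (cAnd (cEq (cVar w) n) a).

(* All code constructors are polynomials, so the next formula of the tower is a
   polynomial in the present one. *)
Fixpoint tcodeF (a : term) (A : LPAT) : term :=
  match A with
  | FEq s t => cEq (tcodeT s) (tcodeT t)
  | FPred _ t => tplug (num 0) a (tcodeT t)
  | FNeg A => cNeg (tcodeF a A)
  | FAnd A B => cAnd (tcodeF a A) (tcodeF a B)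
  | FOr A B => cOr (tcodeF a A) (tcodeF a B)
  | FEx v A => cEx (num (S v)) (tcodeF a A)
  | FAll v A => cAll (num (S v)) (tcodeF a A)
  end.

Definition tnext (a : term) : term := tplug (num 1) (tcodeF a B) (cVar (num 0)).

Definition codeS (M : str) (a : M) (A : LPAT) : M :=
  codeF S (fun _ : unit => plugM (numM 0) a) (fun _ => None) A.

Definition nextM (M : str) (a : M) : M :=
  plugM (numM 1) (codeS a B) (cVarM (numM 0)).

Section Terms.
Context {M : str}.

Lemma trel_tplug (e : nat -> M) n w a t w' a' t' :
  TRel e n w w' -> TRel e n a a' -> TRel e n t t' ->
  TRel e n (tplug w a t) (plugM w' a' t').
Proof. intros. unfold tplug, plugM. solve_trel. Qed.

Lemma trel_tcodeT (e : nat -> M) n t : TRel e n (tcodeT t) (codeT S (fun _ => None) t).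
Proof. induction t; simpl; solve_trel. Qed.

Lemma trel_tnext (e : nat -> M) n a a' : TRel e n a a' -> TRel e n (tnext a) (nextM a').
Proof.
  intros Ha. unfold tnext, nextM, codeS.
  apply trel_tplug; try solve [solve_trel].
  induction B as [s t|p t|A IH|A1 IH1 A2 IH2|A1 IH1 A2 IH2|v A IH|v A IH];
    simpl; rewrite ?upd_None.
  - pose proof (trel_tcodeT e n s). pose proof (trel_tcodeT e n t). solve_trel.
  - apply trel_tplug; try solve [solve_trel]. apply trel_tcodeT.
  - solve_trel.
  - solve_trel.
  - solve_trel.
  - solve_trel.
  - solve_trel.
Qed.

Lemma nextM_def f : DefT (M:=M) f -> DefT (fun e => nextM (f e)).
Proof.
  intros Hf. unfold nextM, plugM.
  assert (K : DefT (fun e => codeS (f e) B)); [|solve_defT].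
  unfold codeS.
  assert (L : forall t, DefT (fun _ : nat -> M => codeT S (fun _ => None) t))
    by (intros; apply defT_const).
  induction B as [s t|p t|A IH|A1 IH1 A2 IH2|A1 IH1 A2 IH2|v A IH|v A IH];
    simpl; rewrite ?upd_None; unfold plugM; solve_defT.
Qed.

Definition TowerJ (R : M -> Prop) (z : M) : Prop :=
    z = pairM o0 (cEqM (cVarM (numM 0)) (cVarM (numM 0)))
  \/ (exists c t, z = pairM (oS c) (nextM t) /\ R (pairM c t)).
Definition TowerM (c t : M) : Prop := RecM TowerJ (pairM c t).

Lemma TowerM_def (X : M -> Prop) f g : DefT f -> DefT g ->
  Def X (fun e => TowerM (f e) (g e)).
Proof.
  intros. unfold TowerM, TowerJ, RecM.
  assert (L := nextM_def). 
  repeat (solve_def; try (apply L)).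
Qed.

End Terms.

Local Open Scope arith_scope.

Definition Tower (c t : term) : bform unit := Rec (fun R z =>
    z ≐ ⟨Zero, cEq (cVar (num 0)) (cVar (num 0))⟩
  ∨ (∃ c t, z ≐ ⟨Succ c, tnext t⟩ ∧ R ⟨c, t⟩)) ⟨c, t⟩.

Lemma bsem_Tower (M : str) (I : unit -> M -> Prop) e n x0 x1 a0 a1 :
  TRel e n x0 a0 -> TRel e n x1 a1 ->
  BSem I e n (Tower x0 x1) (TowerM a0 a1).
Proof.
  intros. unfold Tower, TowerM, TowerJ. bsem. now apply trel_tnext.
Qed.

(** The level [S x] is the first that treats the formula [x] correctly. *)
Definition Truth (x : term) : bform unit :=
  ∃ t n, Tower (Succ x) t ∧ Numeral ⟨Zero, ⟨x, Zero⟩⟩ n ∧ Tr (tplug (num 0) t n).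

Definition TruthM (M : str) (T : M -> Prop) (x : M) : Prop :=
  exists t n, TowerM (oS x) t /\ NumeralM (pairM o0 (pairM x o0)) n
              /\ T (plugM (numM 0) t n).

Lemma truth_formula : exists A : LPAT, (forall v, In v (fv A) -> v = 0) /\
  forall (M : str) (I : unit -> M -> Prop) e, sat I e A <-> TruthM (I tt) (e 0).
Proof.
  destruct (restrict_fv (Truth (Var 0) 1)) as (A & HA & SA). exists A. split; auto.
  intros M I e. rewrite SA.
  set (e0 := fun v => if v =? 0 then e 0 else o0).
  assert (Hx : TRel e0 1 (Var 0) (e 0)) by now apply trel_0.
  assert (HT : RRel I e0 1 Tr (I tt)) by exact (@rrel_Tr M I e0 1).
  change (BSem I e0 1 (Truth (Var 0)) (TruthM (I tt) (e 0))).
  unfold Truth, TruthM. bsem.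
  - apply bsem_Tower; solve_trel.
  - apply trel_tplug; solve_trel.
Qed.

End Next.

Local Close Scope arith_scope.

(** ** The tower in a model of [CT0] *)

Record CT0_structure (M : str) (T : M -> Prop) : Prop := {
  ct0_pa : inductive_class (fun _ : M => False);
  ct0_ct : compositional T;
  ct0_ind : forall (A : LPAT) (e : nat -> M) v, Delta0 A ->
    sat (fun _ => T) (upd e v o0) A ->
    (forall x, sat (fun _ => T) (upd e v x) A -> sat (fun _ => T) (upd e v (oS x)) A) ->
    forall x, sat (fun _ => T) (upd e v x) A }.

Lemma clauseM_local (M : str) (X : M -> Prop) (H : inductive_class X) (R R' : M -> M -> Prop) f al :
  (forall a be, a ≺ f -> R a be <-> R' a be) -> clauseM R f al <-> clauseM R' f al.
Proof.
  assert (Q : forall R R' : M -> M -> Prop, (forall a be, a ≺ f -> R a be <-> R' a be) ->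
    clauseM R f al -> clauseM R' f al).
  { clear R R'. intros R R' E K. unfold clauseM in *.
    destruct K as [K|[(a & -> & K)|[(a & b & -> & K & K')|[(a & b & -> & K)
      |[(v & a & -> & x & K)|(v & a & -> & K)]]]]].
    - tauto.
    - right; left. exists a. split; auto. rewrite <- E; auto. apply (lt_tag H).
    - right; right; left. exists a, b. split; auto.
      rewrite <- !E; auto; [apply (lt_tag2 H)|apply (lt_tag1 H)].
    - do 3 right; left. exists a, b. split; auto.
      rewrite <- !E; auto; [apply (lt_tag2 H)|apply (lt_tag1 H)].
    - do 4 right; left. exists v, a. split; auto. exists x. apply E; auto.
      apply (lt_tag2 H).
    - do 5 right. exists v, a. split; auto. intros x. apply E; auto.
      apply (lt_tag2 H). }
  intros E. split; apply Q; auto. intros a be Ha. symmetry. auto.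
Qed.

Section Tower.
Context {M : str} {T : M -> Prop} (HT : CT0_structure T).
Variable B : LPAT.
Hypothesis fvB : forall v, In v (fv B) -> v = 0.
Hypothesis satB : forall (Y : M -> Prop) e, sat (fun _ => Y) e B <-> stepM Y (e 0).
Let H := ct0_pa HT.
Implicit Types x y z w a b c d f i j k t al be : M.

Add Ring model_ring : (model_semiring H).
Ltac mring :=
  repeat match goal with |- context [oS ?x] =>
    lazymatch x with o0 => fail | _ => rewrite (S_add1 H x) end end; ring.

Lemma codeS_form1 a : isForm1M (numM 0) a -> isForm1M (numM 1) (codeS a B).
Proof.
  intros Ha. pose proof (plugM_ok H Ha) as Hok.
  split; [apply (codeF_form H Hok), none_closing|].
  intros u Hu. unfold codeS in Hu.
  rewrite (codeF_free H eq_add_S Hok) in Hu by apply none_closing.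
  destruct Hu as (v & Hv & _ & ->). apply fvB in Hv. now subst.
Qed.

Lemma plug_form1 w v a n : isForm1M w a -> isTermM n ->
  (forall u, FreeInM u n -> u = v) -> isForm1M v (plugM w a n).
Proof.
  intros [Fa Va] Hn Vn. split.
  - apply (isForm_ex H), (isForm_and H). split; auto. apply (isForm_eq H).
    split; auto. apply (isTerm_var H).
  - intros u. unfold plugM.
    rewrite (freeIn_ex H), (freeIn_and H), (freeIn_eq H), (freeIn_var H).
    intros [N [[K|K]|K]]; auto; [congruence|]. apply Va in K. congruence.
Qed.

Lemma nextM_form1 a : isForm1M (numM 0) a -> isForm1M (numM 0) (nextM B a).
Proof.
  intros Ha. apply plug_form1.
  - now apply codeS_form1.
  - apply (isTerm_var H).
  - intros u. now rewrite (freeIn_var H).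
Qed.

Notation Class := (ClassM H T).

Lemma nextM_class a x : isForm1M (numM 0) a ->
  Class (nextM B a) x <-> stepM (Class a) x.
Proof.
  intros Ha. pose proof (plugM_ok H Ha) as Hok.
  assert (Sinj : forall u v : nat, S u = S v -> u = v) by congruence.
  pose (e := fun _ : nat => x).
  assert (E : codeS a B = codeF S (fun _ : unit => plugM (numM 0) a)
                            (upd (numerals H e) 0 None) B).
  { apply codeF_ext. intros v Hv. apply fvB in Hv as ->. now rewrite upd_same. }
  pose proof (codeF_instance H Sinj Hok e 0 x B) as K. rewrite <- E in K.
  unfold ClassM at 1. unfold nextM.
  rewrite (T_plugM (H:=H) (b:=plugM (numM 1) (codeS a B) (nm H x)) (x:=x)
    (ct0_ct HT) (nextM_form1 Ha)).
  - rewrite (T_plugM (ct0_ct HT) (codeS_form1 Ha) (nm_closedTerm H x)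
      (proj2 (val_nm H x x) eq_refl) K).
    rewrite (truth_of_code H (ct0_ct HT) (I:=fun _ => Class a) Sinj Hok).
    + rewrite satB. now rewrite upd_same.
    + intros _ n y Hn Hy. now apply (T_class H (ct0_ct HT)).
  - apply nm_closedTerm.
  - now apply val_nm.
  - apply (sub_ex H). right. split. { intros N. now apply (numM_inj H) in N. }
    eexists. split; [reflexivity|]. apply (sub_and H). eexists _, _. split; [reflexivity|].
    split.
    + apply (sub_eq H). eexists _, _. split; [reflexivity|]. split.
      * apply (sub_var H). right. split; auto. intros N. now apply (numM_inj H) in N.
      * apply (sub_var H). auto.
    + apply (sub_notfree H). { now apply codeS_form1. }
      intros L. apply codeS_form1 in L; auto. now apply (numM_inj H) in L.
Qed.

Lemma TowerM_eq c t : TowerM B c t <-> TowerJ B (RecM (TowerJ B)) (pairM c t).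
Proof. apply (rec_unfold H). intros. unfold TowerJ. solve_cont. Qed.

Lemma tower_unique c : exists t, forall t', TowerM B c t' <-> t' = t.
Proof.
  revert c. apply (ind H).
  { apply def_ex. apply def_all. apply def_iff; [|solve_def].
    apply TowerM_def; solve_defT. }
  - exists (cEqM (cVarM (numM 0)) (cVarM (numM 0))). intros t. rewrite TowerM_eq.
    unfold TowerJ at 1. split.
    + intros [E|(c & t' & E & _)]; code_inv H. reflexivity.
    + intros ->. now left.
  - intros c [t Ht]. exists (nextM B t). intros t'. rewrite TowerM_eq.
    unfold TowerJ at 1. split.
    + intros [E|(d & t1 & E & K)]; apply (pair_inj H) in E as [E1 E2].
      * now apply (pa_S0 H) in E1.
      * apply (pa_inj H) in E1. subst. f_equal. now apply Ht.
    + intros ->. right. exists c, t. split; auto. now apply Ht.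
Qed.

Definition tower (c : M) : M :=
  proj1_sig (constructive_indefinite_description _ (tower_unique c)).

Lemma tower_spec c t : TowerM B c t <-> t = tower c.
Proof.
  unfold tower. apply (proj2_sig (constructive_indefinite_description _ (tower_unique c))).
Qed.

Lemma tower_S c : tower (oS c) = nextM B (tower c).
Proof.
  symmetry. apply tower_spec. rewrite TowerM_eq. right. exists c, (tower c).
  split; auto. now apply tower_spec.
Qed.

Lemma nextM_form1_def : Def (fun _ => False) (fun e : nat -> M => isForm1M (numM 0) (e 0)).
Proof. unfold isForm1M. solve_def. Qed.

Lemma tower_form1 c : isForm1M (numM 0) (tower c).
Proof.
  assert (K : forall c t, TowerM B c t -> isForm1M (numM 0) t).
  { apply (ind H (Y:=fun c => forall t, TowerM B c t -> isForm1M (numM 0) t)).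
    - apply def_all. apply def_imp; [apply TowerM_def; solve_defT|].
      apply (def_subst1 nextM_form1_def). solve_defT.
    - intros t K. rewrite TowerM_eq in K. destruct K as [E|(d & t1 & E & _)].
      + apply (pair_inj H) in E as [_ ->]. split.
        * apply (isForm_eq H). split; apply (isTerm_var H).
        * intros u. rewrite (freeIn_eq H), (freeIn_var H). tauto.
      + apply (pair_inj H) in E as [E _]. symmetry in E. now apply (pa_S0 H) in E.
    - intros x IH t K. apply tower_spec in K as ->. rewrite tower_S.
      apply nextM_form1, IH. now apply tower_spec. }
  apply (K c). now apply tower_spec.
Qed.

Definition level (c x : M) : Prop := Class (tower c) x.

Lemma level_pa c : inductive_class (level c).
Proof. apply (class_ind H (ct0_ct HT) (ct0_ind HT)), tower_form1. Qed.

Lemma level_S c x : level (oS c) x <-> stepM (level c) x.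
Proof. unfold level. rewrite tower_S. apply nextM_class, tower_form1. Qed.

Lemma level_shift c i y : level (oS c) (pairM (oS i) y) <-> level c (pairM i y).
Proof.
  rewrite level_S. unfold stepM. split.
  - intros [(j & z & E & K)|(f & al & E & _)]; code_inv H. exact K.
  - intros K. left. eauto.
Qed.

Lemma level_0 c f al : level (oS c) (pairM o0 (pairM f al)) <->
  clauseM (fun a be => level c (pairM o0 (pairM a be))) f al.
Proof.
  rewrite level_S. unfold stepM. split.
  - intros [(j & z & E & _)|(g & be & E & K)].
    + apply (pair_inj H) in E as [E _]. symmetry in E. now apply (pa_S0 H) in E.
    + apply (pair_inj H) in E as [_ E]. apply (pair_inj H) in E as [-> ->]. exact K.
  - intros K. right. eauto.
Qed.

(** Since [y] is fixed, this is an induction about the truth of one sentence for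
    each [k]; its negation serves for the other direction. *)
Lemma level_add k j c y : level (c ⊕ k) (pairM (j ⊕ k) y) <-> level c (pairM j y).
Proof.
  assert (D : forall neg : M -> M, (forall g, DefT g -> DefT (fun e => neg (g e))) ->
    let R k b := exists t n, TowerM B (c ⊕ k) t /\ NumeralM (pairM (j ⊕ k) y) n
                             /\ b = neg (plugM (numM 0) t n) in
    (forall k, T (neg (plugM (numM 0) (tower (c ⊕ k)) (nm H (pairM (j ⊕ k) y)))) <->
               T (neg (plugM (numM 0) (tower (c ⊕ oS k)) (nm H (pairM (j ⊕ oS k) y))))) ->
    T (neg (plugM (numM 0) (tower c) (nm H (pairM j y)))) ->
    forall k, T (neg (plugM (numM 0) (tower (c ⊕ k)) (nm H (pairM (j ⊕ k) y))))).
  { intros neg Dneg R HS H0 i.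
    assert (UR : forall k b, R k b <->
        b = neg (plugM (numM 0) (tower (c ⊕ k)) (nm H (pairM (j ⊕ k) y)))).
    { intros x b. split.
      - intros (t & n & Ht & Hn & ->). apply tower_spec in Ht as ->.
        now apply (nm_spec H) in Hn as ->.
      - intros ->. exists (tower (c ⊕ x)), (nm H (pairM (j ⊕ x) y)).
        rewrite tower_spec, (nm_spec H). auto. }
    destruct (truth_ind H (ct0_ind HT) (R:=R)) with i as (b & Hb & Tb).
    - unfold R. do 2 apply def_ex. apply def_and.
      { apply TowerM_def; solve_defT. } apply def_and; [solve_def|].
      apply def_eq; [solve_defT|]. apply Dneg. unfold plugM. solve_defT.
    - intros x. eauto.
    - eexists. split; [apply UR; reflexivity|]. now rewrite !(pa_A0 H).
    - intros x (b & Hb & Tb). apply UR in Hb as ->. eexists. split; [apply UR; reflexivity|].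
      now apply (proj1 (HS x)).
    - apply UR in Hb as ->. exact Tb. }
  assert (HS : forall k, T (plugM (numM 0) (tower (c ⊕ k)) (nm H (pairM (j ⊕ k) y))) <->
      T (plugM (numM 0) (tower (c ⊕ oS k)) (nm H (pairM (j ⊕ oS k) y)))).
  { intros i. rewrite !(pa_AS H). symmetry. apply level_shift. }
  assert (Ng : forall c x, T (cNegM (plugM (numM 0) (tower c) (nm H x))) <-> ~ level c x).
  { intros d x. apply (ct_neg (ct0_ct HT)). split.
    - apply (plug_form1 (v:=o0) (tower_form1 d)); [apply nm_term|].
      intros u K. now apply nm_closed in K.
    - intros v K.
      assert (L : forall w, isForm1M w (plugM (numM 0) (tower d) (nm H x))).
      { intros w. apply (plug_form1 (tower_form1 d)); [apply nm_term|].
        intros u L. now apply nm_closed in L. }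
      apply (pa_S0 H (x:=v)). transitivity v; [symmetry|]; now apply L. }
  split.
  - intros K. apply NNPP. intros N. apply Ng in N.
    apply (D cNegM) with (k:=k) in N.
    + apply Ng in N. auto.
    + intros g Hg. solve_defT.
    + intros i. rewrite !Ng. unfold level, ClassM. now rewrite HS.
  - intros K. apply (D (fun b => b)) with (k:=k) in K; auto.
Qed.

Lemma level_clause c i f al : i ≺ c -> level c (pairM i (pairM f al)) <->
  clauseM (fun a be => level c (pairM (oS i) (pairM a be))) f al.
Proof.
  intros [d E].
  replace (pairM i (pairM f al)) with (pairM (o0 ⊕ i) (pairM f al))
    by now rewrite (add0x H).
  assert (E' : c = oS d ⊕ i) by (rewrite <- E; mring).
  rewrite E' at 1. rewrite level_add, level_0.
  apply (clauseM_local H). intros a be _.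
  rewrite <- (level_add (oS i)), E, (add0x H). tauto.
Qed.

(** Both predicates are parts of [level c], for which full induction on [f] is
    available. Their levels must exceed the depth of [f], which is bounded by
    its code. *)
Lemma level_coherent c f : forall i j al, f ⊕ i ≺ c -> f ⊕ j ≺ c ->
  level c (pairM i (pairM f al)) <-> level c (pairM j (pairM f al)).
Proof.
  revert f. apply (strong_ind (level_pa c)
    (Y:=fun f => forall i j al, f ⊕ i ≺ c -> f ⊕ j ≺ c ->
    level c (pairM i (pairM f al)) <-> level c (pairM j (pairM f al)))); [solve_def|].
  intros f IH i j al Hi Hj.
  assert (L : forall i, f ⊕ i ≺ c -> i ≺ c).
  { intros x Hx. eapply (le_lt_trans H); [|exact Hx]. apply le_addl. }
  rewrite !level_clause by auto. apply (clauseM_local H). intros a be Ha.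
  assert (L' : forall i, f ⊕ i ≺ c -> a ⊕ oS i ≺ c).
  { intros x Hx. eapply (le_lt_trans H); [|exact Hx]. destruct Ha as [z <-].
    exists z. mring. }
  apply IH; auto.
Qed.

Definition Sat (f al : M) : Prop := level (oS f) (pairM o0 (pairM f al)).

(* The predicate at index 0 of [level (S f)] is found in [level c] at a larger
   index. *)
Lemma Sat_level c f al : f ≺ c -> level c (pairM o0 (pairM f al)) <-> Sat f al.
Proof.
  intros [d E]. unfold Sat. rewrite <- (level_add d o0 (oS f)).
  replace (oS f ⊕ d) with c by (rewrite <- E; mring). rewrite (add0x H).
  apply level_coherent.
  - rewrite (pa_A0 H). now exists d.
  - exists o0. rewrite <- E. mring.
Qed.

Lemma Sat_clause f al : Sat f al <-> clauseM Sat f al.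
Proof.
  unfold Sat at 1. rewrite level_clause by (exists f; mring).
  apply (clauseM_local H). intros a be Ha.
  rewrite (level_coherent (j:=o0)).
  - apply Sat_level. apply (le_lt_S H), (lt_le H), Ha.
  - destruct Ha as [z <-]. exists z. mring.
  - rewrite (pa_A0 H). apply (le_lt_S H), (lt_le H), Ha.
Qed.

Lemma Sat_bounded c : exists X, inductive_class X /\
  forall f al, f ≺ c -> X (pairM o0 (pairM f al)) <-> Sat f al.
Proof. exists (level c). split; [apply level_pa|]. intros. now apply Sat_level. Qed.

Lemma TruthM_Sat f : TruthM B T f <-> Sat f o0.
Proof.
  unfold TruthM, Sat, level, ClassM. split.
  - intros (t & n & Ht & Hn & K). apply tower_spec in Ht as ->.
    now apply (nm_spec H) in Hn as ->.
  - intros K. eexists _, _. rewrite tower_spec, (nm_spec H). eauto.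
Qed.

End Tower.

(** * Consequences of satisfaction *)

Definition no_preds (M : str) (p : Empty_set) (x : M) : Prop := match p with end.

Section Satisfaction.
Context {M : str} {X0 : M -> Prop} (H : inductive_class X0) {Sat : M -> M -> Prop}.
Implicit Types x y z w a b c d f i j k al be : M.
Hypothesis Sat_clause : forall f al, Sat f al <-> clauseM Sat f al.
Hypothesis Sat_bounded : forall c, exists X, inductive_class X /\
  forall f al, f ≺ c -> X (pairM o0 (pairM f al)) <-> Sat f al.

Ltac sat_clause := rewrite Sat_clause; unfold clauseM; split;
  [let K := fresh "K" in intros K; destr K; code_inv H; eauto
  |let K := fresh "K" in intros K; destr K; search].

Lemma Sat_eq s t al : Sat (cEqM s t) al <-> exists x, TValM al s x /\ TValM al t x.
Proof. sat_clause. Qed.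
Lemma Sat_neg a al : Sat (cNegM a) al <-> ~ Sat a al.
Proof. sat_clause. Qed.
Lemma Sat_and a b al : Sat (cAndM a b) al <-> Sat a al /\ Sat b al.
Proof. sat_clause. Qed.
Lemma Sat_or a b al : Sat (cOrM a b) al <-> Sat a al \/ Sat b al.
Proof. sat_clause. Qed.
Lemma Sat_ex v a al : Sat (cExM v a) al <-> exists x, Sat a (consM (pairM v x) al).
Proof. sat_clause. Qed.
Lemma Sat_all v a al : Sat (cAllM v a) al <-> forall x, Sat a (consM (pairM v x) al).
Proof. sat_clause. Qed.

(** ** Locality and substitution *)

(** No induction is available for statements about [Sat] as such. In an induction
    on formulae it is replaced by a class that agrees with it below a bound. *)
Section Bounded.
Variables (c : M) (X : M -> Prop).
Hypothesis HX : inductive_class X.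
Hypothesis XSat : forall f al, f ≺ c -> X (pairM o0 (pairM f al)) <-> Sat f al.
Notation XS f al := (X (pairM o0 (pairM f al))).

Lemma neg_below a : cNegM a ≺ c -> a ≺ c.
Proof. intros K. eapply (lt_le_trans H); [apply (lt_tag H)|exact (lt_le H K)]. Qed.
Lemma pair_below1 (k : nat) a b : pairM (numM (S k)) (pairM a b) ≺ c -> a ≺ c.
Proof. intros K. eapply (lt_le_trans H); [apply (lt_tag1 H)|exact (lt_le H K)]. Qed.
Lemma pair_below2 (k : nat) a b : pairM (numM (S k)) (pairM a b) ≺ c -> b ≺ c.
Proof. intros K. eapply (lt_le_trans H); [apply (lt_tag2 H)|exact (lt_le H K)]. Qed.

Lemma XS_neg a al : cNegM a ≺ c -> XS (cNegM a) al <-> ~ XS a al.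
Proof. intros K. rewrite !XSat by eauto using neg_below. apply Sat_neg. Qed.
Lemma XS_and a b al : cAndM a b ≺ c -> XS (cAndM a b) al <-> XS a al /\ XS b al.
Proof.
  intros K. pose proof (pair_below1 K). pose proof (pair_below2 K).
  rewrite !XSat by assumption. apply Sat_and.
Qed.
Lemma XS_or a b al : cOrM a b ≺ c -> XS (cOrM a b) al <-> XS a al \/ XS b al.
Proof.
  intros K. pose proof (pair_below1 K). pose proof (pair_below2 K).
  rewrite !XSat by assumption. apply Sat_or.
Qed.
Lemma XS_ex v a al : cExM v a ≺ c ->
  XS (cExM v a) al <-> exists x, XS a (consM (pairM v x) al).
Proof.
  intros K. rewrite XSat, Sat_ex by auto. apply pair_below2 in K.
  split; intros [x L]; exists x; now apply XSat.
Qed.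
Lemma XS_all v a al : cAllM v a ≺ c ->
  XS (cAllM v a) al <-> forall x, XS a (consM (pairM v x) al).
Proof.
  intros K. rewrite XSat, Sat_all by auto. apply pair_below2 in K.
  split; intros L x; now apply XSat.
Qed.

Lemma XS_local f : isFormM f -> f ≺ c -> forall al be,
  (forall v, FreeInM v f -> same_at v al be) -> XS f al <-> XS f be.
Proof.
  revert f. apply (form_ind HX (Y:=fun f => f ≺ c -> forall al be,
    (forall v, FreeInM v f -> same_at v al be) -> XS f al <-> XS f be)).
  { unfold same_at. solve_def. }
  5, 6: intros u a _ IH L al be K; rewrite ?XS_ex, ?XS_all by auto;
    (assert (E : forall x, XS a (consM (pairM u x) al) <-> XS a (consM (pairM u x) be));
     [|now setoid_rewrite E]);
    intros x; apply IH; [exact (pair_below2 L)|];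
    intros v Hv; apply (same_at_cons H); intros N; apply K;
    rewrite ?(freeIn_ex H), ?(freeIn_all H); auto.
  3, 4: intros a b _ IHa _ IHb L al be K; rewrite ?XS_and, ?XS_or by auto;
    rewrite (IHa (pair_below1 L) al be), (IHb (pair_below2 L) al be); [tauto|..];
    intros v Hv; apply K; rewrite ?(freeIn_and H), ?(freeIn_or H); auto.
  - intros s t Hs Ht L al be K. rewrite !XSat, !Sat_eq by auto.
    assert (E : forall r, isTermM r -> (forall v, FreeInM v r -> FreeInM v (cEqM s t)) ->
      forall x, TValM al r x <-> TValM be r x) by (intros; apply (tval_local H); auto).
    setoid_rewrite (E s); auto; [setoid_rewrite (E t); auto; [reflexivity|]|];
      intros v Hv; apply (freeIn_eq H); auto.
  - intros a _ IH L al be K. rewrite !XS_neg by auto.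
    rewrite (IH (neg_below L) al be); [tauto|]. intros v Hv. apply K. now apply (freeIn_neg H).
Qed.

Lemma XS_sub v r x f : isTermM r -> isFormM f -> f ≺ c -> forall g, g ≺ c ->
  FreeForM r v f -> SubM f v r g -> forall al, (forall y, TValM al r y <-> y = x) ->
  XS g al <-> XS f (consM (pairM v x) al).
Proof.
  intros Hr. revert f. apply (form_ind HX (Y:=fun f => f ≺ c -> forall g, g ≺ c ->
    FreeForM r v f -> SubM f v r g -> forall al, (forall y, TValM al r y <-> y = x) ->
    XS g al <-> XS f (consM (pairM v x) al))).
  { solve_def. }
  5, 6: intros u a Ha IH L g Lg F K al Hx;
    match goal with |- _ <-> XS ?q _ =>
      assert (Same : ~ FreeInM v q -> XS q al <-> XS q (consM (pairM v x) al)) by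
        (intros N; apply XS_local; rewrite ?(isForm_ex H), ?(isForm_all H); auto;
         intros w Hw y; symmetry; apply (look_there H); congruence) end;
    rewrite ?(sub_ex H), ?(sub_all H) in K; rewrite ?(freeFor_ex H), ?(freeFor_all H) in F;
    rewrite ?(freeIn_ex H), ?(freeIn_all H) in Same, F;
    destruct K as [[-> ->]|(N & a1 & -> & K)]; [tauto|];
    (destruct F as [F|[F1 F2]];
      [assert (a = a1) as <-; [|tauto]; apply (sub_fun H Ha (v:=v) (r:=r)); auto;
       apply (sub_notfree H); tauto|]);
    rewrite ?XS_ex, ?XS_all by auto;
    (assert (E : forall y, XS a1 (consM (pairM u y) al) <->
                           XS a (consM (pairM u y) (consM (pairM v x) al)));
     [|now setoid_rewrite E]);
    intros y; rewrite (IH (pair_below2 L) a1 (pair_below2 Lg) F2 K);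
    [apply XS_local; [auto|exact (pair_below2 L)|intros w _; apply (same_at_swap H); auto]
    |intros z; rewrite <- Hx; apply (tval_local H); auto; intros w Hw;
     apply (same_at_skip H); congruence].
  3, 4: intros a b _ IHa _ IHb L g Lg F K al Hx;
    rewrite ?(sub_and H), ?(sub_or H) in K; destruct K as (a1 & b1 & -> & K1 & K2);
    rewrite ?(freeFor_and H), ?(freeFor_or H) in F; destruct F as [F1 F2];
    rewrite ?XS_and, ?XS_or by auto;
    rewrite (IHa (pair_below1 L) a1 (pair_below1 Lg) F1 K1 al Hx);
    rewrite (IHb (pair_below2 L) b1 (pair_below2 Lg) F2 K2 al Hx); tauto.
  - intros s t Hs Ht L g Lg _ K al Hx.
    apply (sub_eq H) in K as (s1 & t1 & -> & K1 & K2). rewrite !XSat, !Sat_eq by auto.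
    setoid_rewrite (tval_sub H Hx Hs K1). now setoid_rewrite (tval_sub H Hx Ht K2).
  - intros a _ IH L g Lg F K al Hx. apply (sub_neg H) in K as (a1 & -> & K).
    rewrite (freeFor_neg H) in F. rewrite !XS_neg by auto.
    rewrite (IH (neg_below L) a1 (neg_below Lg) F K al Hx). tauto.
Qed.

End Bounded.

Lemma Sat_local f al be : isFormM f -> (forall v, FreeInM v f -> same_at v al be) ->
  Sat f al <-> Sat f be.
Proof.
  intros Hf K. destruct (Sat_bounded (oS f)) as (X & HX & E).
  assert (L : f ≺ oS f) by apply (le_refl H).
  rewrite <- !E by auto. now apply (XS_local HX E).
Qed.

Lemma Sat_sub v r x f g al : isTermM r -> isFormM f -> FreeForM r v f ->
  SubM f v r g -> (forall y, TValM al r y <-> y = x) ->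
  Sat g al <-> Sat f (consM (pairM v x) al).
Proof.
  intros Hr Hf F K Hx. destruct (Sat_bounded (oS (f ⊕ g))) as (X & HX & E).
  assert (L : f ≺ oS (f ⊕ g)) by apply (le_lt_S H), (le_addr H).
  assert (L' : g ≺ oS (f ⊕ g)) by apply (le_lt_S H), le_addl.
  rewrite <- !E by auto. now apply (XS_sub HX E Hr).
Qed.

Lemma Sat_numeral v x f g al : isFormM f -> SubM f v (nm H x) g ->
  Sat g al <-> Sat f (consM (pairM v x) al).
Proof.
  intros Hf K. apply (Sat_sub (r:=nm H x)); auto.
  - apply nm_term.
  - apply (freeFor_only H); auto. intros u Hu. now apply nm_closed in Hu.
  - intros y. apply tval_nm.
Qed.

(** ** The compositional axioms *)

Definition Truth0 f : Prop := Sat f o0.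

Lemma Truth0_CT : compositional Truth0.
Proof.
  assert (Q : forall v a, isFormM a -> forall x,
    TrInstM Truth0 a v x <-> Sat a (consM (pairM v x) o0)).
  { intros v a Ha x. destruct (sub_total H v (nm H x) Ha) as [b Hb].
    rewrite (TrInst_sub _ Ha Hb). now apply Sat_numeral. }
  unfold Truth0. split.
  - intros s t [[Hs Vs] [Ht Vt]]. rewrite Sat_eq.
    setoid_rewrite (val_tval H o0 Hs Vs). setoid_rewrite (val_tval H o0 Ht Vt).
    split; [intros (x & K1 & K2); eauto|intros (x & y & K1 & K2 & ->); eauto].
  - intros a b _. apply Sat_and.
  - intros a b _. apply Sat_or.
  - intros a _. apply Sat_neg.
  - intros v a [Ha _]. rewrite Sat_all. split; intros K x; now apply Q.
  - intros v a [Ha _]. rewrite Sat_ex. split; intros [x K]; exists x; now apply Q.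
Qed.

(** ** Bounded induction *)

Lemma eval_mono (e : nat -> M) b (t : term) : (forall v, In v (fvt t) -> e v ≼ b) ->
  eval e t ≼ eval (fun _ => b) t.
Proof.
  induction t as [v| |t IH|s IHs t IHt|s IHs t IHt]; simpl; intros K.
  - apply K. now left.
  - apply (le_refl H).
  - apply (le_SS H). auto.
  - apply (le_add H); [apply IHs|apply IHt]; intros; apply K, in_or_app; auto.
  - apply (le_mul H); [apply IHs|apply IHt]; intros; apply K, in_or_app; auto.
Qed.

Lemma sat_FLe P (I : P -> M -> Prop) e (v w : nat) x (t : term) :
  ~ In v (fvt t) -> w <> v -> ~ In w (fvt t) ->
  sat I (upd e v x) (FLe w v t) <-> x ≼ eval e t.
Proof.
  intros Hv N Hw. unfold FLe, le. simpl.
  assert (E : forall z, eval (upd (upd e v x) w z) t = eval e t).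
  { intros z. apply eval_ext. intros u Hu. rewrite !upd_other; congruence. }
  split; intros [z K]; exists z; rewrite E in *;
    rewrite upd_same in *; rewrite upd_other, upd_same in * by congruence; auto.
Qed.

Lemma fv_FLe P (u v w : nat) t : In u (fvt t) -> u <> w -> In u (fv (@FLe P w v t)).
Proof. intros K N. apply in_in_remove; auto. apply in_or_app. now right. Qed.

(** The values of the variables of a bounded formula, free or bound, are bounded,
    so it asks for the truth of boundedly many sentences. *)
Lemma delta0_local (Z : M -> Prop) (A : LPAT) : Delta0 A -> forall b, exists c,
  forall Y : M -> Prop, (forall x, x ≺ c -> Y x <-> Z x) ->
  forall e, (forall v, In v (fv A) -> e v ≼ b) ->
  sat (fun _ => Y) e A <-> sat (fun _ => Z) e A.
Proof.
  induction 1 as [s t|p t|A _ IH|A B _ IHA _ IHB|A B _ IHA _ IHB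
    |v w t A Hv N Hw _ IH|v w t A Hv N Hw _ IH]; intros b.
  6, 7: destruct (IH (b ⊕ eval (fun _ => b) t)) as [c Hc]; exists c; intros Y HY e He;
    assert (K : forall x, x ≼ eval e t ->
      sat (fun _ => Y) (upd e v x) A <-> sat (fun _ => Z) (upd e v x) A) by
    (intros x Hx; apply Hc; auto; intros u Hu; unfold upd;
     destruct (Nat.eqb_spec u v) as [->|Nu];
     [eapply (le_trans H); [exact Hx|]; eapply (le_trans H); [|apply le_addl];
      apply eval_mono; intros u Hu'; apply He;
      apply in_in_remove; [congruence|]; apply in_or_app; left;
      apply fv_FLe; auto; congruence
     |eapply (le_trans H); [|apply (le_addr H)]; apply He;
      apply in_in_remove; auto; apply in_or_app; now right]).
  4, 5: destruct (IHA b) as [c Hc]; destruct (IHB b) as [d Hd]; exists (c ⊕ d);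
    intros Y HY e He; simpl; rewrite (Hc Y), (Hd Y); [tauto|..];
    try (intros; apply He, in_or_app; auto);
    intros x Hx; apply HY; eapply (lt_le_trans H); eauto;
    [apply le_addl|apply (le_addr H)].
  - exists o0. intros Y _ e _. simpl. tauto.
  - exists (oS (eval (fun _ => b) t)). intros Y HY e He. simpl. apply HY.
    apply (le_lt_S H). now apply eval_mono.
  - destruct (IH b) as [c Hc]. exists c. intros Y HY e He. simpl.
    now rewrite (Hc Y HY e).
  - cbn [sat]. split; intros (x & K1 & K2); exists x; split; auto;
      rewrite ?sat_FLe in * by auto; auto; now apply K.
  - unfold FImp. cbn [sat]. split; intros L x; specialize (L x);
      rewrite ?sat_FLe in * by auto;
      (destruct L as [L|L]; [now left|]);
      (destruct (classic (x ≼ eval e t)); [right; now apply K|now left]).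
Qed.

(* Induction for the new class comes from a translation that replaces the
   argument of the predicate. *)
Lemma Truth0_bounded c : exists Y, inductive_class Y /\ forall f, f ≺ c -> Y f <-> Truth0 f.
Proof.
  destruct (Sat_bounded c) as (X & HX & E).
  exists (fun f => X (pairM o0 (pairM f o0))). split; [|intros f; apply E].
  split; [exact (pa_S0 H)|exact (pa_inj H)|exact (pa_A0 H)|exact (pa_AS H)
         |exact (pa_M0 H)|exact (pa_MS H)|].
  intros A e v.
  assert (K : forall e, sat (fun _ : unit => X) e
      (replace_preds (fun p t => FPred p (tpair Zero (tpair t Zero))) A) <->
      sat (fun _ : unit => fun f => X (pairM o0 (pairM f o0))) e A).
  { apply sat_replace. reflexivity. }
  rewrite <- K. intros K0 KS x. apply K, (pa_ind HX); auto.
  intros y. rewrite !K. apply KS.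
Qed.

Lemma sat_def (Y : M -> Prop) e (v : nat) (A : LPAT) :
  Def Y (fun e' => sat (fun _ => Y) (upd e v (e' 0)) A).
Proof.
  exists (csubst (fun u => if u =? v then Var 0 else Var (S (2 * u))) A), e.
  intros e'. rewrite sat_csubst. apply sat_ext. intros u _. unfold upd.
  destruct (u =? v); simpl eval; symmetry; [apply (mix_even e' e 0)|apply (mix_odd e' e)].
Qed.

Lemma bound_exists (e : nat -> M) l : exists b, forall v, In v l -> e v ≼ b.
Proof.
  induction l as [|u l [b IH]].
  - exists o0. intros v [].
  - exists (b ⊕ e u). intros v [<-|Hv]; [apply le_addl|].
    eapply (le_trans H); [now apply IH|apply (le_addr H)].
Qed.

Lemma Truth0_ind (A : LPAT) (e : nat -> M) (v : nat) : Delta0 A ->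
  sat (fun _ => Truth0) (upd e v o0) A ->
  (forall x, sat (fun _ => Truth0) (upd e v x) A ->
             sat (fun _ => Truth0) (upd e v (oS x)) A) ->
  forall x, sat (fun _ => Truth0) (upd e v x) A.
Proof.
  intros HA K0 KS k. destruct (bound_exists e (fv A)) as [b Hb].
  destruct (delta0_local Truth0 HA (b ⊕ k)) as [c Hc].
  destruct (Truth0_bounded c) as (Y & HY & E).
  assert (K : forall x, x ≼ k -> sat (fun _ => Y) (upd e v x) A <->
                                 sat (fun _ => Truth0) (upd e v x) A).
  { intros x Hx. apply Hc; auto. intros u Hu. unfold upd.
    destruct (Nat.eqb_spec u v).
    - eapply (le_trans H); [exact Hx|apply le_addl].
    - eapply (le_trans H); [now apply Hb|apply (le_addr H)]. }
  apply K; [apply (le_refl H)|].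
  assert (L : forall x, x ≼ k -> sat (fun _ => Y) (upd e v x) A).
  { apply (ind HY (Y:=fun x => x ≼ k -> sat (fun _ => Y) (upd e v x) A)).
    - apply def_imp; [solve_def|apply sat_def].
    - intros Hx. now apply K.
    - intros x IH Hx. apply K; auto. assert (x ≼ k) by now apply (lt_le H).
      apply KS, K; auto. }
  apply L, (le_refl H).
Qed.

(** ** Soundness of proofs *)

Definition SeqTrue (al G D : M) : Prop :=
  (forall f, MemM f G -> Sat f al) -> exists f, MemM f D /\ Sat f al.

Lemma mem_single f a : MemM f (consM a o0) <-> a = f.
Proof.
  rewrite (mem_cons H). split; [intros [K|K]; auto; now apply (mem_nil H) in K|auto].
Qed.

Lemma seq_right al G a D : SeqTrue al G (consM a D) <-> Sat a al \/ SeqTrue al G D.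
Proof.
  unfold SeqTrue. split.
  - intros K. destruct (classic (Sat a al)) as [S|N]; [now left|right]. intros HG.
    destruct (K HG) as (f & Hf & Sf). apply (mem_cons H) in Hf as [->|Hf]; [tauto|eauto].
  - intros [S|K] HG.
    + exists a. split; auto. apply (mem_cons H). auto.
    + destruct (K HG) as (f & Hf & Sf). exists f. split; auto. apply (mem_cons H). auto.
Qed.

Lemma seq_left al a G D : SeqTrue al (consM a G) D <-> (Sat a al -> SeqTrue al G D).
Proof.
  unfold SeqTrue. split.
  - intros K Sa HG. apply K. intros f Hf. apply (mem_cons H) in Hf as [<-|Hf]; auto.
  - intros K HG. apply K.
    + apply HG, (mem_cons H). auto.
    + intros f Hf. apply HG, (mem_cons H). auto.
Qed.

Lemma rule0_sound tau G D al : (forall f, tau f -> Truth0 f) ->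
  isFormListM G -> isFormListM D -> Rule0M tau G D -> SeqTrue al G D.
Proof.
  intros Htau LG LD [(a & -> & ->)|[(a & -> & -> & [Fa Va] & Ta)|[(t & -> & ->)
    |(s & t & v & p & q & a & b & Hp & Hq & -> & -> & Ka & Kb)]]];
    rewrite ?seq_left, ?seq_right.
  - tauto.
  - left. apply Htau in Ta. unfold Truth0 in Ta. rewrite Sat_local; eauto.
    intros v Hv. now apply Va in Hv.
  - left. apply (isFormList_cons H) in LD as [LD _]. apply (isForm_eq H) in LD as [Ht _].
    apply Sat_eq. destruct (tval_unique H al Ht) as [x Hx]. exists x.
    split; now apply Hx.
  - intros E Sa. left. apply (isFormList_cons H) in LG as [LG _].
    apply (isForm_eq H) in LG as [Hs Ht].
    destruct (tval_unique H al Hs) as [x Hx]. destruct (tval_unique H al Ht) as [y Hy].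
    apply Sat_eq in E as (z & E1 & E2). apply Hx in E1. apply Hy in E2. subst.
    assert (F : isFormM (cEqM p q)) by now apply (isForm_eq H).
    rewrite (Sat_sub Hs F (freeFor_eq H _ _ _ _) Ka Hx) in Sa.
    now rewrite (Sat_sub Ht F (freeFor_eq H _ _ _ _) Kb Hy).
Qed.

(** The premise is assumed to be true under all assignments, since for the rules
    with an eigenvariable the value of this variable has to vary. *)
Lemma rule1_sound G1 D1 G D : isFormListM G -> isFormListM D ->
  (forall al, SeqTrue al G1 D1) -> Rule1M G1 D1 G D -> forall al, SeqTrue al G D.
Proof.
  intros LG LD K R al.
  assert (Eigen : forall (u v a b x : M), isFormM a ->
    (v = u \/ ~ FreeInM u a) ->
    FreeForM (cVarM u) v a -> SubM a v (cVarM u) b ->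
    Sat b (consM (pairM u x) al) <-> Sat a (consM (pairM v x) al)).
  { intros u v a b x Fa N F S. rewrite (Sat_sub (x:=x) (isTerm_var H u) Fa F S).
    - apply Sat_local; auto. intros w Hw. apply (same_at_cons H). intros Nv.
      destruct N as [->|N].
      + now apply (same_at_skip H).
      + apply (same_at_skip H). congruence.
    - intros y. rewrite (tval_var H). apply (look_here H). }
  assert (Ctx : forall u x L, isFormListM L -> (forall f, MemM f L -> ~ FreeInM u f) ->
    forall f, MemM f L -> Sat f (consM (pairM u x) al) <-> Sat f al).
  { intros u x L HL N f Hf. apply Sat_local. { exact (isFormList_mem H HL Hf). }
    intros v Hv. apply (same_at_skip H). intros ->. exact (N f Hf Hv). }
  destruct R as [R|[(a & -> & ->)|[(a & -> & ->)|[(a & b & L & -> & -> & ->)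
    |[(a & b & L & -> & -> & ->)|[(v & a & r & b & L & Hr & F & S & -> & -> & ->)
    |[(v & a & r & b & L & Hr & F & S & -> & -> & ->)
    |[(v & a & u & b & L & N & F & S & -> & -> & ->)
    |(v & a & u & b & L & N & F & S & -> & -> & ->)]]]]]]]].
  - intros HG. destruct (K al) as (f & Hf & Sf).
    + intros f Hf. apply HG, R, Hf.
    + exists f. split; auto. apply R, Hf.
  - apply seq_left. intros Sa. apply Sat_neg in Sa. specialize (K al).
    rewrite seq_right in K. tauto.
  - apply seq_right. specialize (K al). rewrite seq_left in K. rewrite Sat_neg.
    destruct (classic (Sat a al)); tauto.
  - specialize (K al). rewrite !seq_left in *. rewrite Sat_and. tauto.
  - specialize (K al). rewrite !seq_right in *. rewrite Sat_or. tauto.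
  - specialize (K al). rewrite !seq_left in *. intros Sa. apply K.
    apply (isFormList_cons H) in LG as [Fa _]. rewrite (isForm_all H) in Fa.
    destruct (tval_unique H al Hr) as [x Hx]. rewrite (Sat_sub Hr Fa F S Hx).
    rewrite Sat_all in Sa. apply Sa.
  - specialize (K al). rewrite !seq_right in *. destruct K as [K|K]; auto. left.
    apply (isFormList_cons H) in LD as [Fa _]. rewrite (isForm_ex H) in Fa.
    destruct (tval_unique H al Hr) as [x Hx]. rewrite (Sat_sub Hr Fa F S Hx) in K.
    apply Sat_ex. eauto.
  - apply seq_right. apply (isFormList_cons H) in LD as [Fa LL].
    assert (Na : v = u \/ ~ FreeInM u a).
    { destruct (classic (v = u)); auto. right. intros Hu. apply (N (cAllM v a)).
      - right. apply (mem_cons H). auto.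
      - now apply (freeIn_all H). }
    rewrite (isForm_all H) in Fa. apply NNPP. intros NN. apply NN. left. apply Sat_all.
    intros x. specialize (K (consM (pairM u x) al)). rewrite seq_right in K.
    destruct K as [K|K]. { now rewrite (Eigen u v a b x Fa Na F S) in K. }
    exfalso. apply NN. right. intros HG. destruct K as (f & Hf & Sf).
    + intros f Hf. rewrite (Ctx u x G1); auto.
    + exists f. split; auto. rewrite (Ctx u x L) in Sf; auto.
      intros g Hg. apply N. right. apply (mem_cons H). auto.
  - apply seq_left. intros Sa. apply (isFormList_cons H) in LG as [Fa LL].
    assert (Na : v = u \/ ~ FreeInM u a).
    { destruct (classic (v = u)); auto. right. intros Hu. apply (N (cExM v a)).
      - left. apply (mem_cons H). auto.
      - now apply (freeIn_ex H). }
    rewrite (isForm_ex H) in Fa. apply Sat_ex in Sa as [x Sa].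
    specialize (K (consM (pairM u x) al)). rewrite seq_left in K.
    intros HG. destruct K as (f & Hf & Sf).
    + now rewrite (Eigen u v a b x Fa Na F S).
    + intros f Hf. rewrite (Ctx u x L); auto. intros g Hg. apply N. left.
      apply (mem_cons H). auto.
    + exists f. split; auto. rewrite (Ctx u x D1) in Sf; eauto.
Qed.

Lemma rule2_sound G1 D1 G2 D2 G D al : SeqTrue al G1 D1 -> SeqTrue al G2 D2 ->
  Rule2M G1 D1 G2 D2 G D -> SeqTrue al G D.
Proof.
  intros K1 K2 [(a & -> & -> & -> & ->)|[(a & b & L & -> & -> & -> & -> & ->)
    |(a & b & L & -> & -> & -> & -> & ->)]].
  - rewrite seq_right in K1. rewrite seq_left in K2. tauto.
  - rewrite seq_right in *. rewrite Sat_and. tauto.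
  - rewrite seq_left in *. rewrite Sat_or. tauto.
Qed.

(** The induction is on the elements of the coded set that witnesses that [d] is a
    proof. This set is a parameter, and all formulae in it that matter are
    below [d], so that the statement is about a class with full induction; the
    predicate [tau] does not occur in it. *)
Lemma proofs_sound tau d G D : (forall f, tau f -> Truth0 f) ->
  isProofM tau d -> ConclM d G D -> forall al, SeqTrue al G D.
Proof.
  intros Htau (s & Hd & Hs) [l El].
  destruct (Sat_bounded (oS d)) as (X & HX & E).
  assert (Conc : forall G D l x, MemM x G \/ MemM x D -> x ≺ pairM (pairM G D) l).
  { intros G' D' l' x [Hx|Hx]; apply (mem_lt H) in Hx;
      (eapply (lt_le_trans H); [exact Hx|]);
      (eapply (le_trans H); [|apply le_pair1]); [apply le_pair1|apply (le_pair2 H)]. }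
  pose (XTrue al G D := (forall f, MemM f G -> X (pairM o0 (pairM f al))) ->
    exists f, MemM f D /\ X (pairM o0 (pairM f al))).
  assert (XE : forall z G D l, z = pairM (pairM G D) l -> z ≼ d ->
      forall al, XTrue al G D <-> SeqTrue al G D).
  { intros z G' D' l' -> Hz al.
    assert (B : forall f, MemM f G' \/ MemM f D' -> f ≺ oS d).
    { intros f Hf. eapply (lt_le_trans H); [now apply Conc with (l:=l'), Hf|].
      eapply (le_trans H); [exact Hz|apply (le_S H)]. }
    unfold XTrue, SeqTrue. split; intros K HG.
    - destruct K as (f & Hf & Sf). { intros f Hf. apply E; auto. }
      exists f. split; auto. apply E in Sf; auto.
    - destruct K as (f & Hf & Sf). { intros f Hf. apply E; auto. }
      exists f. split; auto. apply E; auto. }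
  assert (Main : forall z, InSetM z s -> z ≼ d ->
      forall G D l, z = pairM (pairM G D) l -> forall al, XTrue al G D).
  { apply (strong_ind HX (Y:=fun z => InSetM z s -> z ≼ d ->
      forall G D l, z = pairM (pairM G D) l -> forall al, XTrue al G D)).
    { unfold XTrue. solve_def. }
    intros z IH Hz Lz G' D' l' Ez al. rewrite (XE _ _ _ _ Ez Lz).
    assert (Sub : forall d1 G1 D1, d1 ≺ z -> InSetM d1 s -> ConclM d1 G1 D1 ->
        forall al, SeqTrue al G1 D1).
    { intros d1 G1 D1 L1 I1 [l1 E1] be.
      assert (d1 ≼ d). { eapply (le_trans H); [exact (lt_le H L1)|exact Lz]. }
      rewrite <- (XE _ _ _ _ E1); eauto. }
    destruct (Hs z Hz) as (G2 & D2 & LG & LD & R).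
    destruct R as [[E0 R]|[(d1 & G1 & D1 & E0 & I1 & C1 & R)
      |(d1 & G1 & D1 & d2 & G3 & D3 & E0 & I1 & I2 & C1 & C2 & R)]];
      rewrite Ez in E0; apply (pair_inj H) in E0 as [E0 El'];
      apply (pair_inj H) in E0 as [<- <-].
    - eapply rule0_sound; eauto.
    - eapply rule1_sound; eauto. eapply Sub; eauto. subst.
      eapply (lt_le_trans H); [apply (lt_cons1 H)|apply (le_pair2 H)].
    - eapply rule2_sound; [| |exact R].
      + apply (Sub d1 G1 D1); auto. subst.
        eapply (lt_le_trans H); [apply (lt_cons1 H)|apply (le_pair2 H)].
      + apply (Sub d2 G3 D3); auto. subst.
        eapply (lt_le_trans H); [apply (lt_cons1 H d2 o0)|].
        eapply (le_trans H); [exact (lt_le H (lt_cons2 H d1 _))|apply (le_pair2 H)]. }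
  intros al. rewrite <- (XE d G D l); auto.
  - apply (Main d) with (l:=l); auto. apply (le_refl H).
  - apply (le_refl H).
Qed.

Lemma Truth0_GRP tau f : (forall f, tau f -> Truth0 f) -> PrM tau f -> Truth0 f.
Proof.
  intros Htau (d & Hd & Hc).
  destruct (proofs_sound Htau Hd Hc (al:=o0)) as (g & Hg & Sg).
  - intros g Hg. now apply (mem_nil H) in Hg.
  - apply mem_single in Hg as <-. exact Sg.
Qed.

(** ** Truth of the axioms of PA *)

Lemma induction_true f : isInductionM f -> forall al, Sat f al.
Proof.
  intros (v & a & a0 & aS & hyp & step & Fa & S0 & SS & -> & -> & ->) al.
  apply Sat_or. destruct (classic (Sat (cAndM a0 (cAllM v (cImpM a aS))) al)) as [K|K].
  2:{ left. now apply Sat_neg. }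
  right. apply Sat_all. apply Sat_and in K as [K0 KS]. rewrite Sat_all in KS.
  assert (F0 : FreeForM cZeroM v a).
  { apply (freeFor_only H); auto. intros u Hu. now apply (freeIn_zero H) in Hu. }
  rewrite (Sat_sub (isTerm_zero H) Fa F0 S0 (tval_zero H al)) in K0.
  assert (KS' : forall x, Sat a (consM (pairM v x) al) -> Sat a (consM (pairM v (oS x)) al)).
  { intros x Hx. specialize (KS x). apply Sat_or in KS as [KS|KS].
    { apply Sat_neg in KS. tauto. }
    rewrite (Sat_sub (x:=oS x) (r:=cSuccM (cVarM v)) (v:=v) (f:=a)) in KS; auto.
    - rewrite Sat_local; [exact KS|auto|]. intros w Hw.
      destruct (classic (v = w)) as [->|N].
      + intros y. now rewrite !(look_here H).
      + intros y. now rewrite !(look_there H) by auto.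
    - apply (isTerm_succ H), (isTerm_var H).
    - apply (freeFor_only H); auto. intros u. rewrite (freeIn_succ H), (freeIn_var H). auto.
    - intros y. rewrite (tval_succ H). setoid_rewrite (tval_var H).
      setoid_rewrite (look_here H). split; [now intros (z & -> & ->)|eauto]. }
  destruct (Sat_bounded (oS a)) as (X & HX & E).
  assert (L : a ≺ oS a) by apply (le_refl H).
  intros x. apply E; auto. revert x. apply (ind HX); [solve_def|..].
  - now apply E.
  - intros x Hx. apply E; auto. apply KS'. now apply E.
Qed.

Lemma generalization_true f g : GeneralizesM f g -> (forall al, Sat g al) ->
  forall al, Sat f al.
Proof.
  intros (s & Hf & Hs) Hg. destruct (Sat_bounded (oS f)) as (X & HX & E).
  assert (Main : forall z, InSetM z s -> z ≼ f -> forall al, X (pairM o0 (pairM z al))).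
  { apply (strong_ind HX (Y:=fun z => InSetM z s -> z ≼ f ->
      forall al, X (pairM o0 (pairM z al)))); [solve_def|].
    intros z IH Hz Lz al. apply E. { now apply (le_lt_S H). }
    destruct (Hs z Hz) as [->|(v & a & -> & Ha)]; auto.
    assert (La : a ≺ cAllM v a) by apply (lt_tag2 H).
    assert (La' : a ≼ f). { eapply (le_trans H); [exact (lt_le H La)|exact Lz]. }
    apply Sat_all. intros x. apply E; auto. now apply (le_lt_S H). }
  intros al. apply E; [apply (le_refl H)|]. apply Main; auto. apply (le_refl H).
Qed.

Lemma truth_of_standard (A : LPA) e : sentence A ->
  Truth0 (code A) <-> sat (@no_preds M) e A.
Proof.
  intros SA. rewrite <- (truth_of_code H Truth0_CT (sg:=fun v => v)
    (pl:=fun p : Empty_set => match p return M -> M with end)); auto.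
  - unfold code. erewrite codeF_ext; [reflexivity|]. intros v Hv.
    rewrite SA in Hv. destruct Hv.
  - split; now intros [].
  - now intros [].
Qed.

Lemma PA_basic_true A e : In A PA_basic ->
  sat (@no_preds M) e A.
Proof.
  simpl. intros [<-|[<-|[<-|[<-|[<-|[<-|[]]]]]]].
  - exact (pa_S0 H).
  - intros x y. destruct (classic (oS x = oS y)); [right|left]; auto. now apply (pa_inj H).
  - exact (pa_A0 H).
  - exact (pa_AS H).
  - exact (pa_M0 H).
  - exact (pa_MS H).
Qed.

Lemma PA_basic_sentence A : In A PA_basic -> sentence A.
Proof. simpl. intuition (subst; reflexivity). Qed.

Lemma Truth0_ASP f : AxPAM f -> Truth0 f.
Proof.
  intros [(A & HA & ->)|[_ (g & Hg & K)]].
  - apply (truth_of_standard (fun _ => o0)).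
    + now apply PA_basic_sentence.
    + now apply PA_basic_true.
  - apply (generalization_true K). now apply induction_true.
Qed.

End Satisfaction.

(** * The completeness theorem *)

(** ** An enumeration of the formulae *)

(* The codes of formulae in the standard model serve as their numbers. *)
Definition natM : str := Str 0 S Nat.add Nat.mul.

Lemma sat_nat_ind (A : LPAT) I (e : nat -> natM) v :
  sat I (upd e v 0) A -> (forall x, sat I (upd e v x) A -> sat I (upd e v (S x)) A) ->
  forall x, sat I (upd e v x) A.
Proof. intros K0 KS x. induction x; auto. Qed.

Lemma natM_inductive (X : natM -> Prop) : inductive_class X.
Proof.
  split; simpl; intros; try lia.
  - apply sat_nat_ind; auto.
Qed.

Local Notation nat_code := (codeF (M:=natM) (fun v => v)
  (fun (_ : unit) n => pairM (M:=natM) (numM 11) n) (fun _ => None)).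

Lemma numM_nat n : numM (M:=natM) n = n.
Proof. induction n; auto. unfold numM; fold (numM (M:=natM)). now rewrite IHn. Qed.

Lemma codeT_inj (s t : term) : codeT (M:=natM) (fun v => v) (fun _ => None) s =
  codeT (fun v => v) (fun _ => None) t -> s = t.
Proof.
  pose proof (natM_inductive (fun _ => False)) as H.
  revert t. induction s; intros [] E; cbn [codeT] in E; code_inv H; f_equal; auto.
Qed.

Lemma nat_code_inj A B : nat_code A = nat_code B -> A = B.
Proof.
  pose proof (natM_inductive (fun _ => False)) as H.
  revert B. induction A; intros [] E; cbn [codeF] in E; rewrite ?upd_None in E;
    code_inv H; f_equal; auto using codeT_inj; now destruct p, p0.
Qed.

Definition formula_number (n : nat) : LPAT :=
  epsilon (inhabits (FEq Zero Zero)) (fun A => nat_code A = n).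

Lemma formula_number_onto A : exists n, formula_number n = A.
Proof.
  exists (nat_code A). apply nat_code_inj. unfold formula_number.
  apply (epsilon_spec (inhabits (FEq Zero Zero)) (fun B => nat_code B = nat_code A)).
  now exists A.
Qed.

(** ** Renaming free variables *)

Local Arguments Nat.max : simpl never.

(* The least number above all bound variables. *)
Fixpoint bound_sup P (A : form P) : nat :=
  match A with
  | FEq _ _ | FPred _ _ => 0
  | FNeg A => bound_sup A
  | FAnd A B | FOr A B => Nat.max (bound_sup A) (bound_sup B)
  | FEx v A | FAll v A => Nat.max (S v) (bound_sup A)
  end.

Definition rent (s : nat -> nat) (t : term) : term := csubstt (fun v => Var (s v)) t.

Fixpoint ren P (s : nat -> nat) (A : form P) : form P :=
  match A with
  | FEq t1 t2 => FEq (rent s t1) (rent s t2)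
  | FPred p t => FPred p (rent s t)
  | FNeg A => FNeg (ren s A)
  | FAnd A B => FAnd (ren s A) (ren s B)
  | FOr A B => FOr (ren s A) (ren s B)
  | FEx v A => FEx v (ren (upd s v v) A)
  | FAll v A => FAll v (ren (upd s v v) A)
  end.

Lemma bound_sup_ren P (A : form P) : forall s, bound_sup (ren s A) = bound_sup A.
Proof. induction A; intros r; simpl; rewrite ?IHA, ?IHA1, ?IHA2; reflexivity. Qed.

Lemma free_for_sup P (A : form P) u v : bound_sup A <= u -> free_for (Var u) v A.
Proof.
  induction A; cbn [bound_sup free_for fvt]; intros K; auto.
  - split; [apply IHA1|apply IHA2]; lia.
  - split; [apply IHA1|apply IHA2]; lia.
  - right. split; [intros [E|[]]; lia|]. apply IHA. lia.
  - right. split; [intros [E|[]]; lia|]. apply IHA. lia.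
Qed.

Lemma rent_subst v u s s' t :
  (forall x, In x (fvt t) -> x <> v -> s x = s' x /\ s x <> v) -> s v = v -> s' v = u ->
  substt v (Var u) (rent s t) = rent s' t.
Proof.
  unfold rent. intros K E E'. induction t as [x| |t IH|t1 IH1 t2 IH2|t1 IH1 t2 IH2];
    simpl in *; try f_equal; auto using in_or_app.
  destruct (Nat.eq_dec x v) as [->|N].
  - rewrite E, Nat.eqb_refl. congruence.
  - destruct (K x) as [K1 K2]; auto. destruct (Nat.eqb_spec (s x) v); congruence.
Qed.

Lemma rent_ext s s' t : (forall x, In x (fvt t) -> s x = s' x) -> rent s t = rent s' t.
Proof.
  unfold rent. intros K. induction t; simpl in *; f_equal; auto using in_or_app.
Qed.

Lemma ren_ext P (A : form P) : forall s s', (forall x, In x (fv A) -> s x = s' x) ->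
  ren s A = ren s' A.
Proof.
  induction A; intros r r' K; simpl in *; f_equal; auto using rent_ext, in_or_app.
  all: apply IHA; intros x Hx; unfold upd; destruct (Nat.eqb_spec x v); auto.
  all: apply K; now apply in_in_remove.
Qed.

Lemma ren_sentence P (A : form P) s : sentence A -> ren s A = A.
Proof.
  assert (T : forall t, rent (fun v => v) t = t).
  { unfold rent. induction t; simpl; congruence. }
  assert (K : forall B : form P, ren (fun v => v) B = B).
  { induction B; simpl; f_equal; auto;
      rewrite (@ren_ext _ _ _ (fun v => v)); auto; intros x _; unfold upd;
      destruct (Nat.eqb_spec x v); congruence. }
  intros SA. rewrite (@ren_ext _ A s (fun v => v)); auto. rewrite SA. intros x [].
Qed.

(** Renaming does not avoid capture; its use is confined to new names that are
    bound nowhere in the formula. *)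
Lemma ren_subst P (A : form P) : forall v u s s',
  (forall x, In x (fv A) -> x <> v -> s x = s' x /\ s x <> v) -> s v = v -> s' v = u ->
  subst v (Var u) (ren s A) = ren s' A.
Proof.
  induction A as [t1 t2|p t|A IH|A IHA B IHB|A IHA B IHB|w A IH|w A IH];
    intros v u s s' K E E'; simpl in *; f_equal; auto using rent_subst, in_or_app.
  all: destruct (Nat.eqb_spec w v) as [->|N];
    [apply ren_ext; intros x Hx; unfold upd; destruct (Nat.eqb_spec x v); auto;
     apply K; auto; now apply in_in_remove
    |apply IH; rewrite ?upd_other by auto; auto; intros x Hx Nx; unfold upd;
     destruct (Nat.eqb_spec x w); [auto|apply K; auto; now apply in_in_remove]].
Qed.

(** ** A complete Henkin theory *)

Section Henkin.
Variable Ax : LPAT -> Prop.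
Variable G0 : list LPAT.

Definition consistent (G : list LPAT) : Prop := ~ LK Ax G [].
Hypothesis G0_con : consistent G0.

Lemma LK_in A G D : In A G -> In A D -> LK Ax G D.
Proof.
  intros HG HD. apply (LK_struct (@LK_id _ Ax A)); intros B [<-|[]]; auto.
Qed.

Lemma con_neg A G : consistent G -> ~ consistent (A :: G) -> consistent (FNeg A :: G).
Proof.
  intros K N L. apply N. intros L'. apply K. apply LK_cut with (FNeg A); auto.
  apply LK_negR. exact L'.
Qed.

Definition var_sup (A : LPAT) : nat := Nat.max (bound_sup A) (S (list_max (fv A))).
Definition fresh_var (G : list LPAT) : nat := list_max (map var_sup G).

Lemma le_list_max x l : In x l -> x <= list_max l.
Proof.
  intros Hx. pose proof (proj1 (list_max_le l (list_max l)) (Nat.le_refl _)) as F.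
  rewrite Forall_forall in F. auto.
Qed.

Lemma fresh_var_sup A G : In A G -> var_sup A <= fresh_var G.
Proof. intros K. apply le_list_max. now apply in_map. Qed.

Lemma var_sup_fv A u : var_sup A <= u -> ~ In u (fv A).
Proof. unfold var_sup. intros K L. apply le_list_max in L. lia. Qed.

Lemma con_ex v A u G : (forall B, In B (FEx v A :: G) -> var_sup B <= u) ->
  consistent (FEx v A :: G) -> consistent (subst v (Var u) A :: FEx v A :: G).
Proof.
  intros F K L. apply K. apply LK_struct with (FEx v A :: FEx v A :: G) [].
  - apply LK_exL with u; auto.
    + apply free_for_sup. specialize (F _ (or_introl eq_refl)).
      unfold var_sup in F. simpl in F. lia.
    + intros B HB. apply var_sup_fv, F. rewrite app_nil_r in HB. simpl in *. tauto.
  - intros B [<-|HB]; [now left|exact HB].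
  - apply incl_refl.
Qed.

Lemma con_all v A u G : (forall B, In B (FNeg (FAll v A) :: G) -> var_sup B <= u) ->
  consistent (FNeg (FAll v A) :: G) ->
  consistent (FNeg (subst v (Var u) A) :: FNeg (FAll v A) :: G).
Proof.
  intros F K L. apply K. set (G' := FNeg (FAll v A) :: G) in *.
  apply LK_struct with (FNeg (FAll v A) :: G') [].
  2:{ intros B [<-|HB]; [now left|exact HB]. }
  2:{ apply incl_refl. }
  apply LK_negL, LK_allR with u.
  - apply free_for_sup. specialize (F _ (or_introl eq_refl)).
    unfold var_sup in F. simpl in F. lia.
  - intros B HB. apply in_app_or in HB as [HB|[<-|[]]]; apply var_sup_fv; auto.
    apply (F (FNeg (FAll v A))). now left.
  - apply LK_cut with (FNeg (subst v (Var u) A)).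
    + apply LK_negR, LK_in with (subst v (Var u) A); now left.
    + apply (LK_struct L); [apply incl_refl|]. intros B [].
Qed.

(* Besides the formula or its negation, a witness is added: a new variable is an
   example of a true existential or a counterexample of a false universal
   formula. *)
Definition decide (A : LPAT) (G : list LPAT) : list LPAT :=
  let u := fresh_var (A :: FNeg A :: G) in
  if excluded_middle_informative (consistent (A :: G)) then
    match A with FEx v B => subst v (Var u) B :: A :: G | _ => A :: G end
  else
    match A with
    | FAll v B => FNeg (subst v (Var u) B) :: FNeg A :: G
    | _ => FNeg A :: G
    end.

Lemma decide_con A G : consistent G -> consistent (decide A G).
Proof.
  intros K. unfold decide.
  assert (F : forall B, In B (A :: FNeg A :: G) -> var_sup B <= fresh_var (A :: FNeg A :: G))
    by (intros B HB; now apply fresh_var_sup).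
  destruct (excluded_middle_informative _) as [L|N].
  - destruct A; auto. apply con_ex; auto. intros B HB. apply F. simpl in *. tauto.
  - apply con_neg in N; auto. destruct A; auto. apply con_all; auto.
    intros B HB. apply F. simpl in *. tauto.
Qed.

Lemma decide_incl A G : incl G (decide A G).
Proof.
  unfold decide. destruct (excluded_middle_informative _); destruct A;
    intros C HC; simpl; tauto.
Qed.

Fixpoint stage (n : nat) : list LPAT :=
  match n with 0 => G0 | S n => decide (formula_number n) (stage n) end.

Definition Gam (A : LPAT) : Prop := exists n, In A (stage n).

Lemma stage_con n : consistent (stage n).
Proof. induction n; simpl; auto using decide_con. Qed.

Lemma stage_mono m n : m <= n -> incl (stage m) (stage n).
Proof.
  induction 1; [apply incl_refl|]. eapply incl_tran; [eassumption|]. apply decide_incl.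
Qed.

Lemma Gam_finite G : (forall A, In A G -> Gam A) -> exists n, incl G (stage n).
Proof.
  induction G as [|A G IH]; intros K.
  - exists 0. intros A [].
  - destruct IH as [n Hn]. { intros B HB. apply K. now right. }
    destruct (K A (or_introl eq_refl)) as [m Hm]. exists (Nat.max m n).
    intros B [<-|HB].
    + apply (@stage_mono m); auto. lia.
    + apply (@stage_mono n); auto. lia.
Qed.

Lemma Gam_con G : (forall A, In A G -> Gam A) -> consistent G.
Proof.
  intros K L. destruct (Gam_finite K) as [n Hn]. apply (@stage_con n).
  apply (LK_struct L); auto. apply incl_refl.
Qed.

Lemma Gam_total A : Gam A \/ Gam (FNeg A).
Proof.
  destruct (formula_number_onto A) as [n <-].
  assert (K : In (formula_number n) (stage (S n)) \/ In (FNeg (formula_number n)) (stage (S n))).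
  { simpl. unfold decide. destruct (excluded_middle_informative _);
      destruct (formula_number n); simpl; tauto. }
  destruct K; [left|right]; eexists; eassumption.
Qed.

Lemma Gam_neg A : Gam (FNeg A) <-> ~ Gam A.
Proof.
  split.
  - intros N K. apply (@Gam_con [FNeg A; A]).
    + intros B [<-|[<-|[]]]; auto.
    + apply LK_negL. apply LK_in with A; now left.
  - intros N. destruct (Gam_total A); tauto.
Qed.

Lemma Gam_closed G A : LK Ax G [A] -> (forall B, In B G -> Gam B) -> Gam A.
Proof.
  intros L K. apply NNPP. intros N. apply Gam_neg in N.
  apply (@Gam_con (FNeg A :: G)).
  - intros B [<-|HB]; auto.
  - now apply LK_negL.
Qed.

Lemma Gam_and A B : Gam (FAnd A B) <-> Gam A /\ Gam B.
Proof.
  split.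
  - intros K. split; (apply (@Gam_closed [FAnd A B]); [|intros C [<-|[]]; auto]);
      apply LK_andL; [apply LK_in with A|apply LK_in with B]; simpl; auto.
  - intros [KA KB]. apply (@Gam_closed [A; B]).
    + apply LK_andR; [apply LK_in with A|apply LK_in with B]; simpl; auto.
    + intros C [<-|[<-|[]]]; auto.
Qed.

Lemma Gam_or A B : Gam (FOr A B) <-> Gam A \/ Gam B.
Proof.
  split.
  - intros K. apply NNPP. intros N.
    assert (NA : Gam (FNeg A)) by (apply Gam_neg; tauto).
    assert (NB : Gam (FNeg B)) by (apply Gam_neg; tauto).
    apply (@Gam_con [FOr A B; FNeg A; FNeg B]).
    + intros C [<-|[<-|[<-|[]]]]; auto.
    + apply LK_orL.
      * apply LK_struct with [FNeg A; A] [];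
          [apply LK_negL, LK_in with A; simpl; auto| |apply incl_refl].
        intros C [<-|[<-|[]]]; simpl; auto.
      * apply LK_struct with [FNeg B; B] [];
          [apply LK_negL, LK_in with B; simpl; auto| |apply incl_refl].
        intros C [<-|[<-|[]]]; simpl; auto.
  - intros [K|K]; [apply (@Gam_closed [A])|apply (@Gam_closed [B])];
      try (intros C [<-|[]]; auto); apply LK_orR;
      [apply LK_in with A|apply LK_in with B]; simpl; auto.
Qed.

Lemma Gam_inst v A r : free_for r v A -> Gam (FAll v A) -> Gam (subst v r A).
Proof.
  intros F K. apply (@Gam_closed [FAll v A]).
  - apply LK_allL with r; auto. apply LK_in with (subst v r A); now left.
  - intros C [<-|[]]; auto.
Qed.

Lemma Gam_ex_intro v A r : free_for r v A -> Gam (subst v r A) -> Gam (FEx v A).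
Proof.
  intros F K. apply (@Gam_closed [subst v r A]).
  - apply LK_exR with r; auto. apply LK_in with (subst v r A); now left.
  - intros C [<-|[]]; auto.
Qed.

Lemma Gam_ex v A : Gam (FEx v A) ->
  exists u, var_sup (FEx v A) <= u /\ Gam (subst v (Var u) A).
Proof.
  intros K. destruct (formula_number_onto (FEx v A)) as [n E].
  assert (L : exists u, var_sup (FEx v A) <= u /\
     (In (subst v (Var u) A) (stage (S n)) \/ In (FNeg (FEx v A)) (stage (S n)))).
  { simpl. rewrite E. unfold decide. eexists. split.
    - apply fresh_var_sup with (G:=FEx v A :: FNeg (FEx v A) :: stage n). now left.
    - destruct (excluded_middle_informative _); simpl; auto. }
  destruct L as (u & Hu & [L|L]).
  - exists u. split; auto. now exists (S n).
  - exfalso. apply (proj1 (Gam_neg (FEx v A))); auto. now exists (S n).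
Qed.

Lemma Gam_all v A : ~ Gam (FAll v A) ->
  exists u, var_sup (FAll v A) <= u /\ ~ Gam (subst v (Var u) A).
Proof.
  intros K. destruct (formula_number_onto (FAll v A)) as [n E].
  assert (L : exists u, var_sup (FAll v A) <= u /\
     (In (FNeg (subst v (Var u) A)) (stage (S n)) \/ In (FAll v A) (stage (S n)))).
  { simpl. rewrite E. unfold decide. eexists. split.
    - apply fresh_var_sup with (G:=FAll v A :: FNeg (FAll v A) :: stage n). now left.
    - destruct (excluded_middle_informative _); simpl; auto. }
  destruct L as (u & Hu & [L|L]).
  - exists u. split; auto. apply Gam_neg. now exists (S n).
  - exfalso. apply K. now exists (S n).
Qed.

(** ** The term model *)

Definition eqv (s t : term) : Prop := Gam (FEq s t).

Lemma eqv_refl t : eqv t t.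
Proof. apply (@Gam_closed []); [apply LK_refl|intros B []]. Qed.

Lemma eqv_subst s t v A : atomic A -> eqv s t -> Gam (subst v s A) -> Gam (subst v t A).
Proof.
  intros HA E K. apply (@Gam_closed [FEq s t; subst v s A]).
  - now apply LK_eq.
  - intros B [<-|[<-|[]]]; auto.
Qed.

Definition new (l : list nat) : nat := S (list_max l).
Lemma new_notin l k : incl k l -> ~ In (new l) k.
Proof. intros K L. apply K, le_list_max in L. unfold new in L. lia. Qed.

Lemma substt_var v r : substt v r (Var v) = r.
Proof. simpl. now rewrite Nat.eqb_refl. Qed.

Lemma eqv_sym s t : eqv s t -> eqv t s.
Proof.
  intros E. set (v := new (fvt s)).
  assert (N : ~ In v (fvt s)) by (apply new_notin, incl_refl).
  pose proof (@eqv_subst s t v (FEq (Var v) s) Logic.I E) as K. cbn [subst] in K.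
  rewrite !substt_var, !(subst_notin_t _ N) in K. apply K, eqv_refl.
Qed.

Lemma eqv_trans s t r : eqv s t -> eqv t r -> eqv s r.
Proof.
  intros E E'. set (v := new (fvt s)).
  assert (N : ~ In v (fvt s)) by (apply new_notin, incl_refl).
  pose proof (@eqv_subst t r v (FEq s (Var v)) Logic.I E') as K. cbn [subst] in K.
  rewrite !substt_var, !(subst_notin_t _ N) in K. apply K, E.
Qed.

Lemma eqv_succ s t : eqv s t -> eqv (Succ s) (Succ t).
Proof.
  intros E. set (v := new (fvt s)).
  assert (N : ~ In v (fvt s)) by (apply new_notin, incl_refl).
  pose proof (@eqv_subst s t v (FEq (Succ s) (Succ (Var v))) Logic.I E) as K.
  cbn [subst substt] in K. rewrite Nat.eqb_refl, !(subst_notin_t _ N) in K. apply K, eqv_refl.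
Qed.

Lemma eqv_binary (f : term -> term -> term) :
  (forall v r s t, substt v r (f s t) = f (substt v r s) (substt v r t)) ->
  forall s s' t t', eqv s s' -> eqv t t' -> eqv (f s t) (f s' t').
Proof.
  intros Hf s s' t t' E E'. apply eqv_trans with (f s' t).
  - set (v := new (fvt s ++ fvt t)).
    assert (N : ~ In v (fvt s)) by (apply new_notin; intros x Hx; apply in_or_app; auto).
    assert (N' : ~ In v (fvt t)) by (apply new_notin; intros x Hx; apply in_or_app; auto).
    pose proof (@eqv_subst s s' v (FEq (f s t) (f (Var v) t)) Logic.I E) as K.
    cbn [subst] in K. rewrite !Hf, !substt_var, !(subst_notin_t _ N), !(subst_notin_t _ N') in K.
    apply K, eqv_refl.
  - set (v := new (fvt s' ++ fvt t)).
    assert (N : ~ In v (fvt s')) by (apply new_notin; intros x Hx; apply in_or_app; auto).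
    assert (N' : ~ In v (fvt t)) by (apply new_notin; intros x Hx; apply in_or_app; auto).
    pose proof (@eqv_subst t t' v (FEq (f s' t) (f s' (Var v))) Logic.I E') as K.
    cbn [subst] in K. rewrite !Hf, !substt_var, !(subst_notin_t _ N), !(subst_notin_t _ N') in K.
    apply K, eqv_refl.
Qed.

(* Objects are canonical representatives of classes of equal terms, for equality
   has to be interpreted by identity. *)
Definition rep (t : term) : term := epsilon (inhabits Zero) (eqv t).

Lemma eqv_rep t : eqv t (rep t).
Proof. apply (epsilon_spec (inhabits Zero) (eqv t)). exists t. apply eqv_refl. Qed.

Lemma rep_eq s t : eqv s t <-> rep s = rep t.
Proof.
  split.
  - intros E. unfold rep. f_equal. extensionality r. apply propositional_extensionality.
    split; eauto using eqv_trans, eqv_sym.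
  - intros E. apply eqv_trans with (rep s); [apply eqv_rep|]. rewrite E.
    apply eqv_sym, eqv_rep.
Qed.

Lemma rep_rep t : rep (rep t) = rep t.
Proof. symmetry. apply rep_eq, eqv_rep. Qed.

Definition mk (t : term) : {t | rep t = t} := exist _ (rep t) (rep_rep t).

Lemma mk_eq s t : mk s = mk t <-> eqv s t.
Proof.
  rewrite rep_eq. split.
  - intros E. exact (f_equal (@proj1_sig _ _) E).
  - intros E. apply eq_sig_uncurried. exists E. apply proof_irrelevance.
Qed.

Lemma mk_proj (d : {t | rep t = t}) : mk (proj1_sig d) = d.
Proof.
  destruct d as [t E]. apply eq_sig_uncurried. exists E. apply proof_irrelevance.
Qed.

Definition termM : str := Str (mk Zero) (fun d => mk (Succ (proj1_sig d)))
  (fun d d' => mk (Plus (proj1_sig d) (proj1_sig d')))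
  (fun d d' => mk (Times (proj1_sig d) (proj1_sig d'))).

Definition termI (p : unit) (d : termM) : Prop := Gam (FPred p (proj1_sig d)).

Lemma eval_termM (s : nat -> nat) t : eval (M:=termM) (fun v => mk (Var (s v))) t = mk (rent s t).
Proof.
  unfold rent. induction t as [v| |t IH|t1 IH1 t2 IH2|t1 IH1 t2 IH2]; simpl; auto.
  - rewrite IH. apply mk_eq, eqv_succ, eqv_sym, eqv_rep.
  - rewrite IH1, IH2. apply mk_eq. apply (eqv_binary (f:=Plus)); auto using eqv_sym, eqv_rep.
  - rewrite IH1, IH2. apply mk_eq. apply (eqv_binary (f:=Times)); auto using eqv_sym, eqv_rep.
Qed.

Lemma termI_mk p t : termI p (mk t) <-> Gam (FPred p t).
Proof.
  assert (K : forall s t, eqv s t -> Gam (FPred p s) -> Gam (FPred p t)).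
  { intros s r E K. pose proof (@eqv_subst s r 0 (FPred p (Var 0)) Logic.I E). auto. }
  unfold termI. simpl. split; apply K; auto using eqv_sym, eqv_rep.
Qed.

(** A witness for [x = t /\ k = k] is a variable above [k]. So every object is
    named by arbitrarily large variables, and it suffices to substitute
    variables that are not bound in the formula at hand. *)
Lemma mk_var (d : termM) k : exists u, k <= u /\ d = mk (Var u).
Proof.
  rewrite <- (mk_proj d). set (t := proj1_sig d).
  set (x := new (k :: fvt t)).
  assert (Nx : ~ In x (fvt t)) by (apply new_notin; intros y Hy; now right).
  assert (Nk : k <> x).
  { intros E. apply (@new_notin (k :: fvt t) [k]); [|left; exact E].
    intros y [<-|[]]. now left. }
  set (A := FAnd (FEq (Var x) t) (FEq (Var k) (Var k)) : LPAT).
  assert (S : forall r, subst x r A = FAnd (FEq r t) (FEq (Var k) (Var k))).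
  { intros r. unfold A. cbn [subst]. rewrite substt_var, (subst_notin_t _ Nx).
    simpl. apply Nat.eqb_neq in Nk. now rewrite Nk. }
  destruct (@Gam_ex x A) as (u & Hu & Ku).
  - apply Gam_ex_intro with t; [simpl; auto|]. rewrite S. apply Gam_and.
    split; apply eqv_refl.
  - rewrite S in Ku. apply Gam_and in Ku as [Ku _]. exists u. split.
    + assert (K : In k (fv (FEx x A))).
      { apply in_in_remove; auto. unfold A. simpl. rewrite !in_app_iff. simpl. tauto. }
      unfold var_sup in Hu. apply le_list_max in K. lia.
    + apply mk_eq, eqv_sym, Ku.
Qed.

(** The hypothesis on [s], that the names of the values are not bound in [A],
    keeps all substitutions free of capture; for sentences it is void. *)
Lemma truth_lemma A : forall s : nat -> nat, (forall x, In x (fv A) -> bound_sup A <= s x) ->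
  sat termI (fun v => mk (Var (s v)) : termM) A <-> Gam (ren s A).
Proof.
  assert (U : forall (s : nat -> nat) v u,
    (upd (fun v => mk (Var (s v)) : termM) v (mk (Var u))) =
    (fun x => mk (Var (upd s v u x)))).
  { intros s v u. extensionality x. unfold upd. now destruct (x =? v). }
  assert (R : forall v (B : LPAT) s u, (forall x, In x (remove Nat.eq_dec v (fv B)) ->
      Nat.max (S v) (bound_sup B) <= s x) ->
      subst v (Var u) (ren (upd s v v) B) = ren (upd s v u) B).
  { intros v B s u K. apply ren_subst; rewrite ?upd_same; auto.
    intros x Hx N. rewrite !upd_other by auto. split; auto.
    assert (L : In x (remove Nat.eq_dec v (fv B))) by now apply in_in_remove.
    apply K in L. lia. }
  assert (C : forall v (B : LPAT) s u, (forall x, In x (remove Nat.eq_dec v (fv B)) ->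
      Nat.max (S v) (bound_sup B) <= s x) -> Nat.max (S v) (bound_sup B) <= u ->
      forall x, In x (fv B) -> bound_sup B <= upd s v u x).
  { intros v B s u K Hu x Hx. unfold upd. destruct (Nat.eqb_spec x v); [lia|].
    assert (L : In x (remove Nat.eq_dec v (fv B))) by now apply in_in_remove.
    apply K in L. lia. }
  induction A as [t1 t2|p t|A IH|A IHA B IHB|A IHA B IHB|v A IH|v A IH];
    intros s K; simpl in *.
  - rewrite !eval_termM. apply mk_eq.
  - rewrite eval_termM. apply termI_mk.
  - rewrite Gam_neg, IH; tauto.
  - rewrite Gam_and, IHA, IHB; [tauto|..]; intros x Hx;
      (assert (L : In x (fv A ++ fv B)) by (apply in_or_app; auto)); apply K in L; lia.
  - rewrite Gam_or, IHA, IHB; [tauto|..]; intros x Hx;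
      (assert (L : In x (fv A ++ fv B)) by (apply in_or_app; auto)); apply K in L; lia.
  - split.
    + intros [d Hd]. destruct (mk_var d (Nat.max (S v) (bound_sup A))) as (u & Hu & ->).
      rewrite U, IH in Hd by eauto. rewrite <- (R _ _ _ _ K) in Hd.
      apply Gam_ex_intro in Hd; auto. apply free_for_sup. rewrite bound_sup_ren. lia.
    + intros L. apply Gam_ex in L as (u & Hu & L). exists (mk (Var u)).
      assert (Hu' : Nat.max (S v) (bound_sup A) <= u).
      { unfold var_sup in Hu. simpl in Hu. rewrite bound_sup_ren in Hu. lia. }
      rewrite U, IH by eauto. now rewrite <- (R _ _ _ _ K).
  - split.
    + intros Hd. apply NNPP. intros N. apply Gam_all in N as (u & Hu & N). apply N.
      assert (Hu' : Nat.max (S v) (bound_sup A) <= u).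
      { unfold var_sup in Hu. simpl in Hu. rewrite bound_sup_ren in Hu. lia. }
      rewrite (R _ _ _ _ K). rewrite <- IH by eauto. rewrite <- U. apply Hd.
    + intros L d. destruct (mk_var d (Nat.max (S v) (bound_sup A))) as (u & Hu & ->).
      rewrite U, IH by eauto. rewrite <- (R _ _ _ _ K). apply Gam_inst; auto.
      apply free_for_sup. rewrite bound_sup_ren. lia.
Qed.

Lemma truth_sentence A e : sentence A -> sat termI e A <-> Gam A.
Proof.
  intros SA. rewrite (sat_sentence _ _ (fun v => mk (Var v) : termM) SA).
  rewrite (truth_lemma (s:=fun v => v)).
  - rewrite ren_sentence by auto. tauto.
  - rewrite SA. intros x [].
Qed.

End Henkin.

Theorem completeness (Ax : LPAT -> Prop) A : sentence A ->
  (forall (M : str) (I : unit -> M -> Prop),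
     (forall B e, sentence B -> Ax B -> sat I e B) -> forall e, sat I e A) ->
  provable Ax A.
Proof.
  intros SA K. apply NNPP. intros N.
  assert (C : consistent Ax [FNeg A]).
  { intros L. apply N. apply LK_cut with (FNeg A); auto.
    - apply LK_negR, LK_in with A; now left.
    - apply (LK_struct L); [apply incl_refl|]. intros B []. }
  specialize (K (termM C) (@termI Ax [FNeg A] C)).
  assert (L : Gam Ax [FNeg A] A).
  { rewrite <- (truth_sentence (G0_con:=C) (fun _ => o0) SA). apply K. intros B e SB HB.
    rewrite truth_sentence by auto. apply (Gam_closed C (G:=[])).
    - now apply LK_ax.
    - intros D []. }
  apply (proj1 (Gam_neg C A)); auto. exists 0. now left.
Qed.

(** * Models of [CT0] *)

Lemma free_for_closed P r v (A : form P) :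
  (forall u, In u (fvt r) -> u = v) -> free_for r v A.
Proof.
  intros Hr. induction A; simpl; auto.
  - destruct (Nat.eq_dec v0 v) as [->|N]; [left; apply remove_In|right].
    split; auto.
  - destruct (Nat.eq_dec v0 v) as [->|N]; [left; apply remove_In|right].
    split; auto.
Qed.

Lemma sat_induction (M : str) P (I : P -> M -> Prop) e v A :
  sat I e (induction v A) <->
  (sat I (upd e v o0) A ->
   (forall x, sat I (upd e v x) A -> sat I (upd e v (oS x)) A) ->
   forall x, sat I (upd e v x) A).
Proof.
  unfold induction, FImp. cbn [sat].
  rewrite sat_subst by (apply free_for_closed; simpl; tauto). cbn [eval].
  assert (K : forall x, sat I (upd e v x) (subst v (Succ (Var v)) A) <->
                        sat I (upd e v (oS x)) A).
  { intros x. rewrite sat_subst by (apply free_for_closed; simpl; intuition).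
    cbn [eval]. now rewrite upd_same, upd_upd_same. }
  setoid_rewrite K. split.
  - intros [N|L]; auto. intros K0 KS x. exfalso. apply N. split; auto.
    intros y. destruct (classic (sat I (upd e v y) A)); auto.
  - intros L. apply NNPP. intros N. apply N. right. apply L.
    + apply NNPP. intros N0. apply N. left. tauto.
    + intros x Hx. apply NNPP. intros NS. apply N. left. intros [_ KS].
      destruct (KS x); tauto.
Qed.

Section CTAxioms.
Variables (M : str) (T : M -> Prop).
Notation satT := (sat (fun _ : unit => T)).

Lemma rrel_T e n : RRel (fun _ : unit => T) e n Tr T.
Proof. exact (@rrel_Tr M (fun _ => T) e n). Qed.

Lemma sat_compositional e : (forall A, In A CT_compositional -> satT e A) <-> compositional T.
Proof.
  pose proof (@rrel_T e 0) as HT.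
  unfold CT_compositional. match goal with |- (forall A, In A ?l -> _) <-> _ =>
    transitivity (Forall (satT e) l); [symmetry; apply Forall_forall|] end.
  rewrite !Forall_cons_iff.
  match goal with |- satT e (?F1 0) /\ satT e (?F2 0) /\ satT e (?F3 0) /\
    satT e (?F4 0) /\ satT e (?F5 0) /\ satT e (?F6 0) /\ _ <-> _ =>
    assert (S1 : BSem (fun _ : unit => T) e 0 F1
      (forall s t, isClosedTermM s /\ isClosedTermM t ->
        (T (cEqM s t) <-> exists x y, ValM s x /\ ValM t y /\ x = y))) by bsem;
    assert (S2 : BSem (fun _ : unit => T) e 0 F2
      (forall a b, isSentM a /\ isSentM b -> (T (cAndM a b) <-> T a /\ T b))) by bsem;
    assert (S3 : BSem (fun _ : unit => T) e 0 F3
      (forall a b, isSentM a /\ isSentM b -> (T (cOrM a b) <-> T a \/ T b))) by bsem;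
    assert (S4 : BSem (fun _ : unit => T) e 0 F4
      (forall a, isSentM a -> (T (cNegM a) <-> ~ T a))) by bsem;
    assert (S5 : BSem (fun _ : unit => T) e 0 F5
      (forall v a, isForm1M v a -> (T (cAllM v a) <-> forall x, TrInstM T a v x)))
      by (unfold TrInst, TrInstM; bsem);
    assert (S6 : BSem (fun _ : unit => T) e 0 F6
      (forall v a, isForm1M v a -> (T (cExM v a) <-> exists x, TrInstM T a v x)))
      by (unfold TrInst, TrInstM; bsem)
  end.
  unfold BSem in *. rewrite S1, S2, S3, S4, S5, S6. split.
  - intros (K1 & K2 & K3 & K4 & K5 & K6 & _). now split.
  - intros []. do 6 (split; [assumption|]). apply Forall_nil.
Qed.

Lemma sat_GRP e : satT e GRP <-> forall a, isSentM a -> PrM T a -> T a.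
Proof.
  pose proof (@rrel_T e 0) as HT. unfold GRP.
  match goal with |- satT e (?F 0) <-> ?Y =>
    change (BSem (fun _ : unit => T) e 0 F Y) end.
  bsem.
Qed.

Lemma sat_ASP e : satT e ASP <-> forall a, isSentM a -> AxPAM a -> T a.
Proof.
  pose proof (@rrel_T e 0) as HT. unfold ASP.
  match goal with |- satT e (?F 0) <-> ?Y =>
    change (BSem (fun _ : unit => T) e 0 F Y) end.
  bsem.
Qed.

End CTAxioms.

Lemma compositional_sentence A : In A CT_compositional -> sentence A.
Proof. simpl. intuition (subst; reflexivity). Qed.

Lemma PA_sentence A : PA A -> sentence A.
Proof. intros [B HB|v B C [SC _]]; auto using PA_basic_sentence. Qed.

Lemma CT0_sentence A : CT0 A -> sentence A.
Proof.
  intros [B [C HC|C HC]|v B C _ [SC _]]; auto using compositional_sentence.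
  now apply sentence_embed, PA_sentence.
Qed.

Lemma CT0_GRP_ASP_sentence A : CT0_GRP_ASP A -> sentence A.
Proof. intros [B HB| |]; [now apply CT0_sentence|reflexivity|reflexivity]. Qed.

(** An empty predicate can be replaced by a contradiction. *)
Lemma PA_model (M : str) : (forall A e, PA A -> sat (@no_preds M) e A) ->
  inductive_class (fun _ : M => False).
Proof.
  intros K.
  assert (B : forall A, In A PA_basic -> sat (@no_preds M) (fun _ => o0) A).
  { intros A HA. apply K. now apply PA_ax. }
  unfold PA_basic in B. split.
  - apply (B _ (or_introl eq_refl)).
  - intros x y E. specialize (B _ (or_intror (or_introl eq_refl)) x y).
    destruct B as [B|B]; [now destruct B|exact B].
  - apply (B _ (or_intror (or_intror (or_introl eq_refl)))).
  - apply (B _ (or_intror (or_intror (or_intror (or_introl eq_refl))))).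
  - apply (B _ (or_intror (or_intror (or_intror (or_intror (or_introl eq_refl)))))).
  - apply (B _ (or_intror (or_intror (or_intror (or_intror (or_intror (or_introl eq_refl))))))).
  - intros A e v.
    pose (A' := replace_preds (fun _ _ => FNeg (FEq Zero Zero)) A : LPA).
    assert (E : forall e, sat (@no_preds M) e A' <-> sat (fun _ _ => False) e A).
    { apply sat_replace. simpl. tauto. }
    destruct (closure_exists (induction v A')) as [C HC].
    assert (L : sat (@no_preds M) e (induction v A')).
    { destruct HC as [SC [vs EC]]. apply (proj1 (sat_closure _ _ vs)). rewrite <- EC.
      intros e'. apply K. apply (PA_induction (v:=v) (A:=A')). split; eauto. }
    rewrite sat_induction in L. setoid_rewrite E in L. exact L.
Qed.

Lemma inductive_class_PA (M : str) : inductive_class (fun _ : M => False) ->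
  forall A e, PA A -> sat (@no_preds M) e A.
Proof.
  intros H A e [B HB|v B C [SC [vs ->]]].
  - now apply (PA_basic_true H).
  - revert e. apply sat_closure. intros e. apply sat_induction.
    assert (E : forall e, sat (fun (_ : unit) (_ : M) => False) e (embed B) <->
                          sat (@no_preds M) e B) by (intros; apply sat_embed).
    setoid_rewrite <- E. apply (pa_ind H).
Qed.

Lemma CT0_model_structure (M : str) (T : M -> Prop) :
  (forall A e, sentence A -> CT0 A -> sat (fun _ => T) e A) -> CT0_structure T.
Proof.
  intros K. split.
  - apply PA_model. intros A e HA.
    rewrite <- (sat_embed (fun _ : unit => T)). apply K.
    + now apply sentence_embed, PA_sentence.
    + now apply CT0_CTminus, CTminus_PA.
  - apply (sat_compositional T (fun _ => o0)). intros A HA. apply K.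
    + now apply compositional_sentence.
    + now apply CT0_CTminus, CTminus_comp.
  - intros A e v HA. apply sat_induction.
    destruct (closure_exists (induction v A)) as (C & SC & vs & EC).
    apply (proj1 (sat_closure _ _ vs)). rewrite <- EC. intros e'. apply K; auto.
    apply (CT0_induction HA (v:=v)). split; eauto.
Qed.

Lemma model_unit (M : str) (I : unit -> M -> Prop) : I = fun _ => I tt.
Proof. extensionality p. now destruct p. Qed.

(** ** The defined truth predicate *)

Lemma truth_definition : exists T' : LPAT,
  (forall v, In v (fv T') -> v = 0) /\
  forall (M : str) (T : M -> Prop), CT0_structure T -> exists Sat : M -> M -> Prop,
    (forall f al, Sat f al <-> clauseM Sat f al) /\
    (forall c, exists X, inductive_class X /\
       forall f al, f ≺ c -> X (pairM o0 (pairM f al)) <-> Sat f al) /\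
    forall e A, sat (fun _ => T) e (replace_T T' A) <->
                sat (fun _ => Truth0 (Sat:=Sat)) e A.
Proof.
  destruct step_formula as (B & fvB & satB).
  destruct (truth_formula B) as (T' & fvT & satT). exists T'. split; auto.
  intros M T HT. exists (Sat HT B).
  split; [apply Sat_clause; auto|]. split; [apply Sat_bounded; auto|].
  intros e A. rewrite (sat_replace_T _ _ (fun _ => o0) fvT).
  replace (fun (_ : unit) x => sat (fun _ : unit => T) (upd (fun _ => o0) 0 x) T')
    with (fun (_ : unit) => Truth0 (Sat:=Sat HT B)); [tauto|].
  extensionality p. extensionality x. apply propositional_extensionality.
  rewrite satT, upd_same. symmetry. now apply TruthM_Sat.
Qed.

(** Completeness reduces the claim to models of [CT0], in each of which the
    defined formula denotes [Truth0]. *)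
Theorem CT0_defines_GRP_ASP : PA_relatively_definable CT0_GRP_ASP CT0.
Proof.
  destruct truth_definition as (T' & fvT & HT'). exists T'. split; auto.
  intros A HA. apply completeness.
  { apply sentence_replace_T; auto. now apply CT0_GRP_ASP_sentence. }
  intros M I K e. rewrite (model_unit I) in *. set (T := I tt) in *.
  assert (HT : CT0_structure T) by (apply CT0_model_structure; auto).
  destruct (HT' M T HT) as (Sat & HS & HB & E). rewrite E. clear HT' E.
  pose proof (ct0_pa HT) as H.
  destruct HA as [A0 [A1 [A HA|A HA]|v A C HA [SC [vs ->]]]| |].
  - apply (sat_embed _ (@no_preds M)). now apply inductive_class_PA.
  - revert A HA. apply sat_compositional. now apply (Truth0_CT H HS HB).
  - revert e. apply sat_closure. intros e. apply sat_induction.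
    now apply (Truth0_ind H HB).
  - apply sat_GRP. intros a _. now apply (Truth0_GRP H HS HB).
  - apply sat_ASP. intros a _. now apply (Truth0_ASP H HS HB).
Qed.

(** * Arithmetization of the standard syntax *)

Section Standard.
Context {M : str} {X : M -> Prop} (H : inductive_class X).
Implicit Types x y z w : M.

Notation codeT0 := (codeT (M:=M) (fun v => v) (fun _ => None)).

Lemma no_plug_ok : plug_ok (M:=M) (fun v => v) (fun p : Empty_set => match p with end).
Proof. split; now intros []. Qed.

Lemma code_form A : isFormM (code A : M).
Proof. apply (codeF_form H no_plug_ok), none_closing. Qed.

Lemma codeT0_term t : isTermM (codeT0 t).
Proof. apply (codeT_term H), none_closing. Qed.

Lemma code_free w A : FreeInM w (code A) <-> exists v, In v (fv A) /\ w = numM v.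
Proof.
  unfold code. rewrite (codeF_free H (fun u v E => E) no_plug_ok) by apply none_closing.
  split; [intros (v & K1 & _ & K2)|intros (v & K1 & K2)]; eauto.
Qed.

Lemma codeT0_free w t : FreeInM w (codeT0 t) <-> exists v, In v (fvt t) /\ w = numM v.
Proof.
  rewrite (codeT_free H) by apply none_closing.
  split; [intros (v & K1 & _ & K2)|intros (v & K1 & K2)]; eauto.
Qed.

Lemma code_ex v A : code (FEx v A) = cExM (M:=M) (numM v) (code A).
Proof. unfold code. simpl. now rewrite upd_None. Qed.

Lemma code_all v A : code (FAll v A) = cAllM (M:=M) (numM v) (code A).
Proof. unfold code. simpl. now rewrite upd_None. Qed.

Lemma codeT_substt v r t :
  codeT (fun v => v) (upd (fun _ => None) v (Some (codeT0 r))) t = codeT0 (substt v r t).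
Proof.
  induction t as [u| |t IH|s IHs t IHt|s IHs t IHt]; simpl; try congruence.
  unfold upd. now destruct (u =? v).
Qed.

Lemma codeF_subst v r (A : LPA) :
  codeF (fun v => v) (fun p : Empty_set => match p return M -> M with end)
    (upd (fun _ => None) v (Some (codeT0 r))) A = code (subst v r A).
Proof.
  unfold code. induction A as [s t|[]|A IH|A IHA B IHB|A IHA B IHB|u A IH|u A IH];
    simpl; rewrite ?codeT_substt; try congruence.
  - destruct (Nat.eqb_spec u v) as [->|N].
    + now rewrite upd_upd_same.
    + rewrite upd_comm, upd_None by auto. now rewrite IH.
  - destruct (Nat.eqb_spec u v) as [->|N].
    + now rewrite upd_upd_same.
    + rewrite upd_comm, upd_None by auto. now rewrite IH.
Qed.

Lemma code_sub v r A : SubM (code A) (numM v) (codeT0 r) (code (subst v r A)).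
Proof.
  rewrite <- codeF_subst.
  apply (codeF_sub H (fun u v E => E) no_plug_ok); auto using none_closing.
Qed.

Lemma code_freeFor r v A : free_for r v A -> FreeForM (codeT0 r) (numM v) (code A).
Proof.
  assert (Q : forall (u : nat) t, ~ In u (fvt t) -> ~ FreeInM (numM u) (codeT0 t)).
  { intros u t N K. apply codeT0_free in K as (w & K & E). apply (numM_inj H) in E.
    congruence. }
  assert (Q' : forall (u : nat) B, ~ In u (fv B) -> ~ FreeInM (numM u) (code B : M)).
  { intros u B N K. apply code_free in K as (w & K & E). apply (numM_inj H) in E.
    congruence. }
  induction A as [s t|[]|A IH|A IHA B IHB|A IHA B IHB|u A IH|u A IH]; simpl; intros K.
  - apply (freeFor_eq H).
  - apply (freeFor_neg H). now apply IH.
  - apply (freeFor_and H). split; tauto.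
  - apply (freeFor_or H). split; tauto.
  - rewrite code_ex. apply (freeFor_ex H). destruct K as [K|[K1 K2]].
    + left. rewrite <- code_ex. now apply Q'.
    + right. split; auto.
  - rewrite code_all. apply (freeFor_all H). destruct K as [K|[K1 K2]].
    + left. rewrite <- code_all. now apply Q'.
    + right. split; auto.
Qed.

Definition codeL (G : list LPA) : M := fold_right (fun A l => consM (code A) l) o0 G.

Lemma codeL_mem x G : MemM x (codeL G) <-> exists A, In A G /\ x = code A.
Proof.
  induction G as [|A G IH]; simpl.
  - split; [intros K; now apply (mem_nil H) in K|now intros (A & [] & _)].
  - rewrite (mem_cons H), IH. split.
    + intros [<-|(B & HB & E)]; eauto.
    + intros (B & [<-|HB] & ->); eauto.
Qed.

Lemma codeL_form G : isFormListM (codeL G).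
Proof.
  induction G as [|A G IH]; simpl; [apply (isFormList_nil H)|].
  apply (isFormList_cons H). split; auto. apply code_form.
Qed.

Lemma code_sent A : sentence A -> isSentM (code A : M).
Proof.
  intros SA. split; [apply code_form|]. intros v K. apply code_free in K as (u & K & _).
  rewrite SA in K. destruct K.
Qed.

Lemma code_PA A : sentence A -> PA A -> AxPAM (code A : M).
Proof.
  intros SA [B HB|v B C [SC [vs E]]]; [left; eauto|right].
  split; [now apply code_sent|]. exists (code (induction v B)). split.
  - exists (numM v), (code B), (code (subst v Zero B)), (code (subst v (Succ (Var v)) B)).
    eexists _, _. split; [apply code_form|]. split; [apply (code_sub v Zero B)|].
    split; [apply (code_sub v (Succ (Var v)) B)|]. split; [reflexivity|].
    split; [reflexivity|]. unfold code, induction. simpl. now rewrite !upd_None.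
  - subst C. clear SC SA. induction vs as [|u vs IH]; simpl; rewrite (GeneralizesM_eq H).
    + now left.
    + right. rewrite code_all. eauto.
Qed.

(** ** Coding of proofs *)

Lemma proof0 G D : isFormListM G -> isFormListM D -> Rule0M AxPAM G D ->
  exists d, isProofM (M:=M) AxPAM d /\ ConclM d G D.
Proof.
  intros LG LD R. exists (pairM (pairM G D) o0). split; [|now exists o0].
  apply (isProofM_eq H). exists G, D. auto.
Qed.

Lemma proof1 G1 D1 G D : isFormListM G -> isFormListM D ->
  (exists d, isProofM (M:=M) AxPAM d /\ ConclM d G1 D1) -> Rule1M G1 D1 G D ->
  exists d, isProofM (M:=M) AxPAM d /\ ConclM d G D.
Proof.
  intros LG LD (d & Hd & Cd) R. exists (pairM (pairM G D) (consM d o0)).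
  split; [|eexists; reflexivity]. apply (isProofM_eq H). exists G, D.
  split; auto. split; auto. right; left. exists d, G1, D1. auto.
Qed.

Lemma proof2 G1 D1 G2 D2 G D : isFormListM G -> isFormListM D ->
  (exists d, isProofM (M:=M) AxPAM d /\ ConclM d G1 D1) ->
  (exists d, isProofM (M:=M) AxPAM d /\ ConclM d G2 D2) -> Rule2M G1 D1 G2 D2 G D ->
  exists d, isProofM (M:=M) AxPAM d /\ ConclM d G D.
Proof.
  intros LG LD (d1 & Hd1 & Cd1) (d2 & Hd2 & Cd2) R.
  exists (pairM (pairM G D) (consM d1 (consM d2 o0))).
  split; [|eexists; reflexivity]. apply (isProofM_eq H). exists G, D.
  split; auto. split; auto. right; right. exists d1, G1, D1, d2, G2, D2. auto 10.
Qed.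

Lemma notFreeInSeq_code u G D : (forall B, In B (G ++ D) -> ~ In u (fv B)) ->
  NotFreeInSeqM (numM u) (codeL G) (codeL D).
Proof.
  intros K x Hx F.
  assert (L : exists B, In B (G ++ D) /\ x = code B).
  { destruct Hx as [Hx|Hx]; apply codeL_mem in Hx as (B & HB & ->); exists B;
      rewrite in_app_iff; auto. }
  destruct L as (B & HB & ->). apply code_free in F as (v & Hv & E).
  apply (numM_inj H) in E. subst. now apply (K B HB).
Qed.

(** Each rule of the calculus is matched by the same rule for codes. *)
Lemma LK_proof G D : LK PA G D ->
  exists d, isProofM (M:=M) AxPAM d /\ ConclM d (codeL G) (codeL D).
Proof.
  induction 1 as [A|A S A0|t|s t v A HA|G D G' D' _ IH HG HD|A G D _ IH1 _ IH2
    |A G D _ IH|A G D _ IH|A B G D _ IH|A B G D _ IH1 _ IH2|A B G D _ IH1 _ IH2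
    |A B G D _ IH|v A r G D F _ IH|v A u G D F HF _ IH|v A u G D F HF _ IH
    |v A r G D F _ IH].
  - apply proof0; try apply codeL_form. left. simpl. eauto.
  - apply proof0; try apply codeL_form. right; left. exists (code A).
    split; auto. split; auto. split; [now apply code_sent|now apply code_PA].
  - apply proof0; try apply codeL_form. right; right; left. now exists (codeT0 t).
  - apply proof0; try apply codeL_form. do 3 right.
    destruct A as [p q|[]| | | | |]; try destruct HA.
    exists (codeT0 s), (codeT0 t), (numM v), (codeT0 p), (codeT0 q).
    exists (code (subst v s (FEq p q))), (code (subst v t (FEq p q))).
    do 2 (split; [apply codeT0_term|]). do 2 (split; [reflexivity|]).
    split; apply (code_sub v _ (FEq p q)).
  - eapply proof1; try apply codeL_form; [exact IH|]. left. intros x. rewrite !codeL_mem.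
    split; intros (A & HA & E); eauto.
  - eapply proof2; try apply codeL_form; [exact IH1|exact IH2|]. left. now exists (code A).
  - eapply proof1; try apply codeL_form; [exact IH|]. right; left. now exists (code A).
  - eapply proof1; try apply codeL_form; [exact IH|]. do 2 right; left. now exists (code A).
  - eapply proof1; try apply codeL_form; [exact IH|]. do 3 right; left.
    now exists (code A), (code B), (codeL G).
  - eapply proof2; try apply codeL_form; [exact IH1|exact IH2|]. right; left.
    now exists (code A), (code B), (codeL D).
  - eapply proof2; try apply codeL_form; [exact IH1|exact IH2|]. right; right.
    now exists (code A), (code B), (codeL G).
  - eapply proof1; try apply codeL_form; [exact IH|]. do 4 right; left.
    now exists (code A), (code B), (codeL D).
  - eapply proof1; try apply codeL_form; [exact IH|]. do 5 right; left.
    exists (numM v), (code A), (codeT0 r), (code (subst v r A)), (codeL G).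
    split; [apply codeT0_term|]. split; [now apply code_freeFor|].
    split; [apply code_sub|]. simpl. rewrite code_all. auto.
  - eapply proof1; try apply codeL_form; [exact IH|]. do 7 right; left.
    exists (numM v), (code A), (numM u), (code (subst v (Var u) A)), (codeL D).
    split; [now apply notFreeInSeq_code|]. split; [now apply (code_freeFor (r:=Var u))|].
    split; [apply (code_sub v (Var u))|]. simpl. rewrite code_all. auto.
  - eapply proof1; try apply codeL_form; [exact IH|]. do 8 right.
    exists (numM v), (code A), (numM u), (code (subst v (Var u) A)), (codeL G).
    split; [now apply notFreeInSeq_code|]. split; [now apply (code_freeFor (r:=Var u))|].
    split; [apply (code_sub v (Var u))|]. simpl. rewrite code_ex. auto.
  - eapply proof1; try apply codeL_form; [exact IH|]. do 6 right; left.
    exists (numM v), (code A), (codeT0 r), (code (subst v r A)), (codeL D).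
    split; [apply codeT0_term|]. split; [now apply code_freeFor|].
    split; [apply code_sub|]. simpl. rewrite code_ex. auto.
Qed.

Lemma provable_Pr A : provable PA A -> PrM (M:=M) AxPAM (code A).
Proof. intros K. apply (LK_proof K). Qed.

(** ** Standard codes in a structure *)

Lemma numM_add m n : numM (M:=M) (m + n) = numM m ⊕ numM n.
Proof.
  induction m as [|m IH].
  - symmetry. apply (add0x H).
  - change (oS (numM (M:=M) (m + n)) = oS (numM m) ⊕ numM n). rewrite IH.
    symmetry. apply (addSx H).
Qed.

Lemma numM_mul m n : numM (M:=M) (m * n) = numM m ⊗ numM n.
Proof.
  induction m as [|m IH].
  - symmetry. apply (mul0x H).
  - change (numM (M:=M) (n + m * n) = oS (numM m) ⊗ numM n).
    rewrite numM_add, IH, (mulSx H). apply (addC H).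
Qed.

Lemma numM_pair (m n : natM) : numM (M:=M) (pairM m n) = pairM (numM m) (numM n).
Proof.
  unfold pairM at 2. rewrite <- numM_add, <- numM_mul, <- numM_add. reflexivity.
Qed.

Lemma numM_num n : numM (M:=M) (numM (M:=natM) n) = numM n.
Proof. now rewrite numM_nat. Qed.

Lemma numM_codeT t :
  numM (M:=M) (codeT (M:=natM) (fun v => v) (fun _ => None) t) = codeT0 t.
Proof.
  induction t; cbn [codeT]; unfold_codes; rewrite !numM_pair, !numM_num; congruence.
Qed.

Lemma numM_code A : numM (M:=M) (code (M:=natM) A) = code A.
Proof.
  unfold code. induction A as [s t|[]|A IH|A IHA B IHB|A IHA B IHB|u A IH|u A IH];
    cbn [codeF]; rewrite ?upd_None; unfold_codes; rewrite !numM_pair, !numM_num;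
    rewrite ?numM_codeT; congruence.
Qed.

Lemma numeral_num n x : NumeralM (numM n) x <-> x = codeT0 (num n).
Proof.
  revert x. induction n as [|n IH]; intros x.
  - apply (numeral_0 H).
  - change (NumeralM (oS (numM n)) x <-> x = cSuccM (codeT0 (num n))).
    rewrite (numeral_S H). setoid_rewrite IH. split; [now intros (m & -> & ->)|eauto].
Qed.

End Standard.

(** * A sentence that asserts its own unprovability *)

Section Diagonal.
Local Open Scope arith_scope.

(* The code in question is that of [forall v0, v0 = n -> A], where [x] is the
   code of [A] and [n] the numeral of [x]: the diagonal instance of [A], written
   without a substitution. *)
Definition Diagonal (x : term) : bform Empty_set :=
  ∀ n, Numeral x n →
    ¬ Pr (AxPA (P:=Empty_set)) (cAll (num 0) (cImp (cEq (cVar (num 0)) n) x)).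

End Diagonal.

Definition DiagonalM (M : str) (x : M) : Prop :=
  forall n, NumeralM x n ->
    ~ PrM AxPAM (cAllM (numM 0) (cImpM (cEqM (cVarM (numM 0)) n) x)).

Lemma diagonal_formula : exists D : LPA, (forall v, In v (fv D) -> v = 0) /\
  forall (M : str) (e : nat -> M), sat (@no_preds M) e D <-> DiagonalM (e 0).
Proof.
  destruct (restrict_fv (Diagonal (Var 0) 1)) as (D & fvD & SD). exists D. split; auto.
  intros M e. rewrite SD.
  set (e0 := fun v => if v =? 0 then e 0 else o0).
  assert (Hx : TRel e0 1 (Var 0) (e 0)) by now apply trel_0.
  assert (HA : RRel (@no_preds M) e0 1 (AxPA (P:=Empty_set)) AxPAM).
  { intros e' n' t a _. apply bsem_AxPA. }
  change (BSem (@no_preds M) e0 1 (Diagonal (Var 0)) (DiagonalM (e 0))).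
  unfold Diagonal, DiagonalM. bsem.
Qed.

Lemma fvt_num n : fvt (num n) = [].
Proof. induction n; auto. Qed.

Lemma eval_num (M : str) (e : nat -> M) n : eval e (num n) = numM n.
Proof. induction n as [|n IH]; auto. simpl. now rewrite IH. Qed.

Lemma goedel_sentence : exists G : LPA, sentence G /\
  forall (M : str) (X : M -> Prop), inductive_class X -> forall e,
    sat (@no_preds M) e G <-> ~ PrM AxPAM (code (M:=M) G).
Proof.
  destruct diagonal_formula as (D & fvD & SD).
  set (d := code (M:=natM) D : nat).
  exists (FAll 0 (FImp (FEq (Var 0) (num d)) D)). split.
  - apply nil_of_notin. intros v Hv. apply in_remove in Hv as [Hv N]. apply N.
    apply in_app_or in Hv as [Hv|Hv]; auto.
    apply in_app_or in Hv as [[Hv|[]]|Hv]; auto. rewrite fvt_num in Hv. destruct Hv.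
  - intros M X H e.
    assert (E : sat (@no_preds M) e (FAll 0 (FImp (FEq (Var 0) (num d)) D)) <->
                DiagonalM (numM (M:=M) d)).
    { unfold FImp. cbn [sat eval]. split.
      - intros K. destruct (K (numM d)) as [K'|K'].
        + rewrite eval_num, upd_same in K'. tauto.
        + apply SD in K'. now rewrite upd_same in K'.
      - intros K x. rewrite eval_num, upd_same.
        destruct (classic (x = numM d)) as [->|N]; [right|now left].
        apply SD. now rewrite upd_same. }
    rewrite E. unfold DiagonalM. setoid_rewrite (numeral_num H).
    assert (C : code (FAll 0 (FImp (FEq (Var 0) (num d)) D)) =
      cAllM (numM 0) (cImpM (cEqM (cVarM (numM 0))
        (codeT (fun v => v) (fun _ => None) (num d))) (numM (M:=M) d))).
    { rewrite code_all. unfold d. rewrite (numM_code H). reflexivity. }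
    rewrite C. split; [intros K; now apply K|now intros K n ->].
Qed.

(** The Goedel sentence is provable in [CT0] by reflection for the defined truth
    predicate, and not in PA by soundness of PA in the standard model. *)
Theorem CT0_not_conservative :
  exists A : LPA, sentence A /\ provable CT0 (embed A) /\ ~ provable PA A.
Proof.
  destruct goedel_sentence as (G & SG & K). exists G. split; auto. split.
  - apply completeness; [now apply sentence_embed|].
    intros M I HM e. rewrite (model_unit I) in *.
    assert (HT : CT0_structure (I tt)) by (apply CT0_model_structure; auto).
    destruct truth_definition as (T' & _ & HT').
    destruct (HT' M (I tt) HT) as (Sat & HS & HB & _).
    pose proof (ct0_pa HT) as H.
    apply (sat_embed _ (@no_preds M)). apply (K M _ H). intros P.
    pose proof (Truth0_GRP H HS HB (Truth0_ASP H HS HB) P) as L.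
    apply (truth_of_standard H HS HB e SG) in L. now apply (K M _ H) in L.
  - intros P. pose proof (natM_inductive (fun _ => False)) as H.
    destruct (LK_sound (M:=natM) (I:=@no_preds natM) (Ax:=PA)) with
      (G:=@nil LPA) (D:=[G]) (e:=fun _ : nat => 0) as (B & [<-|[]] & S); auto.
    + intros A e _ HA. now apply inductive_class_PA.
    + intros A [].
    + apply (K natM _ H) in S. apply S. now apply (provable_Pr H).
Qed.

Theorem theorem13 :
  PA_relatively_definable CT0_GRP_ASP CT0 /\
  (exists A : form Empty_set,
     sentence A /\ provable CT0 (embed A) /\ ~ provable PA A).
Proof. exact (conj CT0_defines_GRP_ASP CT0_not_conservative). Qed.
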